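(* Let $d\ge 2$, $m\geq 1$, $a=(a_1,\dots,a_m)\in\mathbb{R}_{\ge 0}^m$, let $b\in\mathbb{R}^d$ be a regular value of $f^a$, and let $U\subset\mathbb{R}^d$ be an open set consisting of regular values of $f^a$ and containing $b$. If $\sharp(a)=m$, then the holonomy group $\mathcal{H}_b(U)$ acts transitively on each connected component of $M_b$.
   Context: $S^{d-1}$ is the unit sphere of $\mathbb{R}^d$ with its standard metric, and $(S^{d-1})^m$ carries the product Riemannian metric. Define $f^a:(S^{d-1})^m\to\mathbb{R}^d$ by $f^a(z_1,\dots,z_m)=\sum_{j=1}^m a_jz_j$, and $M_b=(f^a)^{-1}(b)$. For $z\in(S^{d-1})^m$ let $\Delta^a_z$ be the orthogonal complement of $\ker T_zf^a$ in $T_z(S^{d-1})^m$. A $\Delta^a$-curve (horizontal curve) is a piecewise smooth curve whose velocity at each time lies in $\Delta^a$. $\sharp(a)$ is the number of distinct non-zero values in the sequence $a_1,\dots,a_m$; so $\sharp(a)=m$ means that the $a_i$ are non-zero and pairwise distinct. Holonomy: every piecewise smooth loop $c$ at $b$ with image in $U$ has, for every $q\in M_b$, a unique horizontal lift (a $\Delta^a$-curve $\tilde c$ with $f^a\circ\tilde c=c$) starting at $q$. Sending $q$ to the endpoint of this lift defines a diffeomorphism of $M_b$, the holonomy of $c$. The holonomy group $\mathcal{H}_b(U)$ is the group of all diffeomorphisms of $M_b$ obtained in this way from piecewise smooth loops at $b$ in $U$. *)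

(* Defs.v *)
From HB Require Import structures.
From mathcomp Require Import all_boot all_order all_algebra.
From mathcomp Require Import all_classical all_reals all_analysis.

Set Implicit Arguments.
Unset Strict Implicit.
Unset Printing Implicit Defensive.

Import Order.TTheory GRing.Theory Num.Theory.
Import numFieldNormedType.Exports.

Local Open Scope classical_set_scope.
Local Open Scope ring_scope.

(* A point (z_1, ..., z_m) of (R^d)^m is the matrix z : 'M[R]_(m, d) with rows
   z_j.  The norm of the library on matrices is the sup norm; it is used only
   for the topology and for derivatives.  The geometry comes from dotv. *)

Section Geometry.
Context {R : realType} {m d : nat}.
Implicit Types (a : 'I_m -> R) (z V W : 'M[R]_(m, d)) (b : 'rV[R]_d).

Definition dotv (u v : 'rV[R]_d) : R := \sum_(i < d) u 0 i * v 0 i.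

Definition spheres : set 'M[R]_(m, d) :=
  [set z | forall j, dotv (row j z) (row j z) = 1].

Definition tangent z : set 'M[R]_(m, d) :=
  [set V | forall j, dotv (row j z) (row j V) = 0].

(* The metric of (R^d)^m, which induces the product metric on [spheres]. *)
Definition prod_metric V W : R := \sum_(j < m) dotv (row j V) (row j W).

(* f^a is defined on all of (R^d)^m, so that its tangent map at a point z of
   [spheres] is the restriction to [tangent z] of the differential 'd (wsum a) z. *)
Definition wsum a z : 'rV[R]_d := \sum_(j < m) a j *: row j z.

Definition fiber a b : set 'M[R]_(m, d) :=
  [set z | spheres z /\ wsum a z = b].

Definition regular_value a b : Prop :=
  forall z, fiber a b z ->
  forall v : 'rV[R]_d, exists2 V, tangent z V & 'd (wsum a) z V = v.

Definition Tker a z : set 'M[R]_(m, d) :=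
  [set V | tangent z V /\ 'd (wsum a) z V = 0].

Definition Delta a z : set 'M[R]_(m, d) :=
  [set V | tangent z V /\ forall W, Tker a z W -> prod_metric V W = 0].

Definition sharp a : nat := size (undup [seq x <- codom a | x != 0]).

End Geometry.

Section Curves.
Context {R : realType} {V : normedModType R}.

Definition smooth_on (O : set R) (g : R -> V) : Prop :=
  forall n t, O t -> derivable (derive1n n g) t 1.

(* Curves are parametrized by [0, 1]; values elsewhere are irrelevant.
   [piecewise_smooth_along D c]: the curve c is smooth on each closed interval
   of some partition of [0, 1], i.e. it is the restriction of a function g that
   is smooth on a neighbourhood, and its velocities belong to D.  At a partition
   point both one-sided velocities are taken into account.  As the closed
   intervals share their endpoints, such a c is continuous on [0, 1]. *)
Definition piecewise_smooth_along (D : V -> set V) (c : R -> V) : Prop :=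
  exists2 s : seq R, itv_partition 0 1 s &
  forall i, (i < size s)%N ->
  exists (O : set R) (g : R -> V),
    [/\ open O, `[nth 0 (0 :: s) i, nth 0 s i] `<=` O, smooth_on O g &
        forall t, t \in `[nth 0 (0 :: s) i, nth 0 s i] ->
          c t = g t /\ D (c t) (derive1 g t)].

Definition piecewise_smooth (c : R -> V) : Prop :=
  piecewise_smooth_along (fun=> setT) c.

End Curves.

Section Holonomy.
Context {R : realType} {m d : nat}.
Implicit Types (a : 'I_m -> R) (b : 'rV[R]_d) (U : set 'rV[R]_d).

Definition horizontal a (gamma : R -> 'M[R]_(m, d)) : Prop :=
  (forall t, t \in `[0, 1] -> spheres (gamma t)) /\
  piecewise_smooth_along (Delta a) gamma.

Definition loop_in U b (c : R -> 'rV[R]_d) : Prop :=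
  [/\ piecewise_smooth c, c 0 = b, c 1 = b &
      forall t, t \in `[0, 1] -> U (c t)].

Definition horizontal_lift a (c : R -> 'rV[R]_d)
    (gamma : R -> 'M[R]_(m, d)) : Prop :=
  horizontal a gamma /\ forall t, t \in `[0, 1] -> wsum a (gamma t) = c t.

(* h is the holonomy of c: it sends each q to the endpoint of the horizontal
   lift of c starting at q.  (Lifts of loops of regular values exist and are
   unique, so there is exactly one such h, and it is a diffeomorphism.) *)
Definition is_holonomy a b (c : R -> 'rV[R]_d)
    (h : fiber a b -> fiber a b) : Prop :=
  forall q : fiber a b, exists gamma,
    [/\ horizontal_lift a c gamma, gamma 0 = \val q & gamma 1 = \val (h q)].

Definition holonomy_group a b U : set (fiber a b -> fiber a b) :=
  [set h | exists2 c, loop_in U b c & is_holonomy c h].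

End Holonomy.

Arguments holonomy_group {R m d} a b U.

Definition acts_transitively_on {X : Type} (H : set (X -> X)) (C : set X) :
    Prop :=
  (forall h x, H h -> C x -> C (h x)) /\
  (forall x y, C x -> C y -> exists2 h, H h & h x = y).

(* Main.v *)
Require Import Defs.
From HB Require Import structures.
From mathcomp Require Import all_boot all_order all_algebra.
From mathcomp Require Import all_classical all_reals all_analysis.
From mathcomp Require Import ring lra.

Set Implicit Arguments.
Unset Strict Implicit.
Unset Printing Implicit Defensive.

Import Order.TTheory GRing.Theory Num.Theory.
Import numFieldNormedType.Exports.

Local Open Scope classical_set_scope.
Local Open Scope ring_scope.

(** Horizontal curves are the integral curves of [hlift _ (u t)] for controls u,
and they project to the primitives of u.

Why orbits are large.  For a unit vector v, the gradient of z |-> <f(z), v> is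
horizontal, and its flow is explicit: representing a point of the unit sphere
by a light-like line of R^{1+d}, the flow acts on the j-th factor as the Lorentz
boost along v of rapidity a_j t ([boost_curve_derive]).  Conjugating the boosts
along v by the boosts of duration t along an orthogonal unit vector w, and
adding the contributions of t and -t, produces in the j-th factor the
displacement 2 a_j ch(a_j t) times the tangential part of v
([spc_conj_gen_even]).  As the a_j are positive and distinct, the functions
t |-> ch(a_j t) are linearly independent, already on m small values of t
([ch_matrix_unit]), so these displacements span the whole tangent space of the
product of spheres.  A contraction argument ([locally_surjective]) shows that
every point near q is the endpoint of a short horizontal curve from q
([local_reach]); short curves stay over the open set U.  Hence being joined by
such curves is an open equivalence relation, and a connected component of the
fibre lies in a single class.

From curves to holonomies.  The projection of a horizontal curve from x to y in
M_b is a loop c in U.  To obtain an element of the holonomy group, c must have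
lifts from all other points of M_b too.  The equation for these lifts is solved
by Picard iteration, over time steps that are uniform because the part of the
product of spheres over the image of c is compact and the Gram determinant does
not vanish there ([horizontal_flow_exists], [liftable_subdivision]).  Smoothness
in time is inherited from c, and [reach_holonomy] glues the pieces.

Why holonomies preserve components.  Regularity of a value depends only on its
length.  If the loop c passes through 0, then the whole ball that it spans
consists of regular values; otherwise c can be turned onto the ray of b by a
rotation depending continuously on time.  In both cases the lift of c then lies
over a closed convex set of regular values that contains b, and such a part of
the product of spheres retracts onto M_b by the flow of the horizontal field
([fiber_retraction]).  In the second case the endpoint is recovered up to a
rotation fixing b; that rotation is a product of an even number of reflections
fixing b, and it is joined to the identity by moving one mirror onto another
([rotation_component]).  Together this is [lift_component]. *)

(** * Sup norm and entrywise calculus of matrices *)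

Section MatrixNorm.
Context {R : realType} {p q : nat}.
Implicit Types x y : 'M[R]_(p, q).

Lemma mx_norm_leP x (e : R) : 0 <= e ->
  (`|x| <= e <-> forall i j, `|x i j| <= e).
Proof.
move=> e0; rewrite [`|x|]/Num.Def.normr/= mx_normrE; split.
  by move=> h i j; apply: le_trans h; exact: (le_bigmax _ _ (i, j)).
by move=> h; apply: bigmax_le => // -[i j] _; exact: h.
Qed.

Lemma mx_entry_le x i j : `|x i j| <= `|x|.
Proof. by have /(_ (lexx _)) := (mx_norm_leP x (normr_ge0 x)).1. Qed.

Lemma is_derive_mx (M : R -> 'M[R]_(p, q)) (t : R) (D : 'M[R]_(p, q)) :
  is_derive t 1 M D <-> forall i j, is_derive t 1 (fun s => M s i j) (D i j).
Proof.
split=> [[dM <-] i j|h].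
  have /derivable_mxP/(_ i j) dMij := dM.
  by split => //; rewrite derive_mx// mxE.
have dM : derivable M t 1 by apply/derivable_mxP => i j; case: (h i j).
split => //; rewrite derive_mx//; apply/matrixP => i j; rewrite mxE.
by case: (h i j).
Qed.

Lemma continuous_mx {T : topologicalType} (f : T -> 'M[R]_(p, q)) (x : T) :
  (forall i j, {for x, continuous (fun t => f t i j)}) ->
  {for x, continuous f}.
Proof.
move=> h; apply/cvgrPdist_le => e e0; near=> y.
apply/mx_norm_leP; first exact: ltW.
suff : forall ij : 'I_p * 'I_q, `|(f x - f y) ij.1 ij.2| <= e.
  by move=> H i j; exact: (H (i, j)).
near: y; apply: filter_forall => -[i j] /=.
have /cvgrPdist_le/(_ _ e0) := h i j.
by apply: filterS => y; rewrite !mxE.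
Unshelve. all: by end_near. Qed.

End MatrixNorm.

Lemma lipschitz_continuous {R : realType} {V W : normedModType R}
    (f : V -> W) (C : R) :
  (forall x y, `|f x - f y| <= C * `|x - y|) -> continuous f.
Proof.
move=> h x; apply/cvgrPdist_lt => e e0.
have C0 : 0 < `|C| + 1 by rewrite ltr_wpDl.
near=> y; apply: le_lt_trans (h x y) _.
apply: (@le_lt_trans _ _ ((`|C| + 1) * `|x - y|)).
  by rewrite ler_wpM2r// (le_trans (ler_norm _))// lerDl.
rewrite -ltr_pdivlMl//; near: y.
have e1 : 0 < (`|C| + 1)^-1 * e by rewrite mulr_gt0// invr_gt0.
by have /cvgrPdist_lt/(_ _ e1) := @cvg_id _ (nbhs x).
Unshelve. all: by end_near. Qed.

Lemma derive1_val {R : realType} {V : normedModType R} (f : R -> V) (t : R) l :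
  is_derive t 1 f l -> derive1 f t = l.
Proof. by move=> [_ <-]; rewrite derive1E. Qed.

Section ContinuousAlgebra.
Context {R : realType} {T : topologicalType}.

Lemma continuous_sum (I : Type) (r : seq I) (F : I -> T -> R) (x : T) :
  (forall i, continuous_at x (F i)) ->
  continuous_at x (fun t => \sum_(i <- r) F i t).
Proof.
move=> h; elim: r => [|i r IH].
  by under eq_fun do rewrite big_nil; exact: cst_continuous.
under eq_fun do rewrite big_cons.
exact: (@continuousD _ _ _ _ _ _ (h i) IH).
Qed.

Lemma continuous_entry p q (f : T -> 'M[R]_(p, q)) (x : T) i j :
  continuous_at x f -> continuous_at x (fun t => f t i j).
Proof.
move=> cf; apply: (@continuous_comp _ _ _ f (fun M : 'M[R]_(p, q) => M i j)) => //.
exact: coord_continuous.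
Qed.

Lemma continuous_mulmx p q r (f : T -> 'M[R]_(p, q)) (g : T -> 'M[R]_(q, r))
    (x : T) :
  continuous_at x f -> continuous_at x g ->
  continuous_at x (fun t => f t *m g t).
Proof.
move=> cf cg; apply: continuous_mx => i j.
apply: (@eq_ind _ _ (continuous_at x) _ (fun t => (f t *m g t) i j)
  (esym (funext _))); last first.
  move=> t; rewrite mxE; reflexivity.
apply: continuous_sum => k; apply: continuousM; exact: continuous_entry.
Qed.

End ContinuousAlgebra.

(** A closed and bounded set of matrices is the image of a closed and bounded
set of row vectors under the (continuous) reshaping map. *)
Lemma closed_bounded_compact_mx {R : realType} {p q : nat}
    (K : set 'M[R]_(p, q)) (r : R) :
  closed K -> (forall x, K x -> `|x| <= r) -> compact K.
Proof.
move=> Kc Kr.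
have cv : continuous (vec_mx : 'rV[R]_(p * q) -> 'M[R]_(p, q)).
  move=> x; apply: continuous_mx => i j.
  rewrite (_ : (fun t : 'rV[R]_(p * q) => vec_mx t i j) =
               (fun t => t ord0 (mxvec_index i j))).
    exact: coord_continuous.
  by apply/funext => t; rewrite mxE.
rewrite (_ : K = [set vec_mx x | x in vec_mx @^-1` K]); last first.
  apply/seteqP; split => [x Kx|_ [y /= Ky <-]//].
  by exists (mxvec x); rewrite /= ?mxvecK.
apply: continuous_compact; first exact: continuous_subspaceT.
apply: bounded_closed_compact; last exact: closed_comp.
exists r; split; first exact: num_real.
move=> s rs x /= Kx; apply: le_trans (ltW rs).
apply: le_trans (Kr _ Kx).
apply/mx_norm_leP => // i k; rewrite -[x]vec_mxK.
case/mxvec_indexP: k => i' j'; rewrite [i]ord1 mxvecE vec_mxK.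
exact: mx_entry_le.
Qed.

Section ScalarDerivatives.
Context {R : realType}.
Implicit Types (f g : R -> R) (t : R).

Lemma is_deriveD_fun f g t df dg : is_derive t 1 f df -> is_derive t 1 g dg ->
  is_derive t 1 (fun s => f s + g s) (df + dg).
Proof. by move=> hf hg; exact: is_deriveD. Qed.

Lemma is_deriveM_fun f g t df dg : is_derive t 1 f df -> is_derive t 1 g dg ->
  is_derive t 1 (fun s => f s * g s) (df * g t + f t * dg).
Proof.
move=> hf hg.
rewrite addrC [df * _]mulrC; exact: (is_deriveM hf hg).
Qed.

Lemma is_deriveV_fun f t df : f t != 0 -> is_derive t 1 f df ->
  is_derive t 1 (fun s => (f s)^-1) (- (f t)^-1 * (f t)^-1 * df).
Proof.
move=> f0 hf; have := is_deriveV f0 hf; rewrite /GRing.scale/=.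
by rewrite expr2 invfM !mulNr.
Qed.

Lemma is_derive_exp_fun f t df : is_derive t 1 f df ->
  is_derive t 1 (fun s => expR (f s)) (expR (f t) * df).
Proof. by move=> hf; exact: (is_derive1_comp (f := expR)). Qed.

Lemma is_derive_affine f (k l t df : R) : is_derive (k * t + l) 1 f df ->
  is_derive t 1 (fun s => f (k * s + l)) (df * k).
Proof.
move=> hf; apply: (is_derive1_comp (f := f) (g := fun s => k * s + l)) => //.
have := is_deriveD_fun (is_deriveM_fun (is_derive_cst k t 1)
  (is_derive_id t 1)) (is_derive_cst l t 1).
by rewrite mul0r add0r addr0 /cst/= mulr1.
Qed.

Lemma is_derive_sum_fun (I : Type) (r : seq I) (F : I -> R -> R)
    (dF : I -> R) t :
  (forall i, is_derive t 1 (F i) (dF i)) ->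
  is_derive t 1 (fun s => \sum_(i <- r) F i s) (\sum_(i <- r) dF i).
Proof.
move=> h; elim: r => [|i r IH].
  rewrite big_nil (_ : (fun _ => _) = cst 0); last first.
    by apply/funext => s; rewrite big_nil.
  exact: is_derive_cst.
rewrite big_cons (_ : (fun _ => _) = (fun s => F i s + \sum_(j <- r) F j s)).
  exact: is_deriveD_fun.
by apply/funext => s; rewrite big_cons.
Qed.

End ScalarDerivatives.

(** * Functions of class C^n on a set of times *)

Section Ck.
Context {R : realType} {V : normedModType R}.

(** The witness for the derivative is only pinned down on [O], which spares
the algebra below from computing with [derive1n]. *)
Fixpoint Ck (n : nat) (O : set R) (f : R -> V) : Prop :=
  if n is k.+1 then
    exists2 f' : R -> V, forall t, O t -> is_derive t 1 f (f' t) & Ck k O f'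
  else True.

Lemma Ck_ext n (O : set R) (f g : R -> V) : open O ->
  (forall t, O t -> f t = g t) -> Ck n O f -> Ck n O g.
Proof.
move=> oO; case: n => // n fg [f' hf' Cf']; exists f' => // t Ot.
apply: near_eq_is_derive (hf' t Ot).
by have := oO t Ot; exact: filterS.
Qed.

Lemma CkW n (O : set R) (f : R -> V) : Ck n.+1 O f -> Ck n O f.
Proof.
elim: n f => // n IH f [f' hf' Cf']; exists f' => //; exact: IH.
Qed.

Lemma Ck_smooth (O : set R) (f : R -> V) : open O ->
  (forall n, Ck n O f) -> smooth_on O f.
Proof.
move=> oO Cf n; elim: n f Cf => [|n IH] f Cf t Ot.
  by have [f' /(_ t Ot)[]] := Cf 1%N.
rewrite /derive1n iterSr; apply: IH => // k.
have [f' hf' Cf'] := Cf k.+1.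
apply: Ck_ext Cf' => // s Os; rewrite derive1E.
by have [_ ->] := hf' s Os.
Qed.

Lemma Ck_cst n (O : set R) (c : V) : Ck n O (fun=> c).
Proof.
elim: n c => // n IH c; exists (fun=> 0) => // t _; exact: is_derive_cst.
Qed.

Lemma Ck_sub n (O O' : set R) (f : R -> V) : O' `<=` O -> Ck n O f -> Ck n O' f.
Proof.
move=> OO'; elim: n f => // n IH f [f' hf' Cf']; exists f'; last exact: IH.
by move=> t /OO'; exact: hf'.
Qed.

End Ck.

Section CkAlgebra.
Context {R : realType}.
Implicit Types (O : set R) (f g : R -> R).

Lemma CkD n O f g : Ck n O f -> Ck n O g -> Ck n O (fun t => f t + g t).
Proof.
elim: n f g => // n IH f g [f' hf' Cf'] [g' hg' Cg'].
exists (fun t => f' t + g' t); last exact: IH.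
by move=> t Ot; apply: is_deriveD_fun; [exact: hf'|exact: hg'].
Qed.

Lemma CkM n O f g : Ck n O f -> Ck n O g -> Ck n O (fun t => f t * g t).
Proof.
elim: n f g => // n IH f g Cf Cg.
have Cf0 := CkW Cf; have Cg0 := CkW Cg.
move: Cf Cg => [f' hf' Cf'] [g' hg' Cg'].
exists (fun t => f' t * g t + f t * g' t).
  by move=> t Ot; apply: is_deriveM_fun; [exact: hf'|exact: hg'].
by apply: CkD; exact: IH.
Qed.

Lemma CkZ n O (k : R) f : Ck n O f -> Ck n O (fun t => k * f t).
Proof. by move=> h; apply: CkM => //; exact: Ck_cst. Qed.

Lemma CkN n O f : Ck n O f -> Ck n O (fun t => - f t).
Proof.
by move=> /(CkZ (- 1)); under eq_fun do rewrite mulN1r.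
Qed.

Lemma CkB n O f g : Ck n O f -> Ck n O g -> Ck n O (fun t => f t - g t).
Proof. by move=> hf /CkN; exact: CkD. Qed.

Lemma CkV n O f : (forall t, O t -> f t != 0) ->
  Ck n O f -> Ck n O (fun t => (f t)^-1).
Proof.
move=> f0; elim: n => // n IH Cf; have {}IH := IH (CkW Cf).
have [f' hf' Cf'] := Cf.
exists (fun t => - (f t)^-1 * (f t)^-1 * f' t).
  by move=> t Ot; apply: is_deriveV_fun; [exact: f0|exact: hf'].
by apply: CkM => //; apply: CkM => //; exact: CkN.
Qed.

Lemma Ck_exp n O f : Ck n O f -> Ck n O (fun t => expR (f t)).
Proof.
elim: n => // n IH Cf; have {}IH := IH (CkW Cf); have [f' hf' Cf'] := Cf.
exists (fun t => expR (f t) * f' t); last exact: CkM.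
by move=> t Ot; apply: is_derive_exp_fun; exact: hf'.
Qed.

Lemma Ck_affine n O (k l : R) f : Ck n O f ->
  Ck n [set t | O (k * t + l)] (fun t => f (k * t + l)).
Proof.
elim: n f => // n IH f [f' hf' Cf']; exists (fun t => f' (k * t + l) * k).
  by move=> t Ot; apply: is_derive_affine; exact: hf'.
by apply: CkM; [exact: IH|exact: Ck_cst].
Qed.

Lemma Ck_id n O : Ck n O (fun t : R => t).
Proof.
case: n => // n; exists (fun=> 1); last exact: Ck_cst.
by move=> t _; exact: is_derive_id.
Qed.

Lemma Ck_sum n O (I : Type) (r : seq I) (P : pred I) (F : I -> R -> R) :
  (forall i, Ck n O (F i)) -> Ck n O (fun t => \sum_(i <- r | P i) F i t).
Proof.
move=> h; elim: r => [|i r IH].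
  by under eq_fun do rewrite big_nil; exact: Ck_cst.
under eq_fun do rewrite big_cons; case: (P i) => //.
exact: CkD.
Qed.

Lemma Ck_prod n O (I : Type) (r : seq I) (P : pred I) (F : I -> R -> R) :
  (forall i, Ck n O (F i)) -> Ck n O (fun t => \prod_(i <- r | P i) F i t).
Proof.
move=> h; elim: r => [|i r IH].
  by under eq_fun do rewrite big_nil; exact: Ck_cst.
under eq_fun do rewrite big_cons; case: (P i) => //.
exact: CkM.
Qed.

Lemma Ck_det n O k (A : R -> 'M[R]_k) :
  (forall i j, Ck n O (fun t => A t i j)) -> Ck n O (fun t => \det (A t)).
Proof.
move=> h; apply: Ck_sum => s; apply: CkM; first exact: Ck_cst.
by apply: Ck_prod => i; exact: h.
Qed.

Lemma Ck_adj n O k (A : R -> 'M[R]_k) i j :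
  (forall i j, Ck n O (fun t => A t i j)) -> Ck n O (fun t => (\adj (A t)) i j).
Proof.
move=> h; under eq_fun do rewrite mxE.
apply: CkM; first exact: Ck_cst.
apply: Ck_det => i' j'; under eq_fun do rewrite !mxE.
exact: h.
Qed.

Lemma Ck_mx n O p q (M : R -> 'M[R]_(p, q)) :
  (forall i j, Ck n O (fun t => M t i j)) -> Ck n O M.
Proof.
elim: n M => // n IH M h.
have /choice [D hD] : forall ij : 'I_p * 'I_q, exists f',
    (forall t, O t -> is_derive t 1 (fun t => M t ij.1 ij.2) (f' t)) /\
    Ck n O f'.
  by move=> ij; have [f' ? ?] := h ij.1 ij.2; exists f'.
exists (fun t => \matrix_(i, j) D (i, j) t).
  move=> t Ot; apply/is_derive_mx => i j; rewrite mxE.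
  by have [/(_ t Ot)] := hD (i, j).
apply: IH => i j; under eq_fun do rewrite mxE.
by have [] := hD (i, j).
Qed.

Lemma Ck_entry n O p q (M : R -> 'M[R]_(p, q)) i j :
  Ck n O M -> Ck n O (fun t => M t i j).
Proof.
elim: n M => // n IH M [M' hM' CM'].
exists (fun t => M' t i j); last exact: IH.
by move=> t Ot; have /is_derive_mx := hM' t Ot.
Qed.

Lemma Ck_affine_mx n O (k l : R) p q (M : R -> 'M[R]_(p, q)) : Ck n O M ->
  Ck n [set t | O (k * t + l)] (fun t => M (k * t + l)).
Proof.
move=> CM; apply: Ck_mx => i j.
exact: (Ck_affine k l (Ck_entry i j CM)).
Qed.

Lemma is_derive_affine_mx p q (M : R -> 'M[R]_(p, q)) (k l t : R) D :
  is_derive (k * t + l) 1 M D ->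
  is_derive t 1 (fun s => M (k * s + l)) (k *: D).
Proof.
move=> /is_derive_mx h; apply/is_derive_mx => i j; rewrite mxE mulrC.
exact: (is_derive_affine (f := fun s => M s i j)).
Qed.

Lemma Ck1_derivable O p q (M : R -> 'M[R]_(p, q)) t :
  Ck 1 O M -> O t -> is_derive t 1 M (derive1 M t).
Proof. by move=> [M' h _] Ot; have [h1 h2] := h t Ot; rewrite derive1E. Qed.

End CkAlgebra.

(** * Euclidean inner product and the geometry of the weighted sum *)

Section Dotv.
Context {R : realType} {d : nat}.
Implicit Types (u v w : 'rV[R]_d) (k : R).

Lemma dotvE u v : dotv u v = (u *m v^T) 0 0.
Proof. by rewrite mxE; apply: eq_bigr => i _; rewrite mxE. Qed.

Lemma dotvC u v : dotv u v = dotv v u.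
Proof. by apply: eq_bigr => i _; rewrite mulrC. Qed.

Lemma dotvDl u v w : dotv (u + v) w = dotv u w + dotv v w.
Proof. by rewrite !dotvE mulmxDl mxE. Qed.

Lemma dotvZl k u w : dotv (k *: u) w = k * dotv u w.
Proof. by rewrite !dotvE -scalemxAl mxE. Qed.

Lemma dotvNl u w : dotv (- u) w = - dotv u w.
Proof. by rewrite -scaleN1r dotvZl mulN1r. Qed.

Lemma dotvBl u v w : dotv (u - v) w = dotv u w - dotv v w.
Proof. by rewrite dotvDl dotvNl. Qed.

Lemma dotv0l w : dotv 0 w = 0.
Proof. by rewrite -[0](scale0r w) dotvZl mul0r. Qed.

Lemma dotv_suml (I : Type) (r : seq I) (F : I -> 'rV[R]_d) w :
  dotv (\sum_(i <- r) F i) w = \sum_(i <- r) dotv (F i) w.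
Proof.
elim: r => [|i r IH]; first by rewrite !big_nil dotv0l.
by rewrite !big_cons dotvDl IH.
Qed.

Lemma dotvDr u v w : dotv w (u + v) = dotv w u + dotv w v.
Proof. by rewrite dotvC dotvDl !(dotvC w). Qed.

Lemma dotvZr k u w : dotv w (k *: u) = k * dotv w u.
Proof. by rewrite dotvC dotvZl (dotvC w). Qed.

Lemma dotvNr u w : dotv w (- u) = - dotv w u.
Proof. by rewrite dotvC dotvNl (dotvC w). Qed.

Lemma dotvBr u v w : dotv w (u - v) = dotv w u - dotv w v.
Proof. by rewrite dotvDr dotvNr. Qed.

Lemma dotv0r w : dotv w 0 = 0.
Proof. by rewrite dotvC dotv0l. Qed.

Lemma dotv_sumr (I : Type) (r : seq I) (F : I -> 'rV[R]_d) w :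
  dotv w (\sum_(i <- r) F i) = \sum_(i <- r) dotv w (F i).
Proof. by rewrite dotvC dotv_suml; apply: eq_bigr => i _; rewrite dotvC. Qed.

Lemma dotv_ge0 u : 0 <= dotv u u.
Proof. by apply: sumr_ge0 => i _; rewrite -expr2 sqr_ge0. Qed.

Lemma dotv_eq0 u : (dotv u u == 0) = (u == 0).
Proof.
apply/eqP/eqP => [|->]; last exact: dotv0l.
move=> /eqP; rewrite psumr_eq0; last by move=> i _; rewrite -expr2 sqr_ge0.
move=> /allP h; apply/rowP => i; rewrite mxE.
have /= := h i (mem_index_enum i); by rewrite mulf_eq0 orbb => /eqP.
Qed.

Lemma dotv_gt0 u : (0 < dotv u u) = (u != 0).
Proof. by rewrite lt_def dotv_ge0 andbT dotv_eq0. Qed.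

Lemma dotv_delta u (i : 'I_d) : dotv u (delta_mx 0 i) = u 0 i.
Proof.
rewrite /dotv (bigD1 i)//= big1 ?addr0; last first.
  by move=> k /negPf ki; rewrite mxE ki mulr0.
by rewrite mxE !eqxx mulr1.
Qed.

Lemma dotv_mulmx u v (g : 'M[R]_d) : dotv (u *m g) v = dotv u (v *m g^T).
Proof. by rewrite !dotvE trmx_mul trmxK mulmxA. Qed.

Lemma dotv_entry_sqr u i : (u 0 i) ^+ 2 <= dotv u u.
Proof.
rewrite /dotv (bigD1 i)//= -expr2 lerDl; apply: sumr_ge0 => k _.
by rewrite -expr2 sqr_ge0.
Qed.

Lemma continuous_dotv {T : topologicalType} (f g : T -> 'rV[R]_d) (x : T) :
  continuous_at x f -> continuous_at x g ->
  continuous_at x (fun t => dotv (f t) (g t)).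
Proof.
by move=> cf cg; apply: continuous_sum => i; apply: continuousM;
  exact: continuous_entry.
Qed.

Lemma continuous_row {m : nat} (j : 'I_m) :
  continuous (row j : 'M[R]_(m, d) -> 'rV[R]_d).
Proof.
move=> z; apply: continuous_mx => i k.
rewrite (_ : (fun _ => _) = (fun z : 'M[R]_(m, d) => z j k)).
  exact: coord_continuous.
by apply/funext => t; rewrite mxE.
Qed.

End Dotv.

Section WeightedSum.
Context {R : realType} {m d : nat}.
Implicit Types (a : 'I_m -> R) (z V W : 'M[R]_(m, d)) (w : 'rV[R]_d).

Lemma wsumE a : wsum a = mulmx (\row_j a j) :> ('M[R]_(m, d) -> 'rV[R]_d).
Proof.
apply/funext => z; apply/rowP => k; rewrite /wsum summxE mxE.
by apply: eq_bigr => j _; rewrite !mxE.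
Qed.

Lemma wsum_entry a z k : wsum a z 0 k = \sum_j a j * z j k.
Proof. by rewrite wsumE mxE; apply: eq_bigr => j _; rewrite mxE. Qed.

Lemma wsum_mulmx a z (g : 'M[R]_d) : wsum a (z *m g) = wsum a z *m g.
Proof. by rewrite wsumE mulmxA. Qed.

Lemma wsumB a z W : wsum a z - wsum a W = wsum a (z - W).
Proof. by rewrite wsumE mulmxBr. Qed.

Lemma wsum_norm a z : `|wsum a z| <= (\sum_j `|a j|) * `|z|.
Proof.
apply/mx_norm_leP; first by rewrite mulr_ge0// sumr_ge0.
move=> i k; rewrite [i]ord1 wsum_entry mulr_suml.
apply: le_trans (ler_norm_sum _ _ _) _; apply: ler_sum => j _.
by rewrite normrM ler_wpM2l// mx_entry_le.
Qed.

Lemma wsum_continuous a : continuous (wsum a : 'M[R]_(m, d) -> 'rV[R]_d).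
Proof.
apply: (@lipschitz_continuous _ _ _ _ (\sum_j `|a j|)) => x y.
by rewrite wsumB wsum_norm.
Qed.

Lemma diff_wsum a z : 'd (wsum a) z = wsum a :> ('M[R]_(m, d) -> 'rV[R]_d).
Proof.
have := @wsum_continuous a; rewrite wsumE => c.
by rewrite diff_lin.
Qed.

Lemma is_derive_wsum a (z : R -> 'M[R]_(m, d)) (t : R) D :
  is_derive t 1 z D -> is_derive t 1 (fun s => wsum a (z s)) (wsum a D).
Proof.
move=> /is_derive_mx h; apply/is_derive_mx => i k; rewrite [i]ord1 wsum_entry.
under eq_fun do rewrite wsum_entry.
have hj j : is_derive t 1 (fun s => a j * z s j k) (a j * D j k).
  have := is_deriveM_fun (is_derive_cst (a j) t 1) (h j k).
  by rewrite mul0r add0r.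
exact: is_derive_sum_fun.
Qed.

Lemma is_derive_dotv_row (z : R -> 'M[R]_(m, d)) (t : R) D j :
  is_derive t 1 z D ->
  is_derive t 1 (fun s => dotv (row j (z s)) (row j (z s)))
    (dotv (row j D) (row j (z t)) + dotv (row j (z t)) (row j D)).
Proof.
move=> /is_derive_mx h; rewrite -big_split/=.
apply: is_derive_sum_fun => k; apply: is_deriveM_fun;
  by under eq_fun do rewrite mxE; rewrite mxE.
Qed.

(** The horizontal field: on the spheres, its [j]-th component is [a j] times
the tangential part of [w], and these vectors are exactly the gradients of
the functions z |-> <f(z), w>.  The factor |z_j|^2 makes the field tangent to
all products of concentric spheres, so that its integral curves stay on the
spheres without any further argument. *)
Definition hfield a z w : 'M[R]_(m, d) :=
  \matrix_(j, k) (a j * (dotv (row j z) (row j z) * w 0 k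
                         - dotv w (row j z) * z j k)).

Lemma hfieldE a z w j k : hfield a z w j k =
  a j * (dotv (row j z) (row j z) * w 0 k - dotv w (row j z) * z j k).
Proof. by rewrite /hfield mxE. Qed.

Lemma row_hfield a z w j : row j (hfield a z w) =
  a j *: (dotv (row j z) (row j z) *: w - dotv w (row j z) *: row j z).
Proof. by apply/rowP => k; rewrite !mxE. Qed.

Lemma hfield_tangent a z w : tangent z (hfield a z w).
Proof.
move=> j; rewrite row_hfield dotvZr dotvBr !dotvZr (dotvC w).
by rewrite (mulrC (dotv _ w)) subrr mulr0.
Qed.

Lemma hfield_horizontal a z w : spheres z -> Delta a z (hfield a z w).
Proof.
move=> Sz; split; first exact: hfield_tangent.
move=> W [TW]; rewrite diff_wsum => W0.
rewrite /prod_metric (eq_bigr (fun j => dotv w (a j *: row j W))); last first.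
  move=> j _; rewrite row_hfield dotvZl dotvBl !dotvZl Sz TW.
  by rewrite mulr0 subr0 mul1r dotvZr.
by rewrite -dotv_sumr -/(wsum a W) W0 dotv0r.
Qed.

(** The matrix of d_z f (d_z f)^*, for the weight |z_j|^2 as in [hfield]. *)
Definition gram a z : 'M[R]_d :=
  \sum_j (a j) ^+ 2 *: ((dotv (row j z) (row j z))%:M - (row j z)^T *m row j z).

Lemma wsum_hfield a z w : wsum a (hfield a z w) = w *m gram a z.
Proof.
rewrite /wsum /gram mulmx_sumr; apply: eq_bigr => j _.
rewrite row_hfield scalerA -expr2 -scalemxAr mulmxBr mul_mx_scalar mulmxA.
congr (_ *: (_ - _)); rewrite -mul_scalar_mx; congr (_ *m _).
by rewrite [LHS]mx11_scalar !mxE eqxx mulr1n [RHS]mx11_scalar -dotvE.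
Qed.

(** A vector killed by the Gram matrix has no component
tangent to the spheres, so it is orthogonal to the image of d_z f, which is
everything when z lies over a regular value. *)
Lemma gram_det_neq0 a z : spheres z -> regular_value a (wsum a z) ->
  \det (gram a z) != 0.
Proof.
move=> Sz Rz; apply/negP => /det0P[w w0 wG].
have /eqP : dotv (w *m gram a z) w = 0 by rewrite wG dotv0l.
rewrite -wsum_hfield /wsum dotv_suml.
rewrite (eq_bigr (fun j =>
  dotv (a j *: (w - dotv w (row j z) *: row j z))
       (a j *: (w - dotv w (row j z) *: row j z)))); last first.
  move=> j _; rewrite row_hfield Sz !(dotvZl, dotvZr) scale1r.
  rewrite !(dotvBl, dotvBr, dotvZl, dotvZr) Sz (dotvC (row j z)); ring.
rewrite psumr_eq0; last by move=> j _; exact: dotv_ge0.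
move=> /allP h.
have [V TV] := Rz z (conj Sz erefl) w.
rewrite diff_wsum => Vw.
suff : dotv w w = 0 by move/eqP; rewrite dotv_eq0 (negPf w0).
rewrite -{1}Vw /wsum dotv_suml big1// => j _.
have /= := h j (mem_index_enum j); rewrite dotv_eq0 => /eqP h'.
rewrite dotvZl -dotvZr.
have -> : a j *: w = a j *: (dotv w (row j z) *: row j z).
  by apply/eqP; rewrite -subr_eq0 -scalerBr h'.
by rewrite !dotvZr (dotvC (row j V)) TV !mulr0.
Qed.

(** The vector of least length that d_z f maps to [u].  Inverting the Gram matrix
through its adjugate makes every entry a rational function of the entries of
[z], with the Gram determinant as denominator. *)
Definition hlift a z u : 'M[R]_(m, d) :=
  hfield a z ((\det (gram a z))^-1 *: (u *m \adj (gram a z))).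

Lemma wsum_hlift a z u : \det (gram a z) != 0 -> wsum a (hlift a z u) = u.
Proof.
move=> g0; rewrite wsum_hfield -scalemxAl -mulmxA mul_adj_mx mul_mx_scalar.
by rewrite scalerA mulVf// scale1r.
Qed.

Lemma hlift0 a z : hlift a z 0 = 0.
Proof.
rewrite /hlift mul0mx scaler0; apply/matrixP => j k.
by rewrite !mxE dotv0l mul0r mulr0 subrr mulr0.
Qed.

End WeightedSum.

(** * Local solutions of ordinary differential equations *)

Section Geometric.
Context {R : realType}.

Lemma half_pow_small (x c K : R) : 0 <= K ->
  (forall n, x <= c + K / 2 ^+ n) -> x <= c.
Proof.
move=> K0 h; rewrite leNgt; apply/negP => cx.
have e0 : 0 < x - c by rewrite subr_gt0.
have Ke0 : 0 <= K / (x - c) by rewrite divr_ge0// ltW.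
have := archi_boundP Ke0; set n := Num.Def.archi_bound _ => hn.
have := h n; rewrite -lerBlDl; apply/negP; rewrite -ltNge.
rewrite ltr_pdivrMr ?exprn_gt0// mulrC -ltr_pdivrMr//.
apply: lt_trans hn _.
by rewrite -natrX ltr_nat ltn_expl.
Qed.

(** The limit is the supremum of the left endpoints of the intervals of radius
2 K / 2^n around the [u n], any two of which meet. *)
Lemma geometric_limit (u : nat -> R) (K : R) :
  (forall n, `|u n.+1 - u n| <= K / 2 ^+ n) ->
  exists l, forall n, `|l - u n| <= 2 * K / 2 ^+ n.
Proof.
move=> h.
have K0 : 0 <= K by have := le_trans (normr_ge0 _) (h 0%N); rewrite expr0 divr1.
have pow n : 0 < (2 : R) ^+ n by rewrite exprn_gt0.
have hk n k : `|u (n + k)%N - u n| <= 2 * K / 2 ^+ n - 2 * K / 2 ^+ (n + k).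
  elim: k => [|k IH]; first by rewrite addn0 !subrr normr0.
  rewrite addnS -(subrKA (u (n + k)%N)).
  apply: le_trans (ler_normD _ _) _; rewrite addrC.
  apply: le_trans (lerD IH (h _)) _.
  rewrite exprS invfM; set z := (2 ^+ (n + k))^-1; lra.
have hnm n k : u n - 2 * K / 2 ^+ n <= u k + 2 * K / 2 ^+ k.
  have p0 i : 0 <= 2 * K / 2 ^+ i by rewrite divr_ge0 ?mulr_ge0// ltW.
  have := p0 n; have := p0 k.
  case: (leqP n k) => [/subnKC <-|/ltnW/subnKC <-].
    by have := hk n (k - n)%N; rewrite ler_norml => /andP[]; lra.
  by have := hk k (n - k)%N; rewrite ler_norml => /andP[]; lra.
pose A : set R := [set u n - 2 * K / 2 ^+ n | n in setT].
have ubA k : ubound A (u k + 2 * K / 2 ^+ k).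
  by move=> _ [n _ <-]; exact: hnm.
have A0 : A !=set0 by exists (u 0%N - 2 * K / 2 ^+ 0), 0%N.
exists (sup A) => n; rewrite ler_norml; apply/andP; split.
  have : u n - 2 * K / 2 ^+ n <= sup A.
    by apply: ub_le_sup; [exists (u 0%N + 2 * K / 2 ^+ 0)|exists n].
  by lra.
by have := ge_sup A0 (ubA n); lra.
Qed.

End Geometric.

Section MeanValue.
Context {R : realType}.

Lemma mean_value_le (f f' : R -> R) (a b M : R) : a <= b ->
  (forall t, a <= t <= b -> is_derive t 1 f (f' t)) ->
  (forall t, a <= t <= b -> `|f' t| <= M) ->
  `|f b - f a| <= M * (b - a).
Proof.
move=> ab df fM.
have cf : {within `[a, b], continuous f}.
  apply: derivable_within_continuous => t; rewrite in_itv/= => /df[] //.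
have dfo x : x \in `]a, b[%R -> is_derive x 1 f (f' x).
  by rewrite in_itv/= => /andP[ax xb]; apply: df; rewrite !ltW.
have [c cab ->] := MVT_segment ab dfo cf.
have ba : 0 <= b - a by rewrite subr_ge0.
rewrite normrM (ger0_norm ba) ler_wpM2r// fM//.
Qed.

Lemma mean_value_mx p q (f f' : R -> 'M[R]_(p, q)) (a b M : R) : a <= b ->
  (forall t, a <= t <= b -> is_derive t 1 f (f' t)) ->
  (forall t, a <= t <= b -> `|f' t| <= M) ->
  `|f b - f a| <= M * (b - a).
Proof.
move=> ab df fM.
have M0 : 0 <= M by apply: le_trans (fM a _); rewrite ?lexx.
apply/mx_norm_leP; first by rewrite mulr_ge0// subr_ge0.
move=> i j; rewrite !mxE.
apply: (@mean_value_le (fun t => f t i j) (fun t => f' t i j)) => // t tab.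
  by have /is_derive_mx := df t tab.
exact: le_trans (mx_entry_le _ _ _) (fM t tab).
Qed.

End MeanValue.

Lemma const_on_flow_time {R : realType} (f : R -> R) (t : R) :
  (forall s : R, - 1 < s < 2 -> is_derive s 1 f 0) -> - 1 < t < 2 -> f t = f 0.
Proof.
move=> df /andP[t1 t2]; apply/eqP; rewrite -subr_eq0 -normr_le0.
case: (lerP 0 t) => t0.
  rewrite -[leRHS](mul0r (t - 0)); apply: (@mean_value_le _ f (fun=> 0)) => //.
    by move=> s /andP[s1 s2]; apply: df; apply/andP; split; lra.
  by move=> s _; rewrite normr0.
rewrite distrC -[leRHS](mul0r (0 - t)).
apply: (@mean_value_le _ f (fun=> 0)).
- exact: ltW.
- by move=> s /andP[s1 s2]; apply: df; apply/andP; split; lra.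
- by move=> s _; rewrite normr0.
Qed.

Section Picard.
Context {R : realType} {p q : nat}.
Notation E := 'M[R]_(p, q).

Lemma primitive_scalar (g : R -> R) : continuous g ->
  exists G : R -> R, forall t : R, - 2 < t < 3 -> is_derive t 1 G (g t).
Proof.
move=> cg.
pose G x : R := \int[lebesgue_measure]_(t in `[(- 2 : R), x]) g t.
have hG t : - 2 < t < 3 -> derivable G t 1 /\ G^`()%classic t = g t.
  move=> /andP[t2 t3].
  have ig : lebesgue_measure.-integrable `[(- 2 : R), 3] (EFin \o g).
    apply: continuous_compact_integrable; first exact: segment_compact.
    exact: continuous_subspaceT.
  exact: (continuous_FTC1_closed t3 ig t2 (cg t)).
clearbody G; exists G => t /hG[dG Gt].
by split; rewrite -?derive1E.
Qed.

Lemma primitive_mx (g : R -> E) : continuous g ->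
  exists G : R -> E, forall t : R, - 2 < t < 3 -> is_derive t 1 G (g t).
Proof.
move=> cg.
have /choice[G hG] : forall ij : 'I_p * 'I_q, exists G : R -> R,
    forall t : R, - 2 < t < 3 -> is_derive t 1 G (g t ij.1 ij.2).
  move=> [i j] /=; apply: (primitive_scalar (g := fun t => g t i j)) => x.
  apply: (@continuous_comp _ _ _ g (fun M : E => M i j)); first exact: cg.
  exact: coord_continuous.
exists (fun t => \matrix_(i, j) G (i, j) t) => t t23.
apply/is_derive_mx => i j; under eq_fun do rewrite mxE.
exact: (hG (i, j)).
Qed.

Definition clamp_time (t : R) : R := Num.max (- 1) (Num.min t 2).

Lemma clamp_time_itv t : - 1 <= clamp_time t <= 2.
Proof. by rewrite /clamp_time le_max lexx/= ge_max ge_min lexx orbT andbT; lra. Qed.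

Lemma clamp_time_id t : - 1 <= t <= 2 -> clamp_time t = t.
Proof.
by move=> /andP[t1 t2]; rewrite /clamp_time (min_idPl t2) (max_idPr t1).
Qed.

Lemma max_lip (c x y : R) : `|Num.max c x - Num.max c y| <= `|x - y|.
Proof.
by case: (lerP c x); case: (lerP c y) => h1 h2; rewrite ler_norml;
  have := ler_norm (x - y); have := ler_norm (y - x); rewrite (distrC y);
  move=> h3 h4; apply/andP; split; lra.
Qed.

Lemma min_lip (c x y : R) : `|Num.min x c - Num.min y c| <= `|x - y|.
Proof.
by case: (lerP x c); case: (lerP y c) => h1 h2; rewrite ler_norml;
  have := ler_norm (x - y); have := ler_norm (y - x); rewrite (distrC y);
  move=> h3 h4; apply/andP; split; lra.
Qed.

Lemma clamp_time_lip s t : `|clamp_time s - clamp_time t| <= `|s - t|.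
Proof. exact: le_trans (max_lip _ _ _) (min_lip _ _ _). Qed.

(** The contraction is run with time clamped to [-1, 2], so that all iterates
are defined and Lipschitz on the whole line and no interval bookkeeping is
needed; the clamping is invisible on the open interval ]-1, 2[. *)
Lemma picard (F : R -> E -> E) (L M : R) (z0 : E) :
  0 <= L <= 4^-1 ->
  (forall y : R -> E, continuous y -> continuous (fun t => F t (y t))) ->
  (forall t x y, `|F t x - F t y| <= L * `|x - y|) ->
  (forall t x, `|F t x| <= M) ->
  exists2 y : R -> E, y 0 = z0 &
    forall t : R, - 1 < t < 2 -> is_derive t 1 y (F t (y t)).
Proof.
move=> /andP[L0 L4] Fc FL FM.
have M0 : 0 <= M by exact: le_trans (normr_ge0 _) (FM 0 0).
have /choice[I hI] : forall y : R -> E, exists G : R -> E, continuous y ->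
    forall t : R, - 2 < t < 3 -> is_derive t 1 G (F t (y t)).
  move=> y; case: (pselect (continuous y)) => [cy|ncy]; last by exists (fun=> 0).
  by have [G hG] := primitive_mx (Fc y cy); exists G.
(* [I y] is a primitive of the field along the curve [y] *)
pose T (y : R -> E) (t : R) : E := z0 + (I y (clamp_time t) - I y 0).
have Tlip (y : R -> E) (s t : R) : continuous y -> `|T y s - T y t| <= M * `|s - t|.
  move=> cy; wlog ts : s t / clamp_time t <= clamp_time s.
    move=> H; case: (lerP (clamp_time t) (clamp_time s)) => [|/ltW]; first exact: H.
    by move=> /H; rewrite distrC (distrC t).
  have -> : T y s - T y t = I y (clamp_time s) - I y (clamp_time t).
    by rewrite /T; apply/matrixP => i j; rewrite !mxE; ring.
  have /andP[s1 s2] := clamp_time_itv s; have /andP[t1 t2] := clamp_time_itv t.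
  apply: (@le_trans _ _ (M * (clamp_time s - clamp_time t))).
    apply: (@mean_value_mx _ _ _ _ (fun t => F t (y t))) => // x /andP[x1 x2].
    by apply: hI => //; apply/andP; split; lra.
  rewrite ler_wpM2l// (le_trans (ler_norm _))// clamp_time_lip//.
have Tcont (y : R -> E) : continuous y -> continuous (T y).
  move=> cy; apply: (@lipschitz_continuous _ _ _ _ M) => s t; exact: Tlip.
(* an interval of length at most 2 and a Lipschitz constant of at most 1/4 *)
have Tcontr (y y' : R -> E) (e t : R) : continuous y -> continuous y' ->
    (forall s : R, `|y s - y' s| <= e) -> `|T y t - T y' t| <= e / 2.
  move=> cy cy' ye; have e0 : 0 <= e by exact: le_trans (normr_ge0 _) (ye 0).
  pose D (s : R) : E := I y s - I y' s.
  have dD (s : R) : - 2 < s < 3 -> is_derive s 1 D (F s (y s) - F s (y' s)).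
    by move=> s23; apply: is_deriveB; exact: hI.
  have bD (s : R) : `|F s (y s) - F s (y' s)| <= L * e.
    by apply: le_trans (FL _ _ _) _; rewrite ler_wpM2l.
  have -> : T y t - T y' t = D (clamp_time t) - D 0.
    by rewrite /T /D; apply/matrixP => i j; rewrite !mxE; ring.
  have /andP[t1 t2] := clamp_time_itv t.
  have Le0 : 0 <= L * e by rewrite mulr_ge0.
  have Le4 : L * e <= 4^-1 * e by rewrite ler_wpM2r.
  case: (lerP 0 (clamp_time t)) => t0.
    apply: (@le_trans _ _ (L * e * (clamp_time t - 0))).
      apply: (@mean_value_mx _ _ _ _ (fun s => F s (y s) - F s (y' s))) => // x.
      by move=> /andP[x1 x2]; apply: dD; apply/andP; split; lra.
    have : L * e * (clamp_time t - 0) <= L * e * 2 by rewrite ler_wpM2l//; lra.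
    by lra.
  rewrite distrC; apply: (@le_trans _ _ (L * e * (0 - clamp_time t))).
    apply: (@mean_value_mx _ _ _ _ (fun s => F s (y s) - F s (y' s))) => //.
      exact: ltW.
    by move=> x /andP[x1 x2]; apply: dD; apply/andP; split; lra.
  have : L * e * (0 - clamp_time t) <= L * e * 2 by rewrite ler_wpM2l//; lra.
  by lra.
pose Y n : R -> E := iter n T (fun=> z0).
have Yc n : continuous (Y n).
  by elim: n => [|n IH]; [exact: cst_continuous|exact: Tcont].
have Ydiff n (t : R) : `|Y n.+1 t - Y n t| <= 2 * M / 2 ^+ n.
  elim: n t => [|n IH] t.
    rewrite expr0 divr1 /= /T addrC addKr.
    have /andP[t1 t2] := clamp_time_itv t.
    have dI : continuous (fun _ : R => z0) by exact: cst_continuous.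
    case: (lerP 0 (clamp_time t)) => t0.
      apply: (@le_trans _ _ (M * (clamp_time t - 0))).
        apply: (@mean_value_mx _ _ _ _ (fun s => F s z0)) => // x /andP[x1 x2].
        by apply: hI => //; apply/andP; split; lra.
      by rewrite mulrC ler_wpM2r//; lra.
    rewrite distrC; apply: (@le_trans _ _ (M * (0 - clamp_time t))).
      apply: (@mean_value_mx _ _ _ _ (fun s => F s z0)) => //; first exact: ltW.
      by move=> x /andP[x1 x2]; apply: hI => //; apply/andP; split; lra.
    by rewrite mulrC ler_wpM2r//; lra.
  have := Tcontr _ _ _ t (Yc n.+1) (Yc n) IH.
  by rewrite exprSr invfM mulrA.
have /choice[y hy] : forall t : R, exists l : E,
    forall n, `|l - Y n t| <= 4 * M / 2 ^+ n.
  move=> t.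
  have /choice[l hl] : forall ij : 'I_p * 'I_q, exists l : R,
      forall n, `|l - Y n t ij.1 ij.2| <= 2 * (2 * M) / 2 ^+ n.
    move=> [i j] /=; apply: (geometric_limit (u := fun n => Y n t i j)) => n.
    apply: le_trans (Ydiff n t); apply: le_trans (mx_entry_le _ i j).
    by rewrite !mxE.
  exists (\matrix_(i, j) l (i, j)) => n; apply/mx_norm_leP.
    by rewrite divr_ge0 ?mulr_ge0// exprn_ge0.
  move=> i j; rewrite !mxE; apply: le_trans (hl (i, j) n) _.
  by rewrite mulrA -natrM.
have M8 : 0 <= 8 * M by lra.
have ylip (s t : R) : `|y s - y t| <= M * `|s - t|.
  apply: (@half_pow_small _ _ _ (8 * M)) => // n.
  have : `|Y n s - Y n t| <= M * `|s - t|.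
    case: n => [|n]; last exact: Tlip.
    by rewrite /= subrr normr0 mulr_ge0.
  have -> : y s - y t = (y s - Y n s) + (Y n s - Y n t) + (Y n t - y t).
    by rewrite subrKA addrA subrK.
  have := hy s n; have := hy t n; rewrite distrC.
  have := ler_normD (y s - Y n s + (Y n s - Y n t)) (Y n t - y t).
  have := ler_normD (y s - Y n s) (Y n s - Y n t).
  by rewrite -!mulrA; set z := (2 ^+ n)^-1; lra.
have yc : continuous y by exact: (lipschitz_continuous ylip).
have yT (t : R) : y t = T y t.
  apply/eqP; rewrite -subr_eq0 -normr_le0.
  apply: (@half_pow_small _ _ _ (8 * M)) => // n; rewrite add0r.
  have -> : y t - T y t = (y t - Y n.+1 t) + (T (Y n) t - T y t).
    by rewrite addrA subrK.
  apply: le_trans (ler_normD _ _) _.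
  have h1 := hy t n.+1.
  have h2 : `|T (Y n) t - T y t| <= 4 * M / 2 ^+ n / 2.
    by rewrite distrC; apply: Tcontr.
  move: h1 h2; rewrite exprS invfM -!mulrA; set z := (2 ^+ n)^-1.
  have z0' : 0 <= M * z by rewrite mulr_ge0// invr_ge0 exprn_ge0.
  have -> : M * (2^-1 * z) = M * z / 2 by rewrite mulrC -mulrA mulrC (mulrC z).
  have -> : M * (z / 2) = M * z / 2 by rewrite mulrA.
  by lra.
exists y; first by rewrite yT /T clamp_time_id ?subrr ?addr0//; lra.
move=> t t12; apply: (@near_eq_is_derive _ _ _ (fun s => z0 + (I y s - I y 0))).
  have : `]-1, 2[%classic t by rewrite /= in_itv.
  move=> /(near_in_itvoo); apply: filterS => s; rewrite in_itv/= => /andP[s1 s2].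
  by rewrite [RHS]yT /T clamp_time_id// !ltW.
have dI : is_derive t 1 (I y) (F t (y t)).
  by apply: hI => //; case/andP: t12 => *; apply/andP; split; lra.
have -> : F t (y t) = 0 + (F t (y t) - 0) by rewrite add0r subr0.
exact: is_deriveD.
Qed.

(** Continuous dependence on the initial value and on the field: a Gronwall
estimate in the short-time regime, where absorbing the maximum of the
difference into the left-hand side is enough. *)
Lemma ode_compare (y1 y2 f1 f2 : R -> E) (L e : R) :
  0 <= L <= 2^-1 ->
  (forall t : R, 0 <= t <= 1 -> is_derive t 1 y1 (f1 t)) ->
  (forall t : R, 0 <= t <= 1 -> is_derive t 1 y2 (f2 t)) ->
  (forall t : R, 0 <= t <= 1 -> `|f1 t - f2 t| <= L * `|y1 t - y2 t| + e) ->
  `|y1 1 - y2 1| <= 2 * (`|y1 0 - y2 0| + e).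
Proof.
move=> /andP[L0 L2] d1 d2 h.
pose D (t : R) : E := y1 t - y2 t.
have dD (t : R) : 0 <= t <= 1 -> is_derive t 1 D (f1 t - f2 t).
  by move=> t01; apply: is_deriveB; [exact: d1|exact: d2].
have cD : {within `[0, 1], continuous (fun t => `|D t|)}.
  move=> x; apply: continuous_comp; last exact: norm_continuous.
  apply: derivable_within_continuous => {x} t; rewrite in_itv/= => t01.
  by have [] := dD t t01.
have [c c01 cmax] := EVT_max ler01 cD.
have {}c01 : 0 <= c <= 1 by move: c01; rewrite in_itv.
have maxD (t : R) : 0 <= t <= 1 -> `|D t| <= `|D c|.
  by move=> t01; apply: cmax; rewrite in_itv.
have /andP[c0 c1] := c01.
have hc : `|D c - D 0| <= (L * `|D c| + e) * (c - 0).
  apply: (@mean_value_mx _ _ _ _ (fun t => f1 t - f2 t)) => // t /andP[t0 tc].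
    by apply: dD; rewrite t0 (le_trans tc).
  have t01 : 0 <= t <= 1 by rewrite t0 (le_trans tc).
  apply: le_trans (h t t01) _; rewrite lerD2r ler_wpM2l//; exact: maxD.
have Le0 : 0 <= L * `|D c| + e.
  have t01 : 0 <= (0 : R) <= 1 by rewrite lexx ler01.
  apply: le_trans (normr_ge0 _) _; last apply: le_trans (h 0 t01) _.
  by rewrite lerD2r ler_wpM2l// maxD.
have hc' : (L * `|D c| + e) * (c - 0) <= L * `|D c| + e.
  by rewrite subr0 ler_piMr.
have LD : L * `|D c| <= 2^-1 * `|D c| by rewrite ler_wpM2r.
have := ler_normD (D c - D 0) (D 0); rewrite subrK => hn.
have h1 : `|D 1| <= `|D c| by apply: maxD; rewrite lexx ler01.
rewrite -/(D 1) -/(D 0); lra.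
Qed.

End Picard.

(** * Bounded Lipschitz functions *)

Section BoundedLipschitz.
Context {R : realType} {V : normedModType R}.
Implicit Types (D : set V) (f g : V -> R).

Definition bounded_lip D f : Prop :=
  exists2 C : R, 0 <= C & forall x y, D x -> D y ->
    `|f x| <= C /\ `|f x - f y| <= C * `|x - y|.

Lemma bounded_lip_cst D (c : R) : bounded_lip D (fun=> c).
Proof.
exists `|c| => // x y _ _; split => //.
by rewrite subrr normr0 mulr_ge0.
Qed.

Lemma bounded_lipD D f g : bounded_lip D f -> bounded_lip D g ->
  bounded_lip D (fun x => f x + g x).
Proof.
move=> [C C0 hf] [C' C0' hg]; exists (C + C'); first exact: addr_ge0.
move=> x y Dx Dy; have [f1 f2] := hf x y Dx Dy; have [g1 g2] := hg x y Dx Dy.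
split; first by apply: le_trans (ler_normD _ _) _; exact: lerD.
rewrite opprD addrACA mulrDl; apply: le_trans (ler_normD _ _) _; exact: lerD.
Qed.

Lemma bounded_lipM D f g : bounded_lip D f -> bounded_lip D g ->
  bounded_lip D (fun x => f x * g x).
Proof.
move=> [C C0 hf] [C' C0' hg]; exists (C * C' + C * C').
  by rewrite addr_ge0// mulr_ge0.
move=> x y Dx Dy; have [f1 f2] := hf x y Dx Dy; have [g1 g2] := hg x y Dx Dy.
have [f3 _] := hf y x Dy Dx.
split.
  rewrite normrM (le_trans (ler_pM _ _ f1 g1))// lerDl mulr_ge0//.
have -> : f x * g x - f y * g y = (f x - f y) * g x + f y * (g x - g y) by ring.
apply: le_trans (ler_normD _ _) _; rewrite !normrM mulrDl lerD//.
  by rewrite mulrAC ler_pM.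
by rewrite -mulrA ler_pM.
Qed.

Lemma bounded_lipN D f : bounded_lip D f -> bounded_lip D (fun x => - f x).
Proof.
move=> h; under eq_fun do rewrite -mulN1r.
by apply: bounded_lipM => //; exact: bounded_lip_cst.
Qed.

Lemma bounded_lipB D f g : bounded_lip D f -> bounded_lip D g ->
  bounded_lip D (fun x => f x - g x).
Proof. by move=> hf /bounded_lipN; exact: bounded_lipD. Qed.

Lemma bounded_lip_sum D (I : Type) (r : seq I) (P : pred I) (F : I -> V -> R) :
  (forall i, bounded_lip D (F i)) ->
  bounded_lip D (fun x => \sum_(i <- r | P i) F i x).
Proof.
move=> h; elim: r => [|i r IH].
  by under eq_fun do rewrite big_nil; exact: bounded_lip_cst.
under eq_fun do rewrite big_cons; case: (P i) => //.
exact: bounded_lipD.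
Qed.

Lemma bounded_lip_prod D (I : Type) (r : seq I) (P : pred I) (F : I -> V -> R) :
  (forall i, bounded_lip D (F i)) ->
  bounded_lip D (fun x => \prod_(i <- r | P i) F i x).
Proof.
move=> h; elim: r => [|i r IH].
  by under eq_fun do rewrite big_nil; exact: bounded_lip_cst.
under eq_fun do rewrite big_cons; case: (P i) => //.
exact: bounded_lipM.
Qed.

Lemma bounded_lip_det D k (A : V -> 'M[R]_k) :
  (forall i j, bounded_lip D (fun x => A x i j)) ->
  bounded_lip D (fun x => \det (A x)).
Proof.
move=> h; apply: bounded_lip_sum => s; apply: bounded_lipM.
  exact: bounded_lip_cst.
by apply: bounded_lip_prod => i; exact: h.
Qed.

Lemma bounded_lip_adj D k (A : V -> 'M[R]_k) i j :
  (forall i j, bounded_lip D (fun x => A x i j)) ->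
  bounded_lip D (fun x => (\adj (A x)) i j).
Proof.
move=> h; under eq_fun do rewrite mxE.
apply: bounded_lipM; first exact: bounded_lip_cst.
apply: bounded_lip_det => i' j'; under eq_fun do rewrite !mxE.
exact: h.
Qed.

Lemma bounded_lipV D f (del : R) : 0 < del ->
  (forall x, D x -> del <= `|f x|) ->
  bounded_lip D f -> bounded_lip D (fun x => (f x)^-1).
Proof.
move=> d0 fd [C C0 hf]; exists (del^-1 + del^-1 * del^-1 * C).
  by rewrite addr_ge0 ?mulr_ge0// invr_ge0 ltW.
have inv x : D x -> `|(f x)^-1| <= del^-1.
  by move=> Dx; rewrite normfV lef_pV2 ?posrE ?fd// (lt_le_trans d0) ?fd.
have f0 x : D x -> f x != 0 by move=> /fd h; rewrite -normr_gt0 (lt_le_trans d0).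
have di : 0 <= del^-1 by rewrite invr_ge0 ltW.
move=> x y Dx Dy; split.
  by apply: le_trans (inv x Dx) _; rewrite lerDl !mulr_ge0.
have [_ fxy] := hf x y Dx Dy.
have -> : (f x)^-1 - (f y)^-1 = - ((f x)^-1 * (f y)^-1 * (f x - f y)).
  by have := f0 x Dx; have := f0 y Dy => *; field; apply/andP.
rewrite normrN !normrM mulrDl.
apply: (@le_trans _ _ (del^-1 * del^-1 * C * `|x - y|)).
  by rewrite -[leRHS]mulrA ler_pM ?mulr_ge0// ler_pM// inv.
by rewrite lerDr mulr_ge0.
Qed.

End BoundedLipschitz.

(** * Horizontal flows near a compact set of regular points *)

Section HorizontalFlow.
Context {R : realType} {m d : nat}.
Notation E := 'M[R]_(m, d).
Implicit Types (a : 'I_m -> R) (z : E).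

Lemma spheres_norm z : spheres z -> `|z| <= 1.
Proof.
move=> Sz; apply/mx_norm_leP => // j k.
have := dotv_entry_sqr (row j z) k; rewrite Sz mxE => h.
by rewrite -(@ler_pXn2r _ 2)// ?nnegrE// real_normK ?num_real// expr1n.
Qed.

Lemma closed_spheres : closed (spheres : set E).
Proof.
have -> : (spheres : set E) =
    \bigcap_(j in setT) [set z | dotv (row j z) (row j z) = 1].
  by apply/seteqP; split => z h; [move=> j _; exact: h | move=> j; exact: (h j)].
apply: closed_bigI => j _.
rewrite (_ : [set _ | _] = (fun z : E => dotv (row j z) (row j z)) @^-1` [set 1]) //.
apply: closed_comp; last exact: closed_eq.
by move=> z _; apply: continuous_dotv; exact: continuous_row.
Qed.

Lemma hliftD a z u v : hlift a z (u + v) = hlift a z u + hlift a z v.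
Proof.
rewrite /hlift mulmxDl scalerDr; set w := _ *: (u *m _).
set w' := _ *: (v *m _); apply/matrixP => j k.
by rewrite /hfield !mxE dotvDl; ring.
Qed.

Lemma hliftZ a z (k : R) u : hlift a z (k *: u) = k *: hlift a z u.
Proof.
rewrite /hlift -scalemxAl scalerA mulrC -scalerA; set w := _ *: (u *m _).
by apply/matrixP => j i; rewrite /hfield !mxE dotvZl; ring.
Qed.

Lemma hliftB a z u v : hlift a z (u - v) = hlift a z u - hlift a z v.
Proof. by rewrite hliftD -scaleN1r hliftZ scaleN1r. Qed.

Lemma hlift_coord a z u j k :
  hlift a z u j k = \sum_i u 0 i * hlift a z (delta_mx 0 i) j k.
Proof.
rewrite {1}(row_sum_delta u).
elim: (index_enum _) => [|i r IH]; first by rewrite !big_nil hlift0 mxE.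
by rewrite !big_cons hliftD hliftZ mxE IH [in LHS]mxE.
Qed.

Section Region.
Variables (a : 'I_m -> R) (Z : set 'rV[R]_d).
Hypotheses (Zc : closed Z) (Zr : Z `<=` regular_value a).

Definition fibers_over : set E := [set z | spheres z /\ Z (wsum a z)].
Notation K := fibers_over.

Definition thickening (r : R) : set E :=
  [set z | exists2 z0, K z0 & `|z - z0| <= r].

Lemma compact_fibers_over : compact K.
Proof.
apply: (@closed_bounded_compact_mx _ _ _ _ 1) => [|x [Sx _]].
  apply: closedI; first exact: closed_spheres.
  by apply: closed_comp => // z _; exact: wsum_continuous.
exact: spheres_norm.
Qed.

Lemma thickening_bounded_lip r (j : 'I_m) k : 0 <= r ->
  bounded_lip (thickening r) (fun z => z j k).
Proof.
move=> r0; exists (1 + r); first exact: addr_ge0.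
move=> x y [z [Sz _] xz] _; split.
  apply: le_trans (mx_entry_le _ _ _) _.
  rewrite -(subrK z x) addrC; apply: le_trans (ler_normD _ _) _.
  by rewrite lerD// spheres_norm.
have -> : x j k - y j k = (x - y) j k by rewrite !mxE.
apply: le_trans (mx_entry_le _ _ _) _.
by rewrite mulrDl mul1r lerDl mulr_ge0.
Qed.

Lemma gram_bounded_lip r i k : 0 <= r ->
  bounded_lip (thickening r) (fun z => gram a z i k).
Proof.
move=> r0; have h j l := thickening_bounded_lip j l r0.
have -> : (fun z => gram a z i k) = (fun z => \sum_j (a j) ^+ 2 *
    ((\sum_l z j l * z j l) *+ (i == k) - z j i * z j k)).
  apply/funext => z; rewrite /gram summxE; apply: eq_bigr => j _.
  rewrite !mxE big_ord1 !mxE /dotv; congr (_ * (_ *+ _ - _)).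
  by apply: eq_bigr => l _; rewrite !mxE.
apply: bounded_lip_sum => j; apply: bounded_lipM; first exact: bounded_lip_cst.
apply: bounded_lipB; last exact: bounded_lipM.
case: (i == k); last exact: bounded_lip_cst.
apply: (@bounded_lip_sum _ _ _ _ _ _ (fun l (x : E) => x j l * x j l)) => l.
exact: bounded_lipM.
Qed.

(** The determinant has a positive minimum of its absolute value on the compact
set over [Z], and it is Lipschitz, so half of that bound survives on a
sufficiently thin neighbourhood. *)
Lemma gram_det_lower : exists r : R, exists2 del : R, 0 < r /\ 0 < del &
  forall z, thickening r z -> del <= `|\det (gram a z)|.
Proof.
have [C C0 hC] := bounded_lip_det
  (fun i j => gram_bounded_lip i j (ler01 : 0 <= (1 : R))).
have K1 : K `<=` thickening 1.
  by move=> z Kz; exists z => //; rewrite subrr normr0.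
have [del d0 hd] : exists2 del : R, 0 < del &
    forall z, K z -> del <= `|\det (gram a z)|.
  have [Kn0|/set0P/negP/negPn/eqP K0] := pselect (K !=set0); last first.
    by exists 1 => // z; rewrite K0.
  have [z zK hz] : exists2 z, z \in K &
      forall t, t \in K -> `|\det (gram a z)| <= `|\det (gram a t)|.
    apply: (compact_EVT_min Kn0 compact_fibers_over).
    apply/subspace_continuousP => x Kx.
    apply/cvgrPdist_le => e e0.
    have C1 : 0 < C + 1 by rewrite ltr_wpDl.
    near=> y.
    have Ky : K y by near: y; exact: withinT.
    apply: le_trans (ler_dist_dist _ _) _.
    have [_ h] := hC x y (K1 x Kx) (K1 y Ky); apply: le_trans h _.
    apply: (@le_trans _ _ ((C + 1) * `|x - y|)).
      by rewrite ler_wpM2r// lerDl.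
    rewrite -ler_pdivlMl//; near: y.
    have e1 : 0 < (C + 1)^-1 * e by rewrite mulr_gt0// invr_gt0.
    have /cvgrPdist_le/(_ _ e1) := @cvg_id _ (nbhs x).
    exact: cvg_within.
  exists `|\det (gram a z)|; last by move=> t Kt; apply: hz; rewrite inE.
  rewrite normr_gt0; have [Sz Zz] : K z by rewrite inE in zK.
  by apply: gram_det_neq0 => //; exact: Zr.
have C1 : 0 < 2 * (C + 1) by rewrite mulr_gt0// ltr_wpDl.
exists (Num.min 1 (del / (2 * (C + 1)))), (del / 2).
  by rewrite lt_min ltr01 !divr_gt0.
move=> z [z0 Kz0 zz0].
have z1 : thickening 1 z.
  by exists z0 => //; apply: le_trans zz0 _; rewrite ge_min lexx.
have zr : `|z - z0| <= del / (2 * (C + 1)).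
  by apply: le_trans zz0 _; rewrite ge_min lexx orbT.
have [_] := hC z0 z (K1 _ Kz0) z1; rewrite distrC => h.
have := hd z0 Kz0.
have : C * `|z0 - z| <= del / 2.
  apply: (@le_trans _ _ ((C + 1) * (del / (2 * (C + 1))))).
    by rewrite ler_pM// ?lerDl// distrC.
  by rewrite le_eqVlt; apply/orP; left; apply/eqP; field; lra.
have := ler_normB (\det (gram a z0)) (\det (gram a z) - \det (gram a z0)).
have := lerB_dist (\det (gram a z0)) (\det (gram a z)).
rewrite (distrC (\det (gram a z0))); lra.
Unshelve. all: by end_near. Qed.

Lemma hlift_bounded_lip r (del : R) : 0 <= r -> 0 < del ->
  (forall z, thickening r z -> del <= `|\det (gram a z)|) ->
  forall u j k, bounded_lip (thickening r) (fun z => hlift a z u j k).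
Proof.
move=> r0 d0 hd u j k.
have h i l := thickening_bounded_lip i l r0.
have G i l := @gram_bounded_lip r i l r0.
have w l : bounded_lip (thickening r)
    (fun z => ((\det (gram a z))^-1 *: (u *m \adj (gram a z))) 0 l).
  under eq_fun do rewrite !mxE; apply: bounded_lipM.
    by apply: bounded_lipV hd _ => //; exact: bounded_lip_det.
  apply: bounded_lip_sum => i; apply: bounded_lipM; first exact: bounded_lip_cst.
  exact: bounded_lip_adj.
under eq_fun do rewrite mxE.
apply: bounded_lipM; first exact: bounded_lip_cst.
have row_bl (i : 'I_m) l : bounded_lip (thickening r) (fun z => row i z 0 l).
  by under eq_fun do rewrite mxE; exact: h.
apply: bounded_lipB; apply: bounded_lipM => //.
  by apply: bounded_lip_sum => l; apply: bounded_lipM.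
by apply: bounded_lip_sum => l; apply: bounded_lipM.
Qed.

(** As [hlift] is linear in [u], it suffices to estimate its entries at the basis
vectors, which are polynomials in the entries of [z] divided by the Gram
determinant. *)
Lemma hlift_estimates : exists r C : R, [/\ 0 < r, 0 <= C,
  forall z, thickening r z -> \det (gram a z) != 0,
  forall z u, thickening r z -> `|hlift a z u| <= C * `|u| &
  forall z z' u, thickening r z -> thickening r z' ->
    `|hlift a z u - hlift a z' u| <= C * `|u| * `|z - z'|].
Proof.
have [r [del [r0 d0] hd]] := gram_det_lower.
have /choice[C hC] : forall ijk : 'I_d * 'I_m * 'I_d, exists C : R, 0 <= C /\
    forall x y, thickening r x -> thickening r y ->
    `|hlift a x (delta_mx 0 ijk.1.1) ijk.1.2 ijk.2| <= C /\
    `|hlift a x (delta_mx 0 ijk.1.1) ijk.1.2 ijk.2 -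
      hlift a y (delta_mx 0 ijk.1.1) ijk.1.2 ijk.2| <= C * `|x - y|.
  move=> [[i j] k] /=.
  have [C C0 h] := hlift_bounded_lip (ltW r0) d0 hd (delta_mx 0 i) j k.
  by exists C.
pose Cs := \sum_ijk C ijk.
have C0 ijk : 0 <= C ijk by have [] := hC ijk.
have sumC j k : \sum_i C (i, j, k) <= Cs.
  rewrite /Cs (eq_bigr (fun t : 'I_d * 'I_m * 'I_d =>
    C (t.1.1, t.1.2, t.2))); last by case=> [[]].
  rewrite -(pair_bigA _ (fun (t : 'I_d * 'I_m) k => C (t.1, t.2, k)))/=.
  rewrite -(pair_bigA _ (fun i j => \sum_k C (i, j, k)))/=.
  apply: ler_sum => i _.
  rewrite (bigD1 j)//= (bigD1 k)//= -addrA lerDl addr_ge0//.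
    exact: sumr_ge0.
  by apply: sumr_ge0 => ? _; exact: sumr_ge0.
exists r, Cs; split => //.
- exact: sumr_ge0.
- by move=> z /hd h; rewrite -normr_gt0 (lt_le_trans d0).
- move=> z u Dz; apply/mx_norm_leP; first by rewrite mulr_ge0// sumr_ge0.
  move=> j k; rewrite hlift_coord.
  apply: le_trans (ler_norm_sum _ _ _) _.
  apply: (@le_trans _ _ (\sum_i C (i, j, k) * `|u|)).
    apply: ler_sum => i _; rewrite normrM mulrC ler_pM// ?mx_entry_le//.
    by have [_ /(_ z z Dz Dz)[]] := hC (i, j, k).
  by rewrite -mulr_suml ler_wpM2r.
- move=> z z' u Dz Dz'; apply/mx_norm_leP.
    by rewrite !mulr_ge0// sumr_ge0.
  move=> j k; rewrite !mxE -!/(hlift _ _ _ _ _).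
  rewrite (_ : _ - _ = hlift a z u j k - hlift a z' u j k); last first.
    by rewrite !mxE.
  rewrite !(hlift_coord a _ u) -sumrB.
  apply: le_trans (ler_norm_sum _ _ _) _.
  apply: (@le_trans _ _ (\sum_i C (i, j, k) * (`|u| * `|z - z'|))).
    apply: ler_sum => i _; rewrite -mulrBr normrM mulrCA ler_pM// ?mx_entry_le//.
    by have [_ /(_ z z' Dz Dz')[]] := hC (i, j, k).
  by rewrite -mulr_suml -mulrA ler_wpM2r// mulr_ge0.
Qed.


(** Composing a field with the clamp makes it globally Lipschitz and bounded, and
does not change it near [z0]. *)
Definition clamp_box (z0 : E) (r : R) (z : E) : E :=
  \matrix_(j, k) Num.max (z0 j k - r) (Num.min (z j k) (z0 j k + r)).

Lemma clamp_box_near z0 r z : 0 <= r -> `|clamp_box z0 r z - z0| <= r.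
Proof.
move=> r0; apply/mx_norm_leP => // j k; rewrite !mxE.
case: (lerP (z j k) (z0 j k + r)) => h1.
  by case: (lerP (z0 j k - r) (z j k)) => h2; rewrite ler_norml; apply/andP; split; lra.
by case: (lerP (z0 j k - r) (z0 j k + r)) => h2; rewrite ler_norml; apply/andP; split; lra.
Qed.

Lemma clamp_box_lip z0 r x y : `|clamp_box z0 r x - clamp_box z0 r y| <= `|x - y|.
Proof.
apply/mx_norm_leP => // j k; rewrite !mxE.
apply: le_trans (max_lip _ _ _) _; apply: le_trans (min_lip _ _ _) _.
by apply: le_trans (mx_entry_le _ j k); rewrite !mxE.
Qed.

Lemma clamp_box_id z0 r z : `|z - z0| <= r -> clamp_box z0 r z = z.
Proof.
move=> zr; apply/matrixP => j k; rewrite !mxE.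
have : `|z j k - z0 j k| <= r.
  by apply: le_trans zr; apply: le_trans (mx_entry_le _ j k); rewrite !mxE.
rewrite ler_norml => /andP[h1 h2].
by rewrite min_l; [rewrite max_r//; lra|lra].
Qed.

(** Integral curves of the time-dependent horizontal field [hlift _ (u t)].  A
curve that starts over [Z] stays on the spheres and projects to a primitive of
[u]: [hlift] satisfies both infinitesimal identities wherever the Gram
determinant does not vanish, and not only on the spheres. *)
Definition horizontal_flow (r : R) (u : R -> 'rV[R]_d) (z0 : E) (y : R -> E) :=
  [/\ y 0 = z0,
     forall t : R, - 1 < t < 2 -> is_derive t 1 y (hlift a (y t) (u t)),
     forall t : R, - 1 < t < 2 -> thickening r (y t) /\ \det (gram a (y t)) != 0,
     forall t : R, - 1 < t < 2 -> spheres (y t) &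
     forall t : R, - 1 < t < 2 ->
       is_derive t 1 (fun s => wsum a (y s)) (u t)].

(** On a thickening of the compact set over [Z] the field [hlift _ u] is bounded
and Lipschitz with constants proportional to the size of [u]: for small [u] the
time interval ]-1, 2[ is short, the contraction applies, and the solution has
no time to leave the thickening.  One bound on [u] serves all initial points. *)
Lemma horizontal_flow_exists : exists r eta C : R, [/\ 0 < eta, 0 <= C,
  forall (u : R -> 'rV[R]_d) z0, continuous u -> (forall t, `|u t| <= eta) ->
    K z0 -> exists y, horizontal_flow r u z0 y &
  forall (u u' : 'rV[R]_d) z0 z0' y y', `|u| <= eta -> `|u'| <= eta ->
    horizontal_flow r (fun=> u) z0 y -> horizontal_flow r (fun=> u') z0' y' ->
    `|y 1 - y' 1| <= 2 * (`|z0 - z0'| + C * `|u - u'|)].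
Proof.
have [r [C [r0 C0 det0 hb hl]]] := hlift_estimates.
have C1 : 0 < C + 1 by rewrite ltr_wpDl.
pose eta := Num.min (4^-1 / (C + 1)) (r / (2 * (C + 1))).
have eta0 : 0 < eta by rewrite lt_min !divr_gt0// mulr_gt0.
have Ceta4 : C * eta <= 4^-1.
  apply: (@le_trans _ _ ((C + 1) * (4^-1 / (C + 1)))).
    by rewrite ler_pM ?(ltW eta0)// ?lerDl// ge_min lexx.
  by rewrite mulrC divfK// gt_eqF.
have Cetar : C * eta * 2 <= r.
  apply: (@le_trans _ _ ((C + 1) * (r / (2 * (C + 1))) * 2)).
    by rewrite ler_wpM2r// ler_pM ?(ltW eta0)// ?lerDl// ge_min lexx orbT.
  by rewrite le_eqVlt; apply/orP; left; apply/eqP; field; lra.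
have Ceta0 : 0 <= C * eta by rewrite mulr_ge0// ltW.
exists r, eta, C; split => //.
- move=> u z0 uc ueta Kz0.
  have box z : thickening r (clamp_box z0 r z).
    by exists z0 => //; apply: clamp_box_near; exact: ltW.
  pose F (t : R) (z : E) := hlift a (clamp_box z0 r z) (u t).
  have FL t x y : `|F t x - F t y| <= C * eta * `|x - y|.
    apply: le_trans (hl _ _ _ (box x) (box y)) _.
    by rewrite ler_pM ?mulr_ge0// ?ler_wpM2l// clamp_box_lip.
  have FM t x : `|F t x| <= C * eta.
    by apply: le_trans (hb _ _ (box x)) _; rewrite ler_wpM2l.
  have Fc (y : R -> E) : continuous y -> continuous (fun t => F t (y t)).
    move=> yc t; apply/cvgrPdist_le => e e0.
    pose C' := C * eta + C + 1.
    have C'0 : 0 < C' by rewrite /C' ltr_wpDl// addr_ge0.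
    have e1 : 0 < e / (2 * C') by rewrite divr_gt0// mulr_gt0.
    near=> s.
    have h1 : `|y t - y s| <= e / (2 * C').
      by near: s; move: (yc t) => /cvgrPdist_le; apply.
    have h2 : `|u t - u s| <= e / (2 * C').
      by near: s; move: (uc t) => /cvgrPdist_le; apply.
    have -> : F t (y t) - F s (y s) =
        (F t (y t) - F t (y s)) + hlift a (clamp_box z0 r (y s)) (u t - u s).
      by rewrite hliftB /F addrA subrK.
    apply: le_trans (ler_normD _ _) _.
    have h3 := FL t (y t) (y s); have h4 := hb _ (u t - u s) (box (y s)).
    have h5 : C * eta * `|y t - y s| <= C' * (e / (2 * C')).
      by rewrite ler_pM// /C' -addrA lerDl addr_ge0.
    have h6 : C * `|u t - u s| <= C' * (e / (2 * C')).
      by rewrite ler_pM// /C' addrAC lerDr addr_ge0.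
    have h7 : C' * (e / (2 * C')) = e / 2 by field; lra.
    by lra.
  have hC4 : 0 <= C * eta <= 4^-1 by rewrite Ceta0.
  have [y y0 dy] := picard z0 hC4 Fc FL FM.
  have ynear (t : R) : - 1 < t < 2 -> `|y t - z0| <= r.
    move=> /andP[t1 t2]; rewrite -y0; case: (lerP 0 t) => t0.
      apply: (@le_trans _ _ (C * eta * (t - 0))).
        apply: (@mean_value_mx _ _ _ _ (fun s => F s (y s))) => // s /andP[s1 s2].
        by apply: dy; apply/andP; split; lra.
      apply: le_trans Cetar; rewrite ler_wpM2l//; lra.
    rewrite distrC; apply: (@le_trans _ _ (C * eta * (0 - t))).
      apply: (@mean_value_mx _ _ _ _ (fun s => F s (y s))); first exact: ltW.
        by move=> s /andP[s1 s2]; apply: dy; apply/andP; split; lra.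
      by [].
    apply: le_trans Cetar; rewrite ler_wpM2l//; lra.
  have yD (t : R) : - 1 < t < 2 -> thickening r (y t).
    by move=> t12; exists z0 => //; exact: ynear.
  have dy' (t : R) : - 1 < t < 2 -> is_derive t 1 y (hlift a (y t) (u t)).
    move=> t12; have := dy t t12; rewrite /F clamp_box_id//; exact: ynear.
  exists y; split => //.
  + by move=> t t12; split; [exact: yD|apply: det0; exact: yD].
  + move=> t t12 j; have [Sz0 _] := Kz0; rewrite -(Sz0 j) -y0.
    apply: (const_on_flow_time (f := fun t => dotv (row j (y t)) (row j (y t)))) => //.
    move=> s s12; have h := is_derive_dotv_row j (dy' s s12).
    apply: is_derive_eq h _.
    by rewrite dotvC /hlift hfield_tangent addr0.
  + move=> t t12; have := is_derive_wsum a (dy' t t12).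
    by rewrite wsum_hlift//; apply: det0; exact: yD.
- move=> u u' z0 z0' y y' ueta u'eta [y0 dy yD _ _] [y0' dy' yD' _ _].
  rewrite -y0 -y0'.
  have t12 (t : R) : 0 <= t <= 1 -> - 1 < t < 2.
    by move=> /andP[? ?]; apply/andP; split; lra.
  apply: (@ode_compare _ _ _ y y' (fun t => hlift a (y t) u)
    (fun t => hlift a (y' t) u') (C * eta)).
  + by rewrite Ceta0 (le_trans Ceta4)//; lra.
  + by move=> t /t12; exact: dy.
  + by move=> t /t12; exact: dy'.
  + move=> t /t12 t01; have [D1 _] := yD t t01; have [D2 _] := yD' t t01.
    have -> : hlift a (y t) u - hlift a (y' t) u' =
        (hlift a (y t) u - hlift a (y' t) u) + hlift a (y' t) (u - u').
      by rewrite hliftB addrA subrK.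
    apply: le_trans (ler_normD _ _) _; rewrite lerD ?hb//.
    by apply: le_trans (hl _ _ _ D1 D2) _; rewrite ler_wpM2r// ler_wpM2l.
Unshelve. all: by end_near. Qed.

(** The right-hand side of the equation is an algebraic expression in the
solution and the control, so regularity of the control bootstraps. *)
Lemma horizontal_flow_Ck r u z0 y (O : set R) : open O ->
  O `<=` `]-1, 2[%classic -> (forall n, Ck n O u) ->
  horizontal_flow r u z0 y -> forall n, Ck n O y.
Proof.
move=> oO O12 Cu [_ dy yD _ _]; elim=> // n Cy.
have O' t : O t -> - 1 < t < 2 by move=> /O12; rewrite /= in_itv.
exists (fun t => hlift a (y t) (u t)); first by move=> t /O'; exact: dy.
have hy j k : Ck n O (fun t => y t j k) by exact: Ck_entry.
have hr j k : Ck n O (fun t => row j (y t) 0 k).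
  by under eq_fun do rewrite mxE.
have hd' j : Ck n O (fun t => dotv (row j (y t)) (row j (y t))).
  by apply: Ck_sum => k; exact: CkM.
have hG i k : Ck n O (fun t => gram a (y t) i k).
  have -> : (fun t => gram a (y t) i k) = (fun t => \sum_j (a j) ^+ 2 *
      (dotv (row j (y t)) (row j (y t)) * (i == k)%:R - y t j i * y t j k)).
    apply/funext => t; rewrite /gram summxE; apply: eq_bigr => j _.
    by rewrite !mxE big_ord1 !mxE mulr_natr.
  apply: Ck_sum => j; apply: CkM; first exact: Ck_cst.
  by apply: CkB; apply: CkM => //; exact: Ck_cst.
have hw k : Ck n O (fun t =>
    ((\det (gram a (y t)))^-1 *: (u t *m \adj (gram a (y t)))) 0 k).
  under eq_fun do rewrite !mxE; apply: CkM.
    apply: CkV; last exact: Ck_det.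
    by move=> t /O' /yD[].
  by apply: Ck_sum => i; apply: CkM; [exact: Ck_entry|exact: Ck_adj].
apply: Ck_mx => j k; under eq_fun do rewrite mxE.
apply: CkM; first exact: Ck_cst.
apply: CkB; apply: CkM => //.
by apply: Ck_sum => i; exact: CkM.
Qed.

End Region.
End HorizontalFlow.

(** * Lifting short pieces of a curve *)

Lemma Ck_derive1 {R : realType} {V : normedModType R} n (O : set R)
    (f : R -> V) : open O -> Ck n.+1 O f -> Ck n O (derive1 f).
Proof.
move=> oO [f' hf' Cf']; apply: Ck_ext Cf' => // t Ot.
by rewrite derive1E; have [_ ->] := hf' t Ot.
Qed.

Lemma within_lipschitz_continuous {R : realType} {V W : normedModType R}
    (A : set V) (f : V -> W) (C : R) :
  (forall x y, A x -> A y -> `|f x - f y| <= C * `|x - y|) ->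
  {within A, continuous f}.
Proof.
move=> h; apply/subspace_continuousP => x Ax; apply/cvgrPdist_le => e e0.
have C1 : 0 < `|C| + 1 by rewrite ltr_wpDl.
near=> y; have Ay : A y by near: y; exact: withinT.
apply: le_trans (h x y Ax Ay) _.
apply: (@le_trans _ _ ((`|C| + 1) * `|x - y|)).
  by rewrite ler_wpM2r// (le_trans (ler_norm _))// lerDl.
rewrite -ler_pdivlMl//; near: y.
have e1 : 0 < (`|C| + 1)^-1 * e by rewrite mulr_gt0// invr_gt0.
have /cvgrPdist_le/(_ _ e1) := @cvg_id _ (nbhs x).
exact: cvg_within.
Unshelve. all: by end_near. Qed.

Lemma continuous_of_Ck {R : realType} {V : normedModType R} (f : R -> V) :
  Ck 1 setT f -> continuous f.
Proof.
move=> [f' hf' _] t; have [df _] := hf' t I.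
exact/differentiable_continuous/derivable1_diffP.
Qed.

Section Lifting.
Context {R : realType} {m d : nat}.
Notation E := 'M[R]_(m, d).
Implicit Types (a : 'I_m -> R) (c : R -> 'rV[R]_d) (g : R -> E).

Definition horizontal_piece a g : Prop :=
  (exists O : set R, [/\ open O, `[0, 1] `<=` O & forall n, Ck n O g]) /\
  forall t : R, 0 <= t <= 1 -> spheres (g t) /\ Delta a (g t) (derive1 g t).

Definition liftable a c : Prop :=
  forall z, spheres z -> wsum a z = c 0 -> exists g,
    [/\ g 0 = z, horizontal_piece a g &
        forall t : R, 0 <= t <= 1 -> wsum a (g t) = c t].

Lemma horizontal_flow_piece a Z r u z0 y : closed Z -> Z `<=` regular_value a ->
  (forall n, Ck n `]-1, 2[%classic u) ->
  horizontal_flow a Z r u z0 y -> horizontal_piece a y.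
Proof.
move=> Zc Zr Cu hy; have hCk := horizontal_flow_Ck (interval_open _ _) _ Cu hy.
have [_ dy _ Sy _] := hy; split.
  exists `]-1, 2[%classic; split; first exact: interval_open.
    by move=> t; rewrite /= !in_itv/= => /andP[? ?]; apply/andP; split; lra.
  by apply: hCk.
move=> t /andP[t0 t1]; have t12 : - 1 < t < 2 by apply/andP; split; lra.
split; first exact: Sy.
rewrite derive1E; have [_ ->] := dy t t12.
exact/hfield_horizontal/Sy.
Qed.

(** Cutting the curve into n equal parts divides the velocity of each part by n,
so that for large n it is an admissible control for [horizontal_flow_exists],
whatever the starting point. *)
Lemma liftable_subdivision a c : (forall n, Ck n setT c) ->
  (forall t : R, 0 <= t <= 1 -> regular_value a (c t)) ->
  exists n0 : nat, forall n k, (n0 <= n)%N -> (k < n)%N ->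
    liftable a (fun t => c (n%:R^-1 * t + k%:R / n%:R)).
Proof.
move=> Cc creg.
have cc : continuous c by exact: continuous_of_Ck.
have C1 n : Ck n setT (derive1 c) by apply: Ck_derive1 => //; exact: openT.
have c1c : continuous (derive1 c) by exact: continuous_of_Ck.
pose Z : set 'rV[R]_d := [set c t | t in `[0, 1]].
have Zc : closed Z.
  apply: compact_closed; first exact: norm_hausdorff.
  apply: continuous_compact; last exact: segment_compact.
  exact: continuous_subspaceT.
have Zr : Z `<=` regular_value a.
  by move=> _ [t t01 <-]; apply: creg; move: t01; rewrite /= in_itv.
have [r [eta [C [eta0 C0 ex _]]]] := horizontal_flow_exists Zc Zr.
have [M M0 hM] : exists2 M : R, 0 <= M &
    forall t, - 1 <= t <= 2 -> `|derive1 c t| <= M.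
  have cn : {within `[(- 1 : R), 2], continuous (fun t => `|derive1 c t|)}.
    apply: continuous_subspaceT => t.
    apply: (@continuous_comp _ _ _ (derive1 c) Num.norm); first exact: c1c.
    exact: norm_continuous.
  have m12 : (- 1 : R) <= 2 by lra.
  have [s _ hs] := EVT_max m12 cn.
  by exists `|derive1 c s| => // t t12; apply: hs; rewrite in_itv.
exists (Num.Def.archi_bound (M / eta)).+1 => n k n0n kn z Sz fz.
have n0 : (0 < n)%N by exact: leq_ltn_trans kn.
have n1 : (1 : R) <= n%:R by rewrite ler1n.
have ni : 0 < (n%:R : R)^-1 by rewrite invr_gt0 ltr0n.
have kn' : (k%:R : R) + 1 <= n%:R by rewrite natr1 ler_nat.
have Mn : n%:R^-1 * M <= eta.
  rewrite mulrC ler_pdivrMr ?ltr0n// mulrC -ler_pdivrMr//.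
  have Me0 : 0 <= M / eta by rewrite divr_ge0// ltW.
  apply: le_trans (ltW (archi_boundP Me0)) _; rewrite ler_nat.
  exact: leq_trans (leqnSn _) n0n.
have arg t : n%:R^-1 * t + k%:R / n%:R = (t + k%:R) / n%:R :> R.
  by rewrite mulrDl [_^-1 * _]mulrC.
have in12 (t : R) : - 1 <= t <= 2 -> - 1 <= n%:R^-1 * t + k%:R / n%:R <= 2.
  move=> /andP[t1 t2]; rewrite arg ler_pdivlMr ?ltr0n// ler_pdivrMr ?ltr0n//.
  have k0 : (0 : R) <= k%:R by rewrite ler0n.
  by apply/andP; split; lra.
pose w t : 'rV[R]_d := n%:R^-1 *: derive1 c (n%:R^-1 * t + k%:R / n%:R).
(* only the velocity during [-1, 2] is known to be small *)
pose u t := w (clamp_time t).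
have wC i : Ck i setT w.
  apply: Ck_mx => i' j; under eq_fun do rewrite mxE; apply: CkZ.
  exact: (Ck_affine _ _ (Ck_entry i' j (C1 i))).
have uc : continuous u.
  move=> t; apply: (@continuous_comp _ _ _ clamp_time w).
    apply: (@lipschitz_continuous _ R^o R^o _ 1) => x y.
    by rewrite mul1r clamp_time_lip.
  exact: continuous_of_Ck.
have ueta t : `|u t| <= eta.
  rewrite /u /w normrZ (gtr0_norm ni); apply: le_trans Mn.
  by rewrite ler_wpM2l ?(ltW ni)// hM// in12// clamp_time_itv.
have Kz : fibers_over a Z z.
  split => //; exists (n%:R^-1 * 0 + k%:R / n%:R) => //.
  rewrite /= in_itv/= mulr0 add0r divr_ge0// ler_pdivrMr ?ltr0n// mul1r.
  by rewrite ler_nat ltnW.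
have [y hy] := ex u z uc ueta Kz.
have [y0 _ _ _ dwy] := hy.
exists y; split => //.
  apply: (horizontal_flow_piece Zc Zr _ hy) => i.
  apply: (@Ck_ext _ _ _ _ w); first exact: interval_open.
    move=> t; rewrite /= in_itv/= => /andP[t1 t2].
    by rewrite /u clamp_time_id// !ltW.
  exact: Ck_sub (wC i).
move=> t /andP[t0 t1]; apply/rowP => j; apply/eqP; rewrite -subr_eq0; apply/eqP.
pose D s := wsum a (y s) 0 j - c (n%:R^-1 * s + k%:R / n%:R) 0 j.
have D0 : D 0 = 0 by rewrite /D y0 fz subrr.
rewrite -/(D t) -D0; apply: const_on_flow_time; last by apply/andP; split; lra.
move=> s s12; have /is_derive_mx/(_ 0 j) h1 := dwy s s12.
have hc (x : R) : is_derive x 1 (fun s => c s 0 j) (derive1 c x 0 j).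
  by have /is_derive_mx := Ck1_derivable (Cc 1%N) (I : setT x); exact.
have h2 := is_derive_affine (hc (n%:R^-1 * s + k%:R / n%:R)).
have us : u s 0 j = derive1 c (n%:R^-1 * s + k%:R / n%:R) 0 j / n%:R.
  rewrite /u clamp_time_id; last by case/andP: s12 => *; rewrite !ltW.
  by rewrite /w mxE mulrC.
rewrite us in h1; have := is_deriveB h1 h2.
by rewrite subrr.
Qed.

(** * Retracting onto a fibre *)

(** Flowing every point [z] over [Z] along the constant control b - f(z), in
finitely many short steps, is a Lipschitz retraction onto the fibre over [b],
and it maps connected sets to connected sets. *)
Lemma fiber_retraction a (Z : set 'rV[R]_d) b : closed Z ->
  Z `<=` regular_value a ->
  (forall (x y : 'rV[R]_d) (s : R), Z x -> Z y -> 0 <= s <= 1 ->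
     Z (x + s *: (y - x))) ->
  Z b -> forall q1 q2, wsum a q1 = b -> wsum a q2 = b ->
  connected_component (fibers_over a Z) q1 q2 ->
  connected_component (fiber a b) q1 q2.
Proof.
move=> Zc Zr Zconv Zb q1 q2 fq1 fq2 [A [Aq1 AK Aconn] Aq2].
have [r [eta [C [eta0 C0 ex lip]]]] := horizontal_flow_exists Zc Zr.
pose M : R := `|b| + \sum_j `|a j|.
have M0 : 0 <= M by rewrite addr_ge0// sumr_ge0.
have [N [N0 MN]] : exists N : nat, (0 : R) < N%:R /\ N%:R^-1 * M <= eta.
  exists (Num.Def.archi_bound (M / eta)).+1; rewrite ltr0n; split => //.
  rewrite mulrC ler_pdivrMr ?ltr0n// mulrC -ler_pdivrMr//.
  have Me0 : 0 <= M / eta by rewrite divr_ge0// ltW.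
  by apply: le_trans (ltW (archi_boundP Me0)) _; rewrite ler_nat leqnSn.
pose v z : 'rV[R]_d := N%:R^-1 *: (b - wsum a z).
have veta z : fibers_over a Z z -> `|v z| <= eta.
  move=> [Sz _]; rewrite normrZ gtr0_norm ?invr_gt0//; apply: le_trans MN.
  apply: ler_wpM2l; first by rewrite invr_ge0 ltW.
  apply: le_trans (ler_normB _ _) _; rewrite lerD2l; apply: le_trans (wsum_norm _ _) _.
  by rewrite ler_piMr ?sumr_ge0// spheres_norm.
have /choice[step hstep] : forall zw : E * 'rV[R]_d, exists z' : E,
    fibers_over a Z zw.1 -> `|zw.2| <= eta ->
    exists2 y, horizontal_flow a Z r (fun=> zw.2) zw.1 y & z' = y 1.
  move=> [z w] /=; have [[Kz weta]|h] := pselect (fibers_over a Z z /\ `|w| <= eta).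
    have [|y hy] := ex (fun=> w) z _ (fun=> weta) Kz; first exact: cst_continuous.
    by exists (y 1) => _ _; exists y.
  by exists z => Kz weta; case: h.
pose sg k z := iter k (fun z' => step (z', v z)) z.
(* after k of N steps, f has covered the fraction k / N of the segment to b *)
have sgK z k : fibers_over a Z z -> (k <= N)%N ->
    spheres (sg k z) /\ wsum a (sg k z) = wsum a z + (k%:R / N%:R) *: (b - wsum a z).
  move=> Kz; elim: k => [|k IH] kN.
    by have [Sz _] := Kz; rewrite mul0r scale0r addr0.
  have [Sk fk] := IH (ltnW kN).
  have Kk : fibers_over a Z (sg k z).
    split => //; rewrite fk; apply: Zconv => //; first by case: Kz.
    by rewrite divr_ge0// ler_pdivrMr// mul1r ler_nat ltnW.
  have [y [y0 dy yD Sy dwy] yE] := hstep (sg k z, v z) Kk (veta z Kz).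
  rewrite /sg /= -/(sg k z) yE; split; first by apply: Sy; lra.
  apply/rowP => j.
  pose D s := wsum a (y s) 0 j - v z 0 j * s.
  have : D 1 = D 0.
    apply: const_on_flow_time; last by apply/andP; split; lra.
    move=> s s12; have /is_derive_mx/(_ 0 j) h1 := dwy s s12.
    have h2 : is_derive s 1 (fun s => v z 0 j * s) (v z 0 j).
      have := is_deriveM_fun (is_derive_cst (v z 0 j) s 1) (is_derive_id s 1).
      by rewrite mul0r add0r mulr1.
    by have := is_deriveB h1 h2; rewrite subrr.
  rewrite /D mulr1 mulr0 subr0 y0 /= fk => /eqP; rewrite subr_eq => /eqP ->.
  by rewrite /v !mxE -natr1; field; rewrite gt_eqF.
have KK z k : fibers_over a Z z -> (k <= N)%N -> fibers_over a Z (sg k z).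
  move=> Kz kN; have [Sk fk] := sgK z k Kz kN.
  split => //; rewrite fk; apply: Zconv => //; first by case: Kz.
  by rewrite divr_ge0// ler_pdivrMr// mul1r ler_nat.
have sgfix z k : fibers_over a Z z -> wsum a z = b -> (k <= N)%N -> sg k z = z.
  move=> Kz fz; elim: k => // k IH kN; have {}IH := IH (ltnW kN).
  have [y [y0 dy _ _ _] yE] := hstep (z, v z) Kz (veta z Kz).
  rewrite /sg /= -/(sg k z) IH yE.
  have vz0 : v z = 0 by rewrite /v fz subrr scaler0.
  rewrite -[RHS]y0; apply/matrixP => i j.
  apply: (const_on_flow_time (f := fun s => y s i j)); last first.
    by apply/andP; split; lra.
  move=> s s12; have /is_derive_mx/(_ i j) := dy s s12.
  by rewrite /= vz0 hlift0 mxE.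
have sglip k : (k <= N)%N -> exists2 L, 0 <= L & forall z z',
    fibers_over a Z z -> fibers_over a Z z' -> `|sg k z - sg k z'| <= L * `|z - z'|.
  elim: k => [_|k IH kN]; first by exists 1 => // z z' _ _; rewrite mul1r.
  have [L L0 hL] := IH (ltnW kN).
  pose S : R := \sum_j `|a j|.
  have S0 : 0 <= S by exact: sumr_ge0.
  have N0' : 0 <= (N%:R : R)^-1 by rewrite invr_ge0 ltW.
  exists (2 * (L + C * (N%:R^-1 * S))).
    by rewrite mulr_ge0// addr_ge0// mulr_ge0// mulr_ge0.
  move=> z z' Kz Kz'.
  have [y hy yE] := hstep (sg k z, v z) (KK z k Kz (ltnW kN)) (veta z Kz).
  have [y' hy' yE'] := hstep (sg k z', v z') (KK z' k Kz' (ltnW kN)) (veta z' Kz').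
  rewrite /sg /= -/(sg k z) -/(sg k z') yE yE'.
  apply: le_trans (lip _ _ _ _ _ _ (veta z Kz) (veta z' Kz') hy hy') _.
  rewrite -mulrA ler_wpM2l//= mulrDl lerD//; first exact: hL.
  rewrite -mulrA ler_wpM2l//.
  have -> : v z - v z' = N%:R^-1 *: wsum a (z' - z).
    rewrite /v -scalerBr -wsumB; congr (_ *: _).
    by rewrite opprB addrC addrA subrK.
  rewrite normrZ ger0_norm// -mulrA ler_wpM2l//.
  by rewrite distrC; exact: wsum_norm.
have [L L0 hL] := sglip N (leqnn N).
exists [set sg N z | z in A]; last by exists q2 => //; exact: sgfix (AK _ Aq2) fq2 _.
split.
- by exists q1 => //; exact: sgfix (AK _ Aq1) fq1 _.
- move=> _ [z Az <-]; have [Sk fk] := sgK z N (AK _ Az) (leqnn N).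
  by split => //; rewrite fk divff ?gt_eqF// scale1r addrC subrK.
- apply: connected_continuous_connected => //.
  by apply: (@within_lipschitz_continuous _ _ _ _ _ L) => z z' /AK Kz /AK; exact: hL.
Qed.

End Lifting.

(** * Reflections and rotations *)

Section Householder.
Context {R : realType} {d : nat}.
Implicit Types (u v x y n : 'rV[R]_d) (g : 'M[R]_d).

Definition householder n : 'M[R]_d := 1%:M - (2 / dotv n n) *: (n^T *m n).

Definition orthogonal g : Prop := g *m g^T = 1%:M.

Lemma mul_householder v n :
  v *m householder n = v - (2 * dotv v n / dotv n n) *: n.
Proof.
rewrite mulmxBr mulmx1 -scalemxAr mulmxA.
have -> : v *m n^T = (dotv v n)%:M by rewrite [LHS]mx11_scalar -dotvE.
by rewrite mul_scalar_mx scalerA; congr (_ - _ *: _); ring.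
Qed.

Lemma householder_tr n : (householder n)^T = householder n.
Proof. by rewrite linearB/= linearZ/= trmx_mul trmxK trmx1. Qed.

Lemma householderN n : householder (- n) = householder n.
Proof.
have nT : (- n)^T = - n^T by apply/matrixP => i j; rewrite !mxE.
by rewrite /householder dotvNl dotvNr opprK nT mulNmx mulmxN opprK.
Qed.

Lemma householder_orthogonal n : n != 0 -> orthogonal (householder n).
Proof.
rewrite -dotv_gt0 => n0; rewrite /orthogonal householder_tr.
apply/row_matrixP => i; rewrite !rowE mulmxA mulmx1 !mul_householder.
set v : 'rV[R]_d := delta_mx 0 i; set c := 2 * dotv v n / dotv n n.
have -> : 2 * dotv (v - c *: n) n / dotv n n = - c.
  by rewrite dotvBl dotvZl /c; field; rewrite gt_eqF.
by rewrite scaleNr opprK subrK.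
Qed.

(** Two factorizations of one block matrix. *)
Lemma det_1_rank1 p (u : 'cV[R]_p) (v : 'rV[R]_p) :
  \det (1%:M + u *m v) = 1 + (v *m u) 0 0.
Proof.
have h1 : block_mx 1%:M (- v) u 1%:M =
    block_mx 1%:M 0 u 1%:M *m block_mx 1%:M (- v) 0 (1%:M + u *m v).
  rewrite mulmx_block !mul0mx !mulmx0 !mul1mx !mulmx1 !addr0 mulmxN.
  by rewrite addrC addrK.
have h2 : block_mx 1%:M (- v) u 1%:M =
    block_mx (1%:M + v *m u) (- v) 0 1%:M *m block_mx 1%:M 0 u 1%:M.
  rewrite mulmx_block !mul0mx !mulmx0 !mul1mx !mulmx1 !add0r mulNmx.
  by rewrite addrK.
have := congr1 determinant h1; rewrite h2 !det_mulmx !det_lblock !det_ublock.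
rewrite !det1 !mul1r !mulr1 => <-.
by rewrite det_mx11 !mxE eqxx.
Qed.

Lemma det_householder n : n != 0 -> \det (householder n) = - 1.
Proof.
rewrite -dotv_gt0 => n0.
have -> : householder n = 1%:M + (- (2 / dotv n n) *: n^T) *m n.
  by rewrite /householder -scalemxAl scaleNr.
rewrite det_1_rank1 -scalemxAr mxE -dotvE.
by field; rewrite gt_eqF.
Qed.

Lemma orthogonal_dotv g u v : orthogonal g ->
  dotv (u *m g) (v *m g) = dotv u v.
Proof. by move=> og; rewrite dotv_mulmx -mulmxA og mulmx1. Qed.

Lemma orthogonal_tr g : orthogonal g -> orthogonal g^T.
Proof. by rewrite /orthogonal trmxK => /mulmx1C. Qed.

Lemma orthogonalM g h : orthogonal g -> orthogonal h -> orthogonal (g *m h).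
Proof.
by rewrite /orthogonal => og oh; rewrite trmx_mul mulmxA -(mulmxA g) oh mulmx1.
Qed.

Lemma orthogonal1 : orthogonal 1%:M.
Proof. by rewrite /orthogonal trmx1 mulmx1. Qed.

Lemma householder_swap x y : dotv x x = dotv y y -> x != y ->
  x *m householder (x - y) = y.
Proof.
move=> xy; rewrite -subr_eq0 -dotv_gt0 => n0; rewrite mul_householder.
have nE : dotv (x - y) (x - y) = 2 * dotv x (x - y).
  by rewrite !(dotvBl, dotvBr) (dotvC y) xy; ring.
rewrite -nE divff ?gt_eqF// scale1r opprB addrC subrK//.
Qed.

Lemma householder_fix u n : dotv u n = 0 -> u *m householder n = u.
Proof. by move=> un; rewrite mul_householder un mulr0 mul0r scale0r subr0. Qed.

Lemma continuous_householder {T : topologicalType} (f : T -> 'rV[R]_d) (t : T) :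
  f t != 0 -> continuous_at t f ->
  continuous_at t (fun s => householder (f s)).
Proof.
move=> ft0 cf; apply: continuous_mx => i j.
have -> : (fun s => householder (f s) i j) =
    (fun s => (i == j)%:R - 2 * (dotv (f s) (f s))^-1 * (f s 0 i * f s 0 j)).
  by apply/funext => s; rewrite /householder !mxE big_ord1 !mxE.
apply: continuousB; first exact: cst_continuous.
apply: continuousM; last by apply: continuousM; exact: continuous_entry.
apply: continuousM; first exact: cst_continuous.
apply: continuousV; last exact: continuous_dotv.
by rewrite dotv_eq0.
Qed.

Definition reflect_all g (us : seq 'rV[R]_d) : 'M[R]_d :=
  foldl (fun M u => M *m householder u) g us.

Definition normals_to (b : 'rV[R]_d) (us : seq 'rV[R]_d) : Prop :=
  forall u, u \in us -> u != 0 /\ dotv u b = 0.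

Lemma reflect_all_orthogonal g us b : normals_to b us -> orthogonal g ->
  orthogonal (reflect_all g us).
Proof.
elim: us g => //= u us IH g hus og; apply: IH.
  by move=> v vus; apply: hus; rewrite inE vus orbT.
apply: orthogonalM => //; apply: householder_orthogonal.
by have [] := hus u (mem_head _ _).
Qed.

Lemma reflect_all_fix g us b : normals_to b us -> b *m g = b ->
  b *m reflect_all g us = b.
Proof.
elim: us g => //= u us IH g hus bg; apply: IH.
  by move=> v vus; apply: hus; rewrite inE vus orbT.
rewrite mulmxA bg householder_fix//.
by have [_] := hus u (mem_head _ _); rewrite dotvC.
Qed.

Lemma det_reflect_all g us b : normals_to b us ->
  \det (reflect_all g us) = (- 1) ^+ size us * \det g.
Proof.
elim: us g => [|u us IH] g hus /=; first by rewrite mul1r.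
rewrite IH; last by move=> v vus; apply: hus; rewrite inE vus orbT.
rewrite det_mulmx det_householder; last by have [] := hus u (mem_head _ _).
by rewrite mulrN1 exprS mulN1r mulrN mulNr.
Qed.

(** Cartan-Dieudonne relative to a fixed vector: reflecting the images of the
basis vectors back one after the other only uses mirrors that contain the
basis vectors already restored, and [b]. *)
Lemma reflections_to_id g b : orthogonal g -> b *m g = b ->
  exists2 us, normals_to b us & reflect_all g us = 1%:M.
Proof.
move=> og bg.
suff H k : (k <= d)%N -> exists2 us, normals_to b us &
    forall i : 'I_d, (i < k)%N ->
      delta_mx 0 i *m reflect_all g us = delta_mx 0 i :> 'rV[R]_d.
  have [us hus h] := H d (leqnn d).
  exists us => //; apply/row_matrixP => i; rewrite !rowE mulmx1.
  exact/h/ltn_ord.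
elim: k => [_|k IH kd]; first by exists [::].
have [us hus h] := IH (ltnW kd); set M := reflect_all g us in h.
have oM : orthogonal M by exact: reflect_all_orthogonal hus og.
have bM : b *m M = b by exact: reflect_all_fix.
pose e (i : 'I_d) : 'rV[R]_d := delta_mx 0 i.
have ee (i j : 'I_d) : i != j -> dotv (e i) (e j) = 0.
  by move=> /negPf ij; rewrite dotv_delta mxE eq_sym ij.
pose ik := Ordinal kd.
have [eM|neM] := eqVneq (e ik *m M) (e ik).
  exists us => // i; rewrite ltnS leq_eqVlt => /orP[/eqP ik'|]; last exact: h.
  by have -> : i = ik by apply/val_inj.
exists (rcons us (e ik *m M - e ik)).
  move=> u; rewrite mem_rcons inE => /orP[/eqP ->|]; last exact: hus.
  rewrite subr_eq0; split => //.
  by rewrite dotvBl -{1}bM orthogonal_dotv// subrr.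
move=> i; rewrite /reflect_all foldl_rcons -/(reflect_all g us) -/M mulmxA.
rewrite ltnS leq_eqVlt => /orP[/eqP ik'|ilt].
  have -> : i = ik by apply/val_inj.
  by rewrite -/(e ik) householder_swap// orthogonal_dotv.
rewrite h// householder_fix//.
have ine : i != ik by apply/eqP => E; move: ilt; rewrite E ltnn.
by rewrite dotvBr -/(e i) {1}/e -{1}(h i ilt) orthogonal_dotv// -/(e i) ee// subrr.
Qed.

End Householder.

Section OrthogonalAction.
Context {R : realType} {m d : nat}.
Notation E := 'M[R]_(m, d).
Implicit Types (a : 'I_m -> R) (z : E) (g : 'M[R]_d).

Lemma spheres_orthogonal z g : orthogonal g -> spheres z -> spheres (z *m g).
Proof. by move=> og Sz j; rewrite row_mul orthogonal_dotv. Qed.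

Lemma regular_value_orthogonal a (y : 'rV[R]_d) g : orthogonal g ->
  regular_value a y -> regular_value a (y *m g).
Proof.
move=> og ry z [Sz fz] v.
have ogT := orthogonal_tr og.
have Fz : fiber a y (z *m g^T).
  split; first exact: spheres_orthogonal.
  by rewrite wsum_mulmx fz -mulmxA og mulmx1.
have [V TV dV] := ry (z *m g^T) Fz (v *m g^T).
have fV : wsum a V = v *m g^T by rewrite -dV (diff_wsum a (z *m g^T)).
have TVg : tangent z (V *m g).
  move=> j; have := TV j; rewrite !row_mul => <-.
  by rewrite dotv_mulmx trmxK dotvC.
exists (V *m g) => //.
rewrite (diff_wsum a z) wsum_mulmx fV -mulmxA.
by move: ogT; rewrite /orthogonal trmxK => ->; rewrite mulmx1.
Qed.

(** Two vectors of equal length are exchanged by a reflection. *)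
Lemma regular_value_length a (x y : 'rV[R]_d) : dotv x x = dotv y y ->
  regular_value a x -> regular_value a y.
Proof.
move=> xy; have [->//|ne] := eqVneq x y.
move=> rx; rewrite -(householder_swap xy ne); move: rx; apply: regular_value_orthogonal.
by apply: householder_orthogonal; rewrite subr_eq0.
Qed.

Lemma path_connected_component (A : set E) (f : R -> E) (s t : R) : s <= t ->
  (forall x, s <= x <= t -> continuous_at x f) ->
  (forall x, s <= x <= t -> A (f x)) ->
  connected_component A (f s) (f t).
Proof.
move=> st cf Af; exists [set f x | x in `[s, t]]; last first.
  by exists t => //; rewrite /= in_itv/= st lexx.
split; first by exists s => //; rewrite /= in_itv/= st lexx.
  by move=> _ [x /= xst <-]; apply: Af; move: xst; rewrite in_itv.
apply: connected_continuous_connected; first exact: segment_connected.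
apply: continuous_in_subspaceT => x; rewrite inE /= in_itv/=; exact: cf.
Qed.

(** A product of two reflections that fix [b] is joined to the identity by
moving one mirror onto the other. *)
Lemma two_reflections_component a b z (u v : 'rV[R]_d) :
  fiber a b z -> u != 0 -> v != 0 -> dotv u b = 0 -> dotv v b = 0 ->
  connected_component (fiber a b) z (z *m householder u *m householder v).
Proof.
move=> [Sz fz] u0 v0 ub vb; wlog uv : v v0 vb / 0 <= dotv u v.
  move=> H; case: (lerP 0 (dotv u v)) => [|/ltW uv]; first exact: H.
  rewrite -(householderN v); apply: H; rewrite ?oppr_eq0 ?dotvNl ?vb ?oppr0//.
  by rewrite dotvNr oppr_ge0.
pose n (s : R) : 'rV[R]_d := u + s *: (v - u).
have n0 s : 0 <= s <= 1 -> n s != 0.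
  move=> /andP[s0 s1]; rewrite -dotv_gt0.
  rewrite (_ : dotv (n s) (n s) = (1 - s) ^+ 2 * dotv u u +
    2 * (1 - s) * s * dotv u v + s ^+ 2 * dotv v v); last first.
    by rewrite /n !(dotvDl, dotvDr, dotvZl, dotvZr, dotvNl, dotvNr) (dotvC v u); ring.
  have [s12|s12] := lerP s 2^-1.
    have : 0 < (1 - s) ^+ 2 * dotv u u.
      by rewrite mulr_gt0 ?dotv_gt0// exprn_gt0//; lra.
    have : 0 <= 2 * (1 - s) * s * dotv u v by rewrite !mulr_ge0//; lra.
    have : 0 <= s ^+ 2 * dotv v v by rewrite mulr_ge0 ?sqr_ge0// dotv_ge0.
    by lra.
  have : 0 <= (1 - s) ^+ 2 * dotv u u by rewrite mulr_ge0 ?sqr_ge0// dotv_ge0.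
  have : 0 <= 2 * (1 - s) * s * dotv u v by rewrite !mulr_ge0//; lra.
  have : 0 < s ^+ 2 * dotv v v.
    by rewrite mulr_gt0 ?dotv_gt0// exprn_gt0//; lra.
  by lra.
have nb s : dotv (n s) b = 0.
  by rewrite /n dotvDl dotvZl dotvBl ub vb; ring.
pose f s := z *m householder u *m householder (n s).
have f0 : f 0 = z.
  have := householder_orthogonal u0; rewrite /orthogonal householder_tr => uu.
  by rewrite /f /n scale0r addr0 -mulmxA uu mulmx1.
have f1 : f 1 = z *m householder u *m householder v.
  by rewrite /f /n scale1r addrC subrK.
rewrite -f1 -{1}f0; apply: path_connected_component => //.
- move=> s s01; apply: continuous_mulmx; first exact: cst_continuous.
  apply: continuous_householder; first exact: n0.
  apply: (@lipschitz_continuous _ R^o _ n `|v - u|) => x y.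
  by rewrite /n opprD addrACA subrr add0r -scalerBl normrZ mulrC.
- move=> s s01; split.
    apply: spheres_orthogonal; first by apply: householder_orthogonal; exact: n0.
    by apply: spheres_orthogonal => //; exact: householder_orthogonal.
  rewrite !wsum_mulmx fz !householder_fix//; rewrite dotvC//; exact: nb.
Qed.

(** The rotation is a product of reflections that fix [b], whose number is even
because the determinant is 1; they are removed two by two. *)
Lemma rotation_component a b z g : fiber a b z -> orthogonal g ->
  \det g = 1 -> b *m g = b -> connected_component (fiber a b) z (z *m g).
Proof.
move=> Fz og dg bg; have [us hus us1] := reflections_to_id og bg.
have even : ~~ odd (size us).
  have := congr1 determinant us1; rewrite (det_reflect_all _ hus) det1 dg mulr1.
  rewrite -signr_odd; case: (odd _) => //=; rewrite expr1 => h.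
  by have : (- 1 : R) < 1 by [lra]; rewrite h ltxx.
suff : connected_component (fiber a b) (z *m g) (z *m reflect_all g us).
  by rewrite us1 mulmx1; exact: connected_component_sym.
have {us1 dg og bg} := conj og bg.
have [n] := ubnP (size us); elim: n g us hus even => // n IH g us hus even sn.
case: us hus even sn => [|u [|v us]]//= hus even sn [og' bg'].
  apply: connected_component_refl; split.
    by apply: spheres_orthogonal => //; case: Fz.
  by rewrite wsum_mulmx; case: Fz => _ ->.
have [u0 ub] := hus u (mem_head _ _).
have [v0 vb] : v != 0 /\ dotv v b = 0 by apply: hus; rewrite !inE eqxx orbT.
have Fzg : fiber a b (z *m g).
  split; first by apply: spheres_orthogonal => //; case: Fz.
  by rewrite wsum_mulmx; case: Fz => _ ->.
apply: (@connected_component_trans _ _ (z *m g *m householder u *m householder v)).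
  exact: two_reflections_component.
have -> : z *m g *m householder u *m householder v =
    z *m (g *m householder u *m householder v) by rewrite !mulmxA.
apply: IH.
- by move=> w wus; apply: hus; rewrite !inE wus !orbT.
- by move: even; rewrite negbK.
- by move: sn; rewrite ltnS => /ltnW.
- split; last by rewrite !mulmxA bg' !householder_fix// dotvC.
  by do 2 (apply: orthogonalM; last exact: householder_orthogonal).
Qed.

End OrthogonalAction.

(** * Lifts of loops stay in one component of the fibre *)

Section LocallyConstant.

(** Both [P] and its negation define relatively open subsets of [A]. *)
Lemma locally_constant_connected {T : topologicalType} (A : set T)
    (P : T -> Prop) :
  connected A ->
  (forall x, A x -> exists O : set T, [/\ open O, O x &
     forall y, A y -> O y -> (P x <-> P y)]) ->
  forall x y, A x -> A y -> P x -> P y.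
Proof.
move=> Ac loc x y Ax Ay Px.
pose C (Q : T -> Prop) : set T := \bigcup_(O in [set O : set T | open O /\
  exists z, [/\ A z, Q z, O z & forall w, A w -> O w -> (P z <-> P w)]]) O.
have oC Q : open (C Q) by apply: bigcup_open => O [].
have inC (Q : T -> Prop) z : A z -> Q z -> C Q z.
  by move=> Az Qz; have [W [oW Wz h]] := loc z Az; exists W => //; split => //; exists z.
suff /seteqP[_ /(_ y Ay)[]] : A `&` P = A by [].
apply: Ac.
- by exists x.
- exists (C P) => //; apply/seteqP; split => z [Az]; first by split => //; exact: inC.
  by move=> [W [oW [w [Aw Pw Ww h]]] Wz]; split => //; apply/(h z Az Wz).
- exists (~` C (fun z => ~ P z)); first exact: open_closedC.
  apply/seteqP; split => z [Az].
    move=> Pz; split => // -[W [oW [w [Aw nPw Ww h]]] Wz].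
    by apply: nPw; apply/(h z Az Wz).
  by move=> nC; split => //; apply: contrapT => nPz; apply: nC; exact: inC.
Qed.

Lemma segment_ivt {R : realType} (f : R -> R) (s t v : R) : continuous f ->
  0 <= s <= 1 -> 0 <= t <= 1 -> f s <= v <= f t ->
  exists2 x : R, 0 <= x <= 1 & f x = v.
Proof.
move=> cf /andP[s0 s1] /andP[t0 t1] /andP[sv vt].
have cw a b : {within `[a, b], continuous f} by exact: continuous_subspaceT.
have mm : Num.min (f s) (f t) <= v <= Num.max (f s) (f t).
  by rewrite ge_min le_max sv vt orbT.
case: (lerP s t) => st.
  have [x + fx] := IVT st (cw s t) mm; rewrite in_itv/= => /andP[x1 x2].
  by exists x => //; rewrite (le_trans s0)// (le_trans x2).
rewrite minC maxC in mm.
have [x + fx] := IVT (ltW st) (cw t s) mm; rewrite in_itv/= => /andP[x1 x2].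
by exists x => //; rewrite (le_trans t0)// (le_trans x2).
Qed.

End LocallyConstant.

Section AlignRotation.
Context {R : realType} {d : nat}.
Implicit Types (x y : 'rV[R]_d).

Definition vlen x : R := Num.sqrt (dotv x x).

Lemma vlen_sqr x : vlen x ^+ 2 = dotv x x.
Proof. by rewrite sqr_sqrtr// dotv_ge0. Qed.

Lemma vlen_gt0 x : x != 0 -> 0 < vlen x.
Proof. by rewrite -dotv_gt0 => h; rewrite sqrtr_gt0. Qed.

(** The rotation in the plane of [x] and [y] that takes the direction of [y]
to that of [x], as a product of two reflections: the first takes [y] to [-y],
the mirror of the second is orthogonal to the bisector of the two vectors. *)
Definition bisector x y := vlen x *: y + vlen y *: x.

Definition align x y : 'M[R]_d := householder y *m householder (bisector x y).

Lemma bisector_neq0 x y : 0 < dotv x y -> bisector x y != 0.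
Proof.
move=> xy; rewrite -dotv_gt0 /bisector !(dotvDl, dotvDr, dotvZl, dotvZr) (dotvC y x).
have x0 : x != 0 by apply/eqP => x0; move: xy; rewrite x0 dotv0l ltxx.
have y0 : y != 0 by apply/eqP => y0; move: xy; rewrite y0 dotv0r ltxx.
have lx := vlen_gt0 x0; have ly := vlen_gt0 y0.
have : 0 < vlen x * (vlen x * dotv y y).
  by rewrite !mulr_gt0// dotv_gt0.
have : 0 < vlen y * (vlen y * dotv x x) by rewrite !mulr_gt0// dotv_gt0.
have : 0 < vlen x * (vlen y * dotv x y) by rewrite !mulr_gt0.
by lra.
Qed.

Lemma align_orthogonal x y : 0 < dotv x y -> orthogonal (align x y).
Proof.
move=> xy; apply: orthogonalM; apply: householder_orthogonal.
  by apply/eqP => y0; move: xy; rewrite y0 dotv0r ltxx.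
exact: bisector_neq0.
Qed.

Lemma det_align x y : 0 < dotv x y -> \det (align x y) = 1.
Proof.
move=> xy; rewrite det_mulmx !det_householder ?mulrNN ?mulr1//.
  exact: bisector_neq0.
by apply/eqP => y0; move: xy; rewrite y0 dotv0r ltxx.
Qed.

Lemma align_xx x : x != 0 -> align x x = 1%:M.
Proof.
move=> x0; rewrite /align (_ : householder (bisector x x) = householder x).
  by have := householder_orthogonal x0; rewrite /orthogonal householder_tr.
have lx := vlen_gt0 x0; have dx : 0 < dotv x x by rewrite dotv_gt0.
rewrite /bisector -scalerDl /householder.
apply/matrixP => i j; rewrite !mxE !big_ord1 !mxE dotvZl dotvZr.
by congr (_ - _); field; rewrite !gt_eqF//; lra.
Qed.

Lemma mul_align x y : 0 < dotv x y ->
  y *m align x y = (vlen y / vlen x) *: x.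
Proof.
move=> xy.
have x0 : x != 0 by apply/eqP => x0; move: xy; rewrite x0 dotv0l ltxx.
have y0 : y != 0 by apply/eqP => y0; move: xy; rewrite y0 dotv0r ltxx.
have lx := vlen_gt0 x0; have ly := vlen_gt0 y0.
have b0 := bisector_neq0 xy.
rewrite /align mulmxA (mul_householder y y) -mulrA divff; last first.
  by rewrite dotv_eq0.
rewrite mulr1 (_ : y - 2 *: y = - y); last first.
  by apply/rowP => i; rewrite !mxE; ring.
rewrite mul_householder.
have -> : 2 * dotv (- y) (bisector x y) / dotv (bisector x y) (bisector x y)
    = - (vlen x)^-1.
  move: b0; rewrite -dotv_gt0 /bisector.
  rewrite !(dotvDl, dotvDr, dotvZl, dotvZr, dotvNl) (dotvC y x).
  rewrite -!vlen_sqr => b0.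
  by field; rewrite !gt_eqF.
apply/rowP => i; rewrite !mxE; field; rewrite gt_eqF//.
Qed.

Lemma continuous_align {T : topologicalType} (f : T -> 'rV[R]_d) x (t : T) :
  0 < dotv x (f t) -> continuous_at t f ->
  continuous_at t (fun s => align x (f s)).
Proof.
move=> xf cf.
have y0 : f t != 0 by apply/eqP => y0; move: xf; rewrite y0 dotv0r ltxx.
apply: continuous_mulmx; first exact: continuous_householder.
apply: continuous_householder; first exact: bisector_neq0.
have cl : continuous_at t (fun s => vlen (f s)).
  apply: (@continuous_comp _ _ _ (fun s => dotv (f s) (f s)) Num.sqrt).
    exact: continuous_dotv.
  exact: sqrt_continuous.
apply: continuous_mx => i j.
have -> : (fun s => bisector x (f s) i j) =
    (fun s => vlen x * f s i j + vlen (f s) * x i j).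
  by apply/funext => s; rewrite /bisector !mxE.
apply: continuousD; apply: continuousM => //.
- exact: cst_continuous.
- exact: continuous_entry.
- exact: cst_continuous.
Qed.

End AlignRotation.

Section LoopComponent.
Context {R : realType} {m d : nat}.
Notation E := 'M[R]_(m, d).
Variables (a : 'I_m -> R) (b : 'rV[R]_d) (gam : R -> E).
Hypotheses (gamc : continuous gam)
  (Sgam : forall t, 0 <= t <= 1 -> spheres (gam t))
  (rgam : forall t, 0 <= t <= 1 -> regular_value a (wsum a (gam t)))
  (gam0 : wsum a (gam 0) = b) (gam1 : wsum a (gam 1) = b).

Let c t := wsum a (gam t).
Let rho t := dotv (c t) (c t).

Let cc : continuous c.
Proof.
move=> t; apply: (@continuous_comp _ _ _ gam (wsum a)); first exact: gamc.
exact: wsum_continuous.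
Qed.

Let rhoc : continuous rho.
Proof. by move=> t; apply: continuous_dotv; exact: cc. Qed.

(** Vectors whose length lies between two lengths attained by [c] are regular
values, by the intermediate value theorem. *)
Let regular_between s t (y : 'rV[R]_d) : 0 <= s <= 1 -> 0 <= t <= 1 ->
  rho s <= dotv y y <= rho t -> regular_value a y.
Proof.
move=> s01 t01 yst; have [x x01 rx] := segment_ivt rhoc s01 t01 yst.
by apply: regular_value_length (rgam x01); exact: rx.
Qed.

Let zero_in01 : 0 <= (0 : R) <= 1. Proof. by rewrite lexx ler01. Qed.
Let one_in01 : 0 <= (1 : R) <= 1. Proof. by rewrite lexx ler01. Qed.

Let rho_max : exists2 s, 0 <= s <= 1 & forall t, 0 <= t <= 1 -> rho t <= rho s.
Proof.
have [s s01 h] := EVT_max ler01 (continuous_subspaceT rhoc).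
exists s; first by move: s01; rewrite in_itv.
by move=> t t01; apply: h; rewrite in_itv.
Qed.

Let rho_min : exists2 s, 0 <= s <= 1 & forall t, 0 <= t <= 1 -> rho s <= rho t.
Proof.
have [s s01 h] := EVT_min ler01 (continuous_subspaceT rhoc).
exists s; first by move: s01; rewrite in_itv.
by move=> t t01; apply: h; rewrite in_itv.
Qed.

(** If [c] passes through the origin, then the ball that contains it consists
of regular values, and the curve can be retracted directly. *)
Let component_through_zero s : 0 <= s <= 1 -> c s = 0 ->
  connected_component (fiber a b) (gam 0) (gam 1).
Proof.
move=> s01 cs0; have [t t01 ht] := rho_max.
pose Z : set 'rV[R]_d := [set y | dotv y y <= rho t].
have Zg x : 0 <= x <= 1 -> fibers_over a Z (gam x).
  by move=> x01; split; [exact: Sgam|exact: ht].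
apply: (@fiber_retraction _ _ _ a Z) => //.
- rewrite (_ : Z = (fun y : 'rV[R]_d => dotv y y) @^-1` [set x | x <= rho t])//.
  apply: closed_comp; last exact: closed_le.
  by move=> y _; apply: continuous_dotv; exact: cvg_id.
- move=> y Zy; apply: (regular_between s01 t01).
  by rewrite /rho cs0 dotv0l dotv_ge0.
- move=> x y l Zx Zy /andP[l0 l1]; rewrite /Z /=.
  have -> : dotv (x + l *: (y - x)) (x + l *: (y - x)) =
      (1 - l) * dotv x x + l * dotv y y - l * (1 - l) * dotv (x - y) (x - y).
    by rewrite !(dotvDl, dotvDr, dotvZl, dotvZr, dotvNl, dotvNr) (dotvC y x); ring.
  have h1 : 0 <= l * (1 - l) * dotv (x - y) (x - y).
    by rewrite !mulr_ge0 ?dotv_ge0//; lra.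
  have h2 : (1 - l) * dotv x x <= (1 - l) * rho t by rewrite ler_wpM2l//; lra.
  have h3 : l * dotv y y <= l * rho t by rewrite ler_wpM2l.
  by lra.
- by rewrite -gam0; exact: (ht 0 zero_in01).
- exact: path_connected_component.
Qed.

Section AwayFromZero.
Hypothesis c_neq0 : forall t, 0 <= t <= 1 -> c t != 0.

Let b0 : b != 0. Proof. by rewrite -gam0; exact: (c_neq0 zero_in01). Qed.

Let segment_regular : exists k0 k1 : R, 0 <= k0 /\ k0 <= k1 /\
  (forall k, k0 <= k <= k1 -> regular_value a (k *: b)) /\
  (forall k t, 0 <= t <= 1 -> 0 <= k -> k ^+ 2 * dotv b b = rho t ->
     k0 <= k <= k1).
Proof.
have [s s01 hs] := rho_min; have [t t01 ht] := rho_max.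
have bb : 0 < dotv b b by rewrite dotv_gt0 b0.
have rho0 x : 0 <= rho x by exact: dotv_ge0.
have q0 x : 0 <= rho x / dotv b b by rewrite divr_ge0// ltW.
have bi : 0 <= (dotv b b)^-1 by rewrite invr_ge0 ltW.
exists (Num.sqrt (rho s / dotv b b)), (Num.sqrt (rho t / dotv b b)).
split; first exact: sqrtr_ge0.
split.
  by apply: ler_wsqrtr; apply: ler_wpM2r => //; exact: hs.
split=> [k /andP[k0 k1]|k x x01 k0 kx].
  have kk : 0 <= k by exact: le_trans (sqrtr_ge0 _) k0.
  apply: (regular_between s01 t01); rewrite dotvZl dotvZr mulrA -expr2.
  have bn := lt0r_neq0 bb.
  rewrite -[rho s](divfK bn) -[rho t](divfK bn) !ler_pM2r//.
  rewrite -(sqr_sqrtr (q0 s)) -(sqr_sqrtr (q0 t)).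
  by rewrite !ler_pXn2r// ?nnegrE ?sqrtr_ge0// k0.
have kE : k = Num.sqrt (rho x / dotv b b).
  by rewrite -kx mulfK ?gt_eqF// sqrtr_sqr ger0_norm.
rewrite kE; apply/andP; split; apply: ler_wsqrtr; apply: ler_wpM2r => //.
  exact: hs.
exact: ht.
Qed.

(** Otherwise the curve is first rotated onto the ray of [b], by a rotation
that depends continuously on time; it returns to the fibre over [b] up to a
rotation that fixes [b]. *)
Lemma lift_component_neq0 : connected_component (fiber a b) (gam 0) (gam 1).
Proof.
have [k0 [k1 [k00 [k01 [kreg krho]]]]] := segment_regular.
have bb : 0 < dotv b b by rewrite dotv_gt0 b0.
pose Z : set 'rV[R]_d := [set k *: b | k in `[k0, k1]].
have Zc : closed Z.
  apply: compact_closed; first exact: norm_hausdorff.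
  apply: continuous_compact; last exact: segment_compact.
  apply: continuous_subspaceT.
  apply: (@lipschitz_continuous _ R^o _ (fun k : R => k *: b) `|b|) => x y.
  by rewrite -scalerBl normrZ mulrC.
have Zr : Z `<=` regular_value a.
  by move=> _ [k kk <-]; apply: kreg; move: kk; rewrite /= in_itv.
have ZI (k t : R) (g : 'M[R]_d) : 0 <= t <= 1 -> orthogonal g -> 0 <= k ->
    c t *m g = k *: b -> fibers_over a Z (gam t *m g).
  move=> t01 og kk ctg; split; first by apply: spheres_orthogonal => //; exact: Sgam.
  rewrite wsum_mulmx ctg; exists k => //.
  rewrite /= in_itv/=; apply: (krho _ t) => //.
  by rewrite /rho -(orthogonal_dotv (c t) (c t) og) ctg dotvZl dotvZr mulrA expr2.
(* up to time t, the curve can be rotated onto the ray without leaving the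
   component of its starting point *)
pose P t := exists g : 'M[R]_d, [/\ orthogonal g, \det g = 1,
  exists2 k : R, 0 <= k & c t *m g = k *: b &
  connected_component (fibers_over a Z) (gam 0) (gam t *m g)].
(* h turns the direction of c t back to that of c s, along the short way *)
have rot s t : 0 <= s <= 1 -> 0 <= t <= 1 ->
    (forall x, (s <= x <= t) || (t <= x <= s) -> 0 < dotv (c s) (c x)) ->
    exists h : 'M[R]_d, [/\ orthogonal h, \det h = 1,
      exists2 k : R, 0 < k & c t *m h = k *: c s &
      forall (g : 'M[R]_d) (k : R), orthogonal g -> 0 <= k ->
        c s *m g = k *: b ->
        connected_component (fibers_over a Z) (gam s *m g) (gam t *m (h *m g))].
  move=> s01 t01 pos.
  have post : 0 < dotv (c s) (c t).
    by apply: pos; rewrite !lexx andbT andTb; exact: le_total.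
  exists (align (c s) (c t)); split.
  - exact: align_orthogonal.
  - exact: det_align.
  - exists (vlen (c t) / vlen (c s)); last exact: mul_align.
    by rewrite divr_gt0// vlen_gt0// c_neq0.
  move=> g k og kk csg.
  pose f x := gam x *m align (c s) (c x) *m g.
  have fs : f s = gam s *m g by rewrite /f align_xx ?mulmx1// c_neq0.
  have ft : f t = gam t *m (align (c s) (c t) *m g) by rewrite /f mulmxA.
  have fc x : (s <= x <= t) || (t <= x <= s) -> continuous_at x f.
    move=> xst; apply: continuous_mulmx; last exact: cst_continuous.
    apply: continuous_mulmx; first exact: gamc.
    by apply: continuous_align; [exact: pos|exact: cc].
  have fZ x : (s <= x <= t) || (t <= x <= s) -> fibers_over a Z (f x).
    move=> xst; have x01 : 0 <= x <= 1.
      move: s01 t01 => /andP[s0 s1] /andP[t0 t1].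
      by case/orP: xst => /andP[h1 h2]; rewrite (le_trans _ h1)// (le_trans h2).
    have oA := orthogonalM (align_orthogonal (pos x xst)) og.
    have kA : 0 <= vlen (c x) / vlen (c s) * k.
      by rewrite mulr_ge0// divr_ge0// sqrtr_ge0.
    rewrite /f -mulmxA; apply: (ZI _ _ _ x01 oA kA).
    by rewrite mulmxA mul_align ?pos// -scalemxAl csg scalerA.
  rewrite -fs -ft; case: (lerP s t) => st.
    apply: path_connected_component => // x xst; [apply: fc|apply: fZ];
      by rewrite xst.
  apply: connected_component_sym.
  apply: path_connected_component => [|x xst|x xst]; first exact: ltW.
    by apply: fc; rewrite xst orbT.
  by apply: fZ; rewrite xst orbT.
have P0 : P 0.
  exists 1%:M; split; [exact: orthogonal1|exact: det1| |].
    by exists 1 => //; rewrite mulmx1 scale1r.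
  rewrite mulmx1; apply: connected_component_refl.
  rewrite -[gam 0]mulmx1; apply: (ZI _ _ _ zero_in01 (@orthogonal1 R d) ler01).
  by rewrite mulmx1 scale1r.
have loc t : `[0, 1]%classic t -> exists W : set R, [/\ open W, W t &
    forall s, `[0, 1]%classic s -> W s -> (P t <-> P s)].
  rewrite /= in_itv/= => t01.
  have pt : 0 < dotv (c t) (c t) by rewrite dotv_gt0 c_neq0.
  have ct : continuous_at t (fun s => dotv (c t) (c s)).
    by apply: continuous_dotv; [exact: cst_continuous|exact: cc].
  have /cvgrPdist_lt/(_ _ pt) := ct.
  rewrite -nbhs_nearE => /nbhs_ballP[e /= e0 he].
  exists (ball t e); split; [exact: ball_open|exact: ballxx|].
  move=> s; rewrite /= in_itv/= => s01 ts.
  have [] := rot t s t01 s01.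
    move=> x xts.
    have bx : ball t e x.
      move: ts; rewrite /ball/= !ltr_norml => /andP[h1 h2].
      by case/orP: xts => /andP[h3 h4]; apply/andP; split; lra.
    by have := he x bx; rewrite ltr_norml => /andP[h1 h2]; lra.
  move=> h [oh dh [l l0 csh] hconn]; split.
    move=> [g [og dg [k kk ctg] cg]].
    exists (h *m g); split; first exact: orthogonalM.
    - by rewrite det_mulmx dh dg mulr1.
    - exists (l * k); first by rewrite mulr_ge0// ltW.
      by rewrite mulmxA csh -scalemxAl ctg scalerA.
    - exact: connected_component_trans cg (hconn g k og kk ctg).
  move=> [g [og dg [k kk csg] cg]].
  have ohT := orthogonal_tr oh.
  have ctg : c t *m (h^T *m g) = (l^-1 * k) *: b.
    have ctE : c t = l^-1 *: (c s *m h).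
      by rewrite csh scalerA mulVf ?gt_eqF// scale1r.
    by rewrite ctE -scalemxAl mulmxA -(mulmxA (c s)) oh mulmx1 csg scalerA.
  have ohg : orthogonal (h^T *m g) by exact: orthogonalM.
  have lk : 0 <= l^-1 * k by rewrite mulr_ge0// invr_ge0 ltW.
  exists (h^T *m g); split => //.
  - by rewrite det_mulmx det_tr dh dg mulr1.
  - by exists (l^-1 * k).
  - have := hconn _ _ ohg lk ctg; rewrite [h *m _]mulmxA oh mul1mx.
    by move=> /connected_component_sym; exact: connected_component_trans.
have [g [og dg [k kk c1g] cg]] : P 1.
  apply: (locally_constant_connected (@segment_connected _ 0 1) loc _ _ P0);
    by rewrite /= in_itv/= lexx ler01.
have bg : b *m g = b.
  rewrite -{1}gam1 [LHS]c1g.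
  have : k ^+ 2 * dotv b b = dotv b b.
    have := orthogonal_dotv (c 1) (c 1) og.
    by rewrite c1g /c gam1 dotvZl dotvZr mulrA expr2.
  move=> /(congr1 (fun x => x / dotv b b)); rewrite mulfK ?gt_eqF//.
  rewrite divff ?gt_eqF// => /eqP; rewrite sqrf_eq1 => /orP[/eqP -> |/eqP k1'].
    by rewrite scale1r.
  by move: kk; rewrite k1' => h; exfalso; lra.
have F1 : fiber a b (gam 1) by split => //; exact: Sgam one_in01.
apply: (@connected_component_trans _ _ (gam 1 *m g)); last first.
  by apply: connected_component_sym; exact: rotation_component.
apply: (@fiber_retraction _ _ _ a Z) => //.
- move=> _ _ l [x xk <-] [y yk <-] /andP[l0 l1].
  exists (x + l * (y - x)); last first.
    by apply/rowP => i; rewrite !mxE; ring.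
  move: xk yk; rewrite /= !in_itv/= => /andP[x0 x1] /andP[y0 y1].
  have h1 : 0 <= (1 - l) * (x - k0) by rewrite mulr_ge0//; lra.
  have h2 : 0 <= l * (y - k0) by rewrite mulr_ge0//; lra.
  have h3 : 0 <= (1 - l) * (k1 - x) by rewrite mulr_ge0//; lra.
  have h4 : 0 <= l * (k1 - y) by rewrite mulr_ge0//; lra.
  by apply/andP; split; lra.
- exists 1; last by rewrite scale1r.
  rewrite /= in_itv/=; apply: (krho 1 0) => //.
  by rewrite /rho /c gam0; ring.
- by rewrite wsum_mulmx gam1.
Qed.

End AwayFromZero.

(** Over a ball around the origin every loop can be contracted radially; outside
of it a loop may wind around the origin, but rotating the spheres unwinds it. *)
Lemma lift_component : connected_component (fiber a b) (gam 0) (gam 1).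
Proof.
have [[s [s01 cs0]]|h] := pselect (exists s, 0 <= s <= 1 /\ c s = 0).
  exact: component_through_zero s01 cs0.
apply: lift_component_neq0 => t t01; apply/eqP => ct0; apply: h.
by exists t.
Qed.

End LoopComponent.

(** * Piecewise smooth curves *)

Section Piecewise.
Context {R : realType}.

Lemma within_partition_continuous {V : normedModType R} (c : R -> V) (x y : R)
    (s : seq R) : itv_partition x y s ->
  (forall i, (i < size s)%N ->
    {within `[nth 0 (x :: s) i, nth 0 s i], continuous c}) ->
  {within `[x, y], continuous c}.
Proof.
elim: s x => [|z s IH] x.
  move=> /itv_partition_nil -> _; apply/subspace_continuousP => w.
  rewrite /= in_itv/= => wy; apply/cvgrPdist_lt => e e0; near=> v.
  have : `[y, y]%classic v by near: v; exact: withinT.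
  rewrite /= in_itv/= => vy.
  by rewrite -(le_anti wy) -(le_anti vy) subrr normr0.
move=> xys h; have zy := itv_partition_cons xys.
have xz : x <= z by case: xys => /= /andP[/ltW].
rewrite (_ : `[x, y]%classic = `[x, z] `|` `[z, y]); last first.
  have zley := itv_partition_le zy.
  apply/seteqP; split => w /=; rewrite !in_itv/=.
    by move=> /andP[xw ->]; rewrite xw andbT /=; apply/orP; exact: le_total.
  move=> [/andP[-> wz]|/andP[zw ->]]; first exact: le_trans wz zley.
  by rewrite (le_trans xz zw).
apply: withinU_continuous; [exact: interval_closed|exact: interval_closed| |].
  exact: (h 0%N).
by apply: IH => // i ilt; exact: (h i.+1).
Unshelve. all: by end_near. Qed.

Lemma piecewise_smooth_continuous {V : normedModType R} (D : V -> set V)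
    (c : R -> V) : piecewise_smooth_along D c -> {within `[0, 1], continuous c}.
Proof.
move=> [s s01 h]; apply: (within_partition_continuous s01) => i ilt.
have [W [g [oW sW gW cg]]] := h i ilt.
have gc : {within `[nth 0 (0 :: s) i, nth 0 s i], continuous g}.
  apply: continuous_in_subspaceT => t; rewrite inE => /sW Wt.
  by apply/differentiable_continuous/derivable1_diffP; exact: (gW 0%N).
apply: subspace_eq_continuous gc => t; rewrite inE => ti.
by have [] := cg t ti.
Qed.

Lemma clamp01_continuous {V : normedModType R} (c : R -> V) :
  {within `[0, 1], continuous c} ->
  continuous (fun t : R => c (Num.max 0 (Num.min t 1))).
Proof.
move=> /subspace_continuousP cc t.
pose k (t : R) := Num.max 0 (Num.min t 1).
have k01 s : `[0, 1]%classic (k s).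
  by rewrite /= in_itv/= le_max lexx/= ge_max ge_min lexx orbT andbT.
have kc : continuous k.
  apply: (@lipschitz_continuous _ R^o R^o k 1) => x y; rewrite mul1r.
  exact: le_trans (max_lip _ _ _) (min_lip _ _ _).
apply/cvgrPdist_lt => e e0.
have /cvgrPdist_lt/(_ _ e0) := cc _ (k01 t); rewrite near_withinE => h.
have /nbhs_ballP[del /= del0 hd] := h.
have /cvgrPdist_lt/(_ _ del0) := kc t.
by apply: filterS => s ks; apply: (hd (k s)); [exact: ks|exact: k01].
Qed.

(** The index is capped so that the final time 1 belongs to the last curve. *)
Definition glue {V : normedModType R} (gs : seq (R -> V)) (t : R) : V :=
  let i := minn (Num.truncn ((size gs)%:R * t)) (size gs).-1 in
  nth (fun=> 0) gs i ((size gs)%:R * t + - i%:R).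

Lemma glue_on {V : normedModType R} (gs : seq (R -> V)) i (t : R) :
  (i < size gs)%N ->
  (forall j, (j.+1 < size gs)%N ->
    nth (fun=> 0) gs j 1 = nth (fun=> 0) gs j.+1 0) ->
  i%:R <= (size gs)%:R * t <= i.+1%:R ->
  glue gs t = nth (fun=> 0) gs i ((size gs)%:R * t + - i%:R).
Proof.
move=> ilt hm /andP[it]; rewrite /glue.
have iN : (i <= (size gs).-1)%N by case: (size gs) ilt.
rewrite le_eqVlt => /orP[/eqP ti|ti]; last first.
  have -> : Num.truncn ((size gs)%:R * t) = i by apply: truncn_def; rewrite it.
  by rewrite (minn_idPl iN).
rewrite ti natrK; have [iN'|iN'] := ltnP i.+1 (size gs).
  have -> : minn i.+1 (size gs).-1 = i.+1.
    by apply/minn_idPl; case: (size gs) iN'.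
  by rewrite subrr -hm// -natr1 addrAC subrr add0r.
have -> : minn i.+1 (size gs).-1 = i => //.
have -> : (size gs).-1 = i.
  by apply/eqP; rewrite eqn_leq iN andbT; case: (size gs) iN'.
exact/minn_idPr.
Qed.

Lemma glue_start {V : normedModType R} (gs : seq (R -> V)) : (0 < size gs)%N ->
  (forall j, (j.+1 < size gs)%N ->
    nth (fun=> 0) gs j 1 = nth (fun=> 0) gs j.+1 0) ->
  glue gs 0 = nth (fun=> 0) gs 0 0.
Proof.
by move=> g0 hm; rewrite (@glue_on _ _ 0)// mulr0 ?lexx ?ler01// oppr0 addr0.
Qed.

Lemma glue_end {V : normedModType R} (gs : seq (R -> V)) : (0 < size gs)%N ->
  (forall j, (j.+1 < size gs)%N ->
    nth (fun=> 0) gs j 1 = nth (fun=> 0) gs j.+1 0) ->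
  glue gs 1 = nth (fun=> 0) gs (size gs).-1 1.
Proof.
move=> g0 hm; rewrite (@glue_on _ _ (size gs).-1) ?prednK//.
  rewrite mulr1; congr (nth _ _ _ _).
  by rewrite -{1}(prednK g0) -natr1 addrAC subrr add0r.
by rewrite mulr1 lexx andbT ler_nat leq_pred.
Qed.

Lemma glue_index (N : nat) (t : R) : (0 < N)%N -> 0 <= t <= 1 ->
  exists2 i, (i < N)%N & i%:R <= N%:R * t <= i.+1%:R.
Proof.
move=> N0 /andP[t0 t1].
have Nt0 : 0 <= N%:R * t by rewrite mulr_ge0.
have /andP[h1 h2] := truncn_itv Nt0.
have [lt|ge] := ltnP (Num.truncn (N%:R * t)) N.
  by exists (Num.truncn (N%:R * t)) => //; rewrite h1 ltW.
exists N.-1; first by rewrite prednK.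
rewrite prednK//; apply/andP; split.
  by apply: le_trans h1; rewrite ler_nat (leq_trans _ ge)// leq_pred.
by rewrite ler_piMr.
Qed.

Lemma glue_piecewise_smooth p q (D : 'M[R]_(p, q) -> set 'M[R]_(p, q))
    (gs : seq (R -> 'M[R]_(p, q))) :
  (0 < size gs)%N ->
  (forall z v (k : R), D z v -> D z (k *: v)) ->
  (forall j, (j.+1 < size gs)%N ->
    nth (fun=> 0) gs j 1 = nth (fun=> 0) gs j.+1 0) ->
  (forall i, (i < size gs)%N ->
    (exists O : set R, [/\ open O, `[0, 1] `<=` O &
       forall n, Ck n O (nth (fun=> 0) gs i)]) /\
    forall t : R, 0 <= t <= 1 ->
      D (nth (fun=> 0) gs i t) (derive1 (nth (fun=> 0) gs i) t)) ->
  piecewise_smooth_along D (glue gs).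
Proof.
move=> g0 DZ hm hg; set N := size gs.
have N0 : (0 : R) < N%:R by rewrite ltr0n.
pose s : seq R := mkseq (fun i => i.+1%:R / N%:R) N.
have sz : size s = N by rewrite size_mkseq.
have ns i : (i < N)%N -> nth 0 s i = i.+1%:R / N%:R.
  by move=> iN; rewrite nth_mkseq.
have ns0 i : (i < N)%N -> nth 0 (0 :: s) i = i%:R / N%:R.
  by case: i => [|i] iN /=; [rewrite mul0r|rewrite ns// ltnW].
exists s.
  split.
    apply/(pathP 0) => i; rewrite sz => iN.
    by rewrite ns0// ns// ltr_pM2r ?invr_gt0// ltr_nat.
  have NE : N = N.-1.+1 by rewrite prednK.
  rewrite (last_nth 0) sz [X in nth _ _ X]NE /= ns; last by rewrite {2}NE.
  by rewrite -NE divff ?eqxx// gt_eqF.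
rewrite sz => i iN; rewrite ns0// ns//.
have [[W [oW W01 CW]] Dg] := hg i iN.
pose phi (t : R) := N%:R * t + - i%:R.
have phic : continuous phi.
  apply: (@lipschitz_continuous _ R^o R^o phi N%:R) => x y.
  by rewrite /phi opprD addrACA subrr addr0 -mulrBr normrM ger0_norm// ltW.
have itvE (t : R) : t \in `[i%:R / N%:R, i.+1%:R / N%:R] ->
    i%:R <= N%:R * t <= i.+1%:R.
  by rewrite in_itv/= ler_pdivrMr// ler_pdivlMr// mulrC.
have phi01 (t : R) : t \in `[i%:R / N%:R, i.+1%:R / N%:R] -> 0 <= phi t <= 1.
  move=> /itvE; rewrite /phi -natr1 => /andP[h1 h2]; apply/andP; split; lra.
exists (phi @^-1` W), (fun t => nth (fun=> 0) gs i (N%:R * t + - i%:R)); split.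
- by apply: open_comp => // x _; exact: phic.
- by move=> t /phi01 h; apply: W01; rewrite /= in_itv.
- apply: Ck_smooth; first by apply: open_comp => // x _; exact: phic.
  by move=> n; exact: (Ck_affine_mx _ _ (CW n)).
move=> t ti; have -> : glue gs t = nth (fun=> 0) gs i (N%:R * t + - i%:R).
  by apply: glue_on => //; exact: itvE.
split => //.
have Wt : W (phi t) by apply: W01; rewrite /= in_itv/= phi01.
have d1 := Ck1_derivable (CW 1%N) Wt.
rewrite (derive1_val (is_derive_affine_mx d1)).
by apply: DZ; apply: Dg; exact: phi01.
Qed.

End Piecewise.

(** * From horizontal chains to the holonomy group *)

(** The inclusion has a section on [A], continuous for the initial topology, that
maps a connected set of [T] inside [A] to a connected set of the subtype. *)
Lemma component_subtype {T : topologicalType} (A : set T) (x y : A) :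
  connected_component A (\val x) (\val y) ->
  connected_component [set: A] x y.
Proof.
move=> [B [Bx BA Bc] By].
pose r (z : T) : A := if pselect (A z) is left Az then SigSub (mem_set Az) else x.
have rK z : A z -> \val (r z) = z.
  by rewrite /r => Az; case: pselect.
have rv (w : A) : r (\val w) = w by apply/val_inj/rK/set_valP.
exists [set r z | z in B]; last by exists (\val y); rewrite ?rv.
split => //; first by exists (\val x); rewrite ?rv.
apply: connected_continuous_connected => //.
apply: (@continuous_comp_initial _ _ _ _ (r : subspace B -> _)).
have idc : {within B, continuous (fun z : T => z)}.
  by apply: continuous_subspaceT => z; exact: cvg_id.
apply: subspace_eq_continuous idc => z; rewrite inE => Bz /=.
exact/esym/rK/BA.
Qed.

Section HolonomyComponents.
Context {R : realType} {m d : nat}.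
Variables (a : 'I_m -> R) (b : 'rV[R]_d) (U : set 'rV[R]_d).
Hypothesis Ureg : U `<=` regular_value a.

Lemma holonomy_component (h : fiber a b -> fiber a b) (x : fiber a b) :
  holonomy_group a b U h -> connected_component [set: fiber a b] x (h x).
Proof.
move=> [c [_ c0 c1 cU] hol]; apply: component_subtype.
have [gam [[[Sg pg] fg] g0 g1]] := hol x.
pose k (t : R) := Num.max 0 (Num.min t 1).
have k01 s : 0 <= k s <= 1.
  by rewrite le_max lexx/= ge_max ge_min lexx orbT andbT ler01.
have kid s : 0 <= s <= 1 -> k s = s.
  by move=> /andP[s0 s1]; rewrite /k (min_idPl s1) (max_idPr s0).
have k0 : k 0 = 0 by apply: kid; rewrite lexx ler01.
have k1 : k 1 = 1 by apply: kid; rewrite lexx ler01.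
have := @lift_component _ _ _ a b (fun t => gam (k t)).
rewrite k0 k1 g0 g1; apply.
- exact/clamp01_continuous/(piecewise_smooth_continuous pg).
- by move=> t _; apply: Sg; rewrite in_itv/= k01.
- by move=> t _; apply: Ureg; rewrite fg ?in_itv/= ?k01//; apply: cU; rewrite in_itv/= k01.
- by have [] := set_valP x.
- by have [] := set_valP (h x).
Qed.

End HolonomyComponents.

Section Chains.
Context {R : realType} {m d : nat}.
Notation E := 'M[R]_(m, d).
Variables (a : 'I_m -> R) (U : set 'rV[R]_d).
Hypothesis Ureg : U `<=` regular_value a.
Implicit Types (z : E) (g : R -> E) (gs : seq (R -> E)).

Lemma Delta_scale z V (k : R) : Delta a z V -> Delta a z (k *: V).
Proof.
move=> [TV hV]; split.
  by move=> j; rewrite linearZ/= dotvZr TV mulr0.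
move=> W KW; rewrite -[RHS](mulr0 k) -(hV W KW) /prod_metric mulr_sumr.
by apply: eq_bigr => j _; rewrite linearZ/= dotvZl.
Qed.

(** Being defined for all times, these curves are stable under the affine changes
of time that subdivide or reverse them. *)
Definition control_piece g : Prop :=
  [/\ forall n, Ck n setT g,
      forall t, spheres (g t) /\ Delta a (g t) (derive1 g t) &
      forall t : R, 0 <= t <= 1 -> U (wsum a (g t))].

Fixpoint chain (Q : (R -> E) -> Prop) z gs z' : Prop :=
  if gs is g :: gs' then [/\ Q g, g 0 = z & chain Q (g 1) gs' z'] else z = z'.

Lemma chain_cat Q z1 gs z2 gs' z3 :
  chain Q z1 gs z2 -> chain Q z2 gs' z3 -> chain Q z1 (gs ++ gs') z3.
Proof.
elim: gs z1 => [|g gs IH] z1 /=; first by move=> ->.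
by move=> [Qg g0 h] h'; split => //; exact: IH.
Qed.

Lemma chain_nth Q z gs z' : chain Q z gs z' ->
  [/\ forall i, (i < size gs)%N -> Q (nth (fun=> 0) gs i),
     (0 < size gs)%N -> nth (fun=> 0) gs 0 0 = z,
     (0 < size gs)%N -> nth (fun=> 0) gs (size gs).-1 1 = z' &
     forall i, (i.+1 < size gs)%N ->
       nth (fun=> 0) gs i 1 = nth (fun=> 0) gs i.+1 0].
Proof.
elim: gs z => [|g gs IH] z //= [Qg g0 hc]; have [h1 h2 h3 h4] := IH _ hc.
split => //.
- by case.
- by case: gs hc h3 {IH h1 h2 h4} => //= g' gs _ h3 _; exact: h3.
- by case=> [|i] ilt; [rewrite h2|exact: h4].
Qed.

Definition short_piece g : Prop :=
  control_piece g /\ liftable a (fun t => wsum a (g t)).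

Definition reach z z' : Prop := exists gs, chain short_piece z gs z'.

Lemma reach_refl z : reach z z. Proof. by exists [::]. Qed.

Lemma reach_trans z1 z2 z3 : reach z1 z2 -> reach z2 z3 -> reach z1 z3.
Proof. by move=> [gs h] [gs' h']; exists (gs ++ gs'); exact: chain_cat h'. Qed.

Lemma control_piece_affine g (k l : R) : control_piece g ->
  (forall t, 0 <= t <= 1 -> 0 <= k * t + l <= 1) ->
  control_piece (fun t => g (k * t + l)).
Proof.
move=> [Cg Hg Ug] kl; split.
- by move=> n; exact: (Ck_affine_mx k l (Cg n)).
- move=> t; have [Sg Dg] := Hg (k * t + l); split; first exact: Sg.
  have d1 := Ck1_derivable (Cg 1%N) (I : setT (k * t + l)).
  by rewrite (derive1_val (is_derive_affine_mx d1)); exact: Delta_scale.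
- by move=> t t01; exact/Ug/kl.
Qed.

Lemma Ck_wsum n g : Ck n setT g -> Ck n setT (fun t => wsum a (g t)).
Proof.
move=> Cg; apply: Ck_mx => i k; rewrite [i]ord1.
under eq_fun do rewrite wsum_entry.
by apply: Ck_sum => j; apply: CkZ; exact: Ck_entry.
Qed.

Lemma reach_control_piece g : control_piece g -> reach (g 0) (g 1).
Proof.
move=> Pg; have [Cg Hg Ug] := Pg.
have Cf n : Ck n setT (fun t => wsum a (g t)) by exact: Ck_wsum.
have [n0 hn] := liftable_subdivision Cf (fun t t01 => Ureg (Ug t t01)).
pose n := n0.+1; have n0' : (0 : R) < n%:R by rewrite ltr0n.
suff H k : (k <= n)%N -> reach (g 0) (g (k%:R / n%:R)).
  by have := H n (leqnn n); rewrite divff ?gt_eqF.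
elim: k => [_|k IH kn]; first by rewrite mul0r; exact: reach_refl.
apply: reach_trans (IH (ltnW kn)) _.
exists [:: fun t => g (n%:R^-1 * t + k%:R / n%:R)] => /=; split.
- split; last exact: hn.
  apply: control_piece_affine => // t /andP[t0 t1].
  rewrite [_^-1 * _]mulrC -mulrDl divr_ge0 ?addr_ge0//=.
  by rewrite ler_pdivrMr// mul1r (le_trans (lerD t1 (lexx _)))// nat1r ler_nat.
- by rewrite mulr0 add0r.
- by rewrite mulr1 -[X in X + _]mul1r -mulrDl nat1r.
Qed.

(** Reversed pieces need not be liftable as they stand, hence the subdivision. *)
Lemma reach_sym z z' : reach z z' -> reach z' z.
Proof.
move=> [gs]; elim: gs z => [|g gs IH] z /=; first by move=> ->; exact: reach_refl.
move=> [[Pg _] <- /IH h]; apply: reach_trans h _.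
have := @control_piece_affine g (- 1) 1 Pg.
have h (t : R) : 0 <= t <= 1 -> 0 <= - 1 * t + 1 <= 1.
  by move=> /andP[t0 t1]; apply/andP; split; lra.
move=> /(_ h)/reach_control_piece; rewrite mulr0 add0r mulr1.
by rewrite addNr.
Qed.

Lemma lift_chain z gs z' y : chain short_piece z gs z' ->
  spheres y -> wsum a y = wsum a z ->
  exists hs y', [/\ size hs = size gs, chain (horizontal_piece a) y hs y',
    spheres y', wsum a y' = wsum a z' &
    forall i t, (i < size gs)%N -> 0 <= t <= 1 ->
      wsum a (nth (fun=> 0) hs i t) = wsum a (nth (fun=> 0) gs i t)].
Proof.
elim: gs z y => [|g gs IH] z y /=.
  by move=> <- Sy fy; exists [::], y.
move=> [[Pg lg] g0 hgs] Sy fy.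
have [|h [h0 hp hw]] := lg y Sy; first by rewrite g0.
have one01 : 0 <= (1 : R) <= 1 by rewrite lexx ler01.
have [Sh1 _] := hp.2 1 one01.
have [hs [y' [sz ch Sy' fy' hnth]]] := IH _ _ hgs Sh1 (hw 1 one01).
exists (h :: hs), y'; split => //=; first by rewrite sz.
by case=> [|i] t ilt t01 /=; [exact: hw|exact: hnth].
Qed.

Lemma horizontal_glue y hs y' : (0 < size hs)%N ->
  chain (horizontal_piece a) y hs y' ->
  [/\ horizontal a (glue hs), glue hs 0 = y & glue hs 1 = y'].
Proof.
move=> s0 /chain_nth[h1 h2 h3 h4].
split; [split|by rewrite glue_start// h2|by rewrite glue_end// h3].
  move=> t; rewrite in_itv/= => t01; have [i ilt it] := glue_index s0 t01.
  rewrite (glue_on ilt h4 it); have [_ hS] := h1 i ilt.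
  apply: (hS _ _).1; move: it; rewrite -natr1 => /andP[i1 i2].
  by apply/andP; split; lra.
apply: glue_piecewise_smooth => //; first by move=> z v k; exact: Delta_scale.
by move=> i ilt; have [hO hS] := h1 i ilt; split => // t t01; have [] := hS t t01.
Qed.

(** The chain projects to a loop, of which it is itself a horizontal lift; since
its pieces are liftable, the loop also lifts, piece by piece, from all other
points of the fibre, and these lifts define the holonomy. *)
Lemma reach_holonomy b (x y : fiber a b) : U b ->
  reach (\val x) (\val y) ->
  exists2 h, holonomy_group a b U h & h x = y.
Proof.
move=> Ub [gs0 hgs0].
have [Sx fx] := set_valP x; have [Sy fy] := set_valP y.
have [gs hgs s0] : exists2 gs, chain short_piece (\val x) gs (\val y) &
    (0 < size gs)%N.
  case: gs0 hgs0 => [/= xy|g gs h]; last by exists (g :: gs).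
  exists [:: fun=> \val x] => //=; split => //; split; last first.
    move=> z Sz fz; exists (fun=> z); split => //; split.
      by exists setT; split; [exact: openT|by []|move=> n; exact: Ck_cst].
    move=> t _; split; first exact: Sz.
    rewrite (derive1_val (is_derive_cst z t 1)).
    by rewrite -(scale0r (hfield a z 0)); apply: Delta_scale; exact: hfield_horizontal.
  split; first by move=> n; exact: Ck_cst.
    move=> t; split; first exact: Sx.
    rewrite (derive1_val (is_derive_cst (\val x) t 1)).
    rewrite -(scale0r (hfield a (\val x) 0)).
    by apply: Delta_scale; exact: hfield_horizontal.
  by move=> t _; rewrite fx.
pose c t := wsum a (glue gs t).
have [k1 k2 k3 k4] := chain_nth hgs.
have hpiece g : short_piece g -> horizontal_piece a g.
  move=> [[Cg Hg _] _]; split; first by exists setT; split; [exact: openT|by []|exact: Cg].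
  by move=> t _; exact: Hg.
have lift0 : horizontal_lift a c (glue gs) /\ glue gs 0 = \val x /\
    glue gs 1 = \val y.
  have hch : chain (horizontal_piece a) (\val x) gs (\val y).
    elim: (gs) (\val x) hgs => //= g gs' IH z [Pg g0 h].
    by split => //; [exact: hpiece|exact: IH].
  by have [H g0 g1] := horizontal_glue s0 hch.
have lifts (q : fiber a b) : exists q' : fiber a b, (q = x -> q' = y) /\
    exists gam, [/\ horizontal_lift a c gam, gam 0 = \val q & gam 1 = \val q'].
  have [->|qx] := pselect (q = x).
    exists y; split => //; exists (glue gs).
    by have [? [? ?]] := lift0.
  have [Sq fq] := set_valP q.
  have [|hs [y' [sz ch Sy' fy' hnth]]] := lift_chain hgs Sq; first by rewrite fq fx.
  have Fy' : fiber a b y' by split => //; rewrite fy' fy.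
  exists (SigSub (mem_set Fy')); split => //; exists (glue hs).
  have sh0 : (0 < size hs)%N by rewrite sz.
  have [H g0 g1] := horizontal_glue sh0 ch.
  split => //; split => // t; rewrite in_itv/= => t01.
  have [i ilt it] := glue_index s0 t01.
  have [_ _ _ m4] := chain_nth ch.
  rewrite /c (glue_on ilt k4 it) -hnth//; last first.
    by move: it; rewrite -natr1 => /andP[i1 i2]; apply/andP; split; lra.
  have ilt' : (i < size hs)%N by rewrite sz.
  have it' : i%:R <= (size hs)%:R * t <= i.+1%:R by rewrite sz.
  by rewrite (glue_on ilt' m4 it') sz.
have /choice[h hh] := lifts.
exists h; last by have [-> ] := hh x.
exists c; last by move=> q; have [_ [gam hgam]] := hh q; exists gam.
have [_ [g0 g1]] := lift0.
split.
- have cE : c = glue [seq (fun t => wsum a (g t)) | g <- gs].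
    apply/funext => t; rewrite /c /glue size_map.
    set i := minn _ _; have ilt : (i < size gs)%N.
      by apply: leq_ltn_trans (geq_minr _ _) _; rewrite prednK.
    by rewrite (nth_map (fun=> 0)).
  rewrite cE; apply: (@glue_piecewise_smooth _ _ _ (fun=> setT)) => //.
  + by rewrite size_map.
  + move=> j; rewrite size_map => jlt.
    by rewrite !(nth_map (fun=> 0)) ?k4// ltnW.
  + move=> i; rewrite size_map => ilt; split => //; exists setT; split => //.
      exact: openT.
    move=> n; rewrite (nth_map (fun=> 0))//; apply: Ck_wsum.
    by have [[Cg _ _] _] := k1 i ilt.
- by rewrite /c g0 fx.
- by rewrite /c g1 fy.
- move=> t; rewrite in_itv/= => t01; have [i ilt it] := glue_index s0 t01.
  rewrite /c (glue_on ilt k4 it); have [[_ _ Ug] _] := k1 i ilt; apply: Ug.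
  by move: it; rewrite -natr1 => /andP[i1 i2]; apply/andP; split; lra.
Qed.

End Chains.

(** * Hyperbolic boosts and explicit horizontal curves *)

Section Hyperbolic.
Context {R : realType}.
Implicit Types (s t : R).

Definition ch t : R := (expR t + expR (- t)) / 2.
Definition sh t : R := (expR t - expR (- t)) / 2.

Lemma ch0 : ch 0 = 1. Proof. by rewrite /ch oppr0 expR0; field. Qed.
Lemma sh0 : sh 0 = 0. Proof. by rewrite /sh oppr0 expR0 subrr mul0r. Qed.
Lemma chN t : ch (- t) = ch t. Proof. by rewrite /ch opprK addrC. Qed.
Lemma shN t : sh (- t) = - sh t.
Proof. by rewrite /sh opprK -mulNr opprB. Qed.

Lemma chD s t : ch (s + t) = ch s * ch t + sh s * sh t.
Proof. by rewrite /ch /sh opprD !expRD; field. Qed.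

Lemma shD s t : sh (s + t) = sh s * ch t + ch s * sh t.
Proof. by rewrite /ch /sh opprD !expRD; field. Qed.

Lemma ch_sh t : ch t ^+ 2 - sh t ^+ 2 = 1.
Proof.
have : expR t * expR (- t) = 1 by rewrite -expRD subrr expR0.
by rewrite /ch /sh => h; rewrite -[RHS]h; field.
Qed.

Lemma ch_gt_sh t : `|sh t| < ch t.
Proof.
rewrite /ch /sh ltr_norml; have := expR_gt0 t; have := expR_gt0 (- t) => h1 h2.
by apply/andP; split; lra.
Qed.

Lemma ch_inj s t : 0 <= s -> 0 <= t -> ch s = ch t -> s = t.
Proof.
move=> s0 t0; rewrite /ch !expRN => h.
have es := expR_gt0 s; have et := expR_gt0 t.
have : (expR s - expR t) * (expR s * expR t - 1) = 0.
  have -> : (expR s - expR t) * (expR s * expR t - 1) =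
      expR s * expR t * ((expR s + (expR s)^-1) - (expR t + (expR t)^-1)).
    by field; rewrite !gt_eqF.
  have -> : expR s + (expR s)^-1 = expR t + (expR t)^-1 by lra.
  by rewrite subrr mulr0.
move=> /eqP; rewrite mulf_eq0 !subr_eq0 => /orP[/eqP/expR_inj//|].
rewrite -expRD -expR0 => /eqP/expR_inj st; lra.
Qed.

Lemma is_derive_neg_exp t : is_derive t 1 (fun s : R => expR (- s)) (- expR (- t)).
Proof.
have h : is_derive t 1 (fun s : R => - s) (- 1).
  by apply: is_deriveN.
by have := is_derive_exp_fun h; rewrite mulrN1.
Qed.

Lemma is_derive_ch t : is_derive t 1 ch (sh t).
Proof.
have := is_deriveM_fun (is_deriveD_fun (is_derive_expR t) (is_derive_neg_exp t))
  (is_derive_cst (2^-1 : R) t 1).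
by rewrite mulr0 addr0.
Qed.

Lemma is_derive_sh t : is_derive t 1 sh (ch t).
Proof.
have h : is_derive t 1 (fun s => expR s - expR (- s)) (expR t + expR (- t)).
  have := is_deriveB (is_derive_expR t) (is_derive_neg_exp t).
  by rewrite opprK.
have := is_deriveM_fun h (is_derive_cst (2^-1 : R) t 1).
by rewrite mulr0 addr0.
Qed.

Lemma Ck_ch n O (f : R -> R) : Ck n O f -> Ck n O (fun t => ch (f t)).
Proof.
move=> Cf; apply: CkM; last exact: Ck_cst.
by apply: CkD; apply: Ck_exp => //; exact: CkN.
Qed.

Lemma Ck_sh n O (f : R -> R) : Ck n O f -> Ck n O (fun t => sh (f t)).
Proof.
move=> Cf; apply: CkM; last exact: Ck_cst.
by apply: CkB; apply: Ck_exp => //; exact: CkN.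
Qed.

End Hyperbolic.

Section Boost.
Context {R : realType} {d : nat}.
Implicit Types (v w : 'rV[R]_d) (x : 'rV[R]_(1 + d)) (s t : R).

(** A vector of R^{1+d} is written as its time coordinate [tim x] and its space
part [spc x]; a unit vector z of R^d is represented by the multiples of the
light-like vector with time coordinate 1 and space part z. *)
Definition tim x : R := lsubmx x 0 0.
Definition spc x : 'rV[R]_d := rsubmx x.

(** The infinitesimal Lorentz boost in the direction [v]. *)
Definition gen v : 'M[R]_(1 + d) := block_mx 0 v v^T 0.

(** The exponential of [t *: gen v] when [v] is a unit vector: then the cube of
[gen v] is [gen v]. *)
Definition boost v t : 'M[R]_(1 + d) :=
  1%:M + sh t *: gen v + (ch t - 1) *: (gen v *m gen v).

Lemma tim_lin (k : R) x y : tim (x + k *: y) = tim x + k * tim y.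
Proof. by rewrite /tim !mxE. Qed.

Lemma spc_lin (k : R) x y : spc (x + k *: y) = spc x + k *: spc y.
Proof. by apply/rowP => i; rewrite !mxE. Qed.

Lemma mul_gen v x :
  x *m gen v = row_mx (dotv v (spc x))%:M (tim x *: v).
Proof.
rewrite -{1}(hsubmxK x) /gen mul_row_block !mulmx0 add0r addr0; congr row_mx.
  by rewrite [LHS]mx11_scalar -dotvE dotvC.
by rewrite [lsubmx x]mx11_scalar mul_scalar_mx.
Qed.

Lemma tim_gen v x : tim (x *m gen v) = dotv v (spc x).
Proof. by rewrite mul_gen /tim row_mxKl mxE eqxx mulr1n. Qed.

Lemma spc_gen v x : spc (x *m gen v) = tim x *: v.
Proof. by rewrite mul_gen /spc row_mxKr. Qed.

Lemma time_space_eq x y : tim x = tim y -> spc x = spc y -> x = y.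
Proof.
move=> h0 h1; rewrite -(hsubmxK x) -(hsubmxK y); congr row_mx => //.
by rewrite [LHS]mx11_scalar [RHS]mx11_scalar; congr _%:M.
Qed.

Lemma mul_boost v t x : x *m boost v t =
  x + sh t *: (x *m gen v) + (ch t - 1) *: (x *m gen v *m gen v).
Proof. by rewrite /boost !mulmxDr mulmx1 -!scalemxAr mulmxA. Qed.

Section Unit.
Variable v : 'rV[R]_d.
Hypothesis v1 : dotv v v = 1.

Lemma tim_boost t x :
  tim (x *m boost v t) = ch t * tim x + sh t * dotv v (spc x).
Proof.
rewrite mul_boost !tim_lin !tim_gen spc_gen dotvZr v1; ring.
Qed.

Lemma spc_boost t x : spc (x *m boost v t) =
  spc x + (sh t * tim x + (ch t - 1) * dotv v (spc x)) *: v.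
Proof.
rewrite mul_boost !spc_lin !spc_gen tim_gen !scalerA.
by rewrite -addrA -scalerDl.
Qed.

Lemma dotv_spc_boost t x :
  dotv v (spc (x *m boost v t)) = ch t * dotv v (spc x) + sh t * tim x.
Proof. by rewrite spc_boost dotvDr dotvZr v1; ring. Qed.

Lemma boostD s t x : x *m boost v s *m boost v t = x *m boost v (s + t).
Proof.
apply: time_space_eq.
  by rewrite !tim_boost dotv_spc_boost chD shD; ring.
rewrite !spc_boost tim_boost dotvDr dotvZr v1 chD shD.
by apply/rowP => i; rewrite !mxE; ring.
Qed.

Lemma boost0 x : x *m boost v 0 = x.
Proof.
by rewrite mul_boost sh0 ch0 subrr !scale0r !addr0.
Qed.

End Unit.

Definition light_like x : Prop := 0 < tim x /\ tim x ^+ 2 = dotv (spc x) (spc x).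

Lemma unit_dotv_le v (y : 'rV[R]_d) : dotv v v = 1 ->
  dotv v y ^+ 2 <= dotv y y.
Proof.
move=> v1; have := dotv_ge0 (y - dotv v y *: v).
rewrite !(dotvDl, dotvDr, dotvZl, dotvZr, dotvNl, dotvNr) v1 (dotvC y v).
by lra.
Qed.

Lemma boost_light_like v t x : dotv v v = 1 -> light_like x ->
  light_like (x *m boost v t).
Proof.
move=> v1 [x0 xx]; have pl := unit_dotv_le (spc x) v1.
set p := dotv v (spc x) in pl *.
split.
  rewrite tim_boost// -/p.
  have : `|p| <= tim x.
    rewrite -(@ler_pXn2r _ 2)// ?nnegrE ?(ltW x0)//.
    by rewrite real_normK ?num_real// xx.
  have := ch_gt_sh t => hs hp.
  have h1 : `|sh t * p| <= `|sh t| * tim x by rewrite normrM ler_wpM2l.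
  have h2 : `|sh t| * tim x < ch t * tim x by rewrite ltr_pM2r.
  move: h1; rewrite ler_norml => /andP[h1 _]; lra.
rewrite tim_boost// spc_boost// !(dotvDl, dotvDr, dotvZl, dotvZr) v1.
rewrite -xx (dotvC (spc x)) -/p; apply/eqP; rewrite -subr_eq0.
rewrite (_ : _ - _ = (ch t ^+ 2 - sh t ^+ 2 - 1) * (tim x ^+ 2 - p ^+ 2)).
  by rewrite ch_sh subrr mul0r.
by ring.
Qed.

End Boost.

Section BoostPieces.
Context {R : realType} {m d : nat}.
Notation E := 'M[R]_(m, d).
Notation H := 'M[R]_(m, 1 + d).
Implicit Types (a : 'I_m -> R) (z : E) (X : H) (v w : 'rV[R]_d).

Definition light_rows X : Prop := forall j, light_like (row j X).

Definition proj X : E := \matrix_(j, k) (spc (row j X) 0 k / tim (row j X)).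

Definition homog z : H := \matrix_j row_mx 1%:M (row j z).

Lemma tim_homog z j : tim (row j (homog z)) = 1.
Proof. by rewrite /homog rowK /tim row_mxKl mxE eqxx. Qed.

Lemma spc_homog z j : spc (row j (homog z)) = row j z.
Proof. by rewrite /homog rowK /spc row_mxKr. Qed.

Lemma light_homog z : spheres z -> light_rows (homog z).
Proof.
by move=> Sz j; split; rewrite tim_homog ?ltr01// spc_homog Sz expr1n.
Qed.

Lemma proj_homog z : proj (homog z) = z.
Proof.
by apply/matrixP => j k; rewrite mxE tim_homog spc_homog divr1 mxE.
Qed.

Lemma proj_spheres X : light_rows X -> spheres (proj X).
Proof.
move=> LX j; have [t0 tt] := LX j.
have -> : row j (proj X) = (tim (row j X))^-1 *: spc (row j X).
  by apply/rowP => k; rewrite !mxE mulrC.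
by rewrite dotvZl dotvZr -tt; field; rewrite gt_eqF.
Qed.

(** The time-[t] flow of the gradient of z |-> <f(z), v>, in homogeneous
coordinates: the j-th point undergoes the boost of rapidity [a j * t]. *)
Definition boosts a v t X : H := \matrix_j (row j X *m boost v (a j * t)).

Lemma row_boosts a v t X j : row j (boosts a v t X) = row j X *m boost v (a j * t).
Proof. exact: rowK. Qed.

Lemma boosts_light a v t X : dotv v v = 1 -> light_rows X ->
  light_rows (boosts a v t X).
Proof. by move=> v1 LX j; rewrite row_boosts; exact: boost_light_like. Qed.

Lemma boosts0 a v X : dotv v v = 1 -> boosts a v 0 X = X.
Proof.
by move=> v1; apply/row_matrixP => j; rewrite row_boosts mulr0 boost0.
Qed.

Variables (a : 'I_m -> R) (v : 'rV[R]_d) (X : H) (t0 : R).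
Hypotheses (v1 : dotv v v = 1) (LX : light_rows X).

Let g (t : R) : E := proj (boosts a v (t0 * t) X).
Let tm j t := tim (row j (boosts a v (t0 * t) X)).
Let sp j t := spc (row j (boosts a v (t0 * t) X)).

Let tmE j t : tm j t = ch (a j * (t0 * t)) * tim (row j X) +
  sh (a j * (t0 * t)) * dotv v (spc (row j X)).
Proof. by rewrite /tm row_boosts tim_boost. Qed.

Let spE j t k : sp j t 0 k = spc (row j X) 0 k +
  (sh (a j * (t0 * t)) * tim (row j X) +
   (ch (a j * (t0 * t)) - 1) * dotv v (spc (row j X))) * v 0 k.
Proof. by rewrite /sp row_boosts spc_boost// !mxE. Qed.

Let tm_gt0 j t : 0 < tm j t.
Proof. by have [] := boosts_light a (t0 * t) v1 LX j. Qed.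

Let rap_derive j (t : R) : is_derive t 1 (fun s : R => a j * (t0 * s)) (a j * t0).
Proof.
have h := is_deriveM_fun (is_derive_cst (a j * t0) t 1) (is_derive_id t 1).
rewrite mul0r add0r mulr1 in h.
by rewrite (_ : (fun _ => _) = (fun s => a j * t0 * s))//; apply/funext => s; rewrite mulrA.
Qed.

Let ch_derive j (t : R) : is_derive t 1 (fun s => ch (a j * (t0 * s)))
  (sh (a j * (t0 * t)) * (a j * t0)).
Proof.
exact: (is_derive1_comp (f := ch) (is_derive_ch _) (rap_derive j t)).
Qed.

Let sh_derive j (t : R) : is_derive t 1 (fun s => sh (a j * (t0 * s)))
  (ch (a j * (t0 * t)) * (a j * t0)).
Proof.
exact: (is_derive1_comp (f := sh) (is_derive_sh _) (rap_derive j t)).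
Qed.

Let tm_derive j (t : R) : is_derive t 1 (tm j) (a j * t0 * dotv v (sp j t)).
Proof.
rewrite (_ : tm j = (fun t => ch (a j * (t0 * t)) * tim (row j X) +
  sh (a j * (t0 * t)) * dotv v (spc (row j X)))); last exact/funext/tmE.
have := is_deriveD_fun
  (is_deriveM_fun (ch_derive j t) (is_derive_cst (tim (row j X)) t 1))
  (is_deriveM_fun (sh_derive j t) (is_derive_cst (dotv v (spc (row j X))) t 1)).
by move=> h; apply: is_derive_eq h _; rewrite /sp row_boosts dotv_spc_boost// /cst; ring.
Qed.

Let sp_derive j k (t : R) : is_derive t 1 (fun s => sp j s 0 k) (a j * t0 * tm j t * v 0 k).
Proof.
rewrite (_ : (fun s => _) = (fun t => spc (row j X) 0 k +
  (sh (a j * (t0 * t)) * tim (row j X) +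
   (ch (a j * (t0 * t)) + - 1) * dotv v (spc (row j X))) * v 0 k)); last first.
  by apply/funext => s; rewrite spE.
have h1 := is_deriveM_fun (sh_derive j t) (is_derive_cst (tim (row j X)) t 1).
have h2 := is_deriveM_fun
  (is_deriveD_fun (ch_derive j t) (is_derive_cst (- 1 : R) t 1))
  (is_derive_cst (dotv v (spc (row j X))) t 1).
have h := is_deriveD_fun (is_derive_cst (spc (row j X) 0 k) t 1)
  (is_deriveM_fun (is_deriveD_fun h1 h2) (is_derive_cst (v 0 k) t 1)).
by apply: is_derive_eq h _; rewrite tmE /cst; ring.
Qed.

(** In homogeneous coordinates the equation is linear: the time coordinate grows
at the rate <v, space part> and the space part at the rate (time coordinate) v;
the quotient rule turns this into the tangential projection of [v]. *)
Lemma boost_curve_derive (t : R) : is_derive t 1 g (hfield a (g t) (t0 *: v)).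
Proof.
apply/is_derive_mx => j k.
have -> : (fun s => g s j k) = (fun s => sp j s 0 k * (tm j s)^-1).
  by apply/funext => s; rewrite mxE.
have tn : tm j t != 0 by rewrite gt_eqF.
have h := is_deriveM_fun (sp_derive j k t) (is_deriveV_fun tn (tm_derive j t)).
apply: is_derive_eq h _.
have Sg : spheres (g t) by apply: proj_spheres; exact: boosts_light.
rewrite hfieldE Sg dotvZl.
have -> : row j (g t) = (tm j t)^-1 *: sp j t.
  by apply/rowP => i; rewrite !mxE mulrC.
have -> : g t j k = sp j t 0 k / tm j t by rewrite mxE.
have -> : (t0 *: v) 0 k = t0 * v 0 k by rewrite mxE.
rewrite dotvZr; move: tn; move: (tm j t) (sp j t 0 k) (dotv v _) => x y p xn.
by field.
Qed.

Lemma boost_curve_spheres t : spheres (g t).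
Proof. by apply: proj_spheres; exact: boosts_light. Qed.

Lemma boost_curve_Ck n : Ck n setT g.
Proof.
apply: Ck_mx => j k.
have -> : (fun s => g s j k) = (fun s => sp j s 0 k * (tm j s)^-1).
  by apply/funext => s; rewrite mxE.
have rap : Ck n setT (fun s : R => a j * (t0 * s)).
  by apply: CkZ; apply: CkZ; exact: Ck_id.
apply: CkM.
  under eq_fun do rewrite spE; apply: CkD; first exact: Ck_cst.
  apply: CkM; last exact: Ck_cst; apply: CkD; apply: CkM; try exact: Ck_cst.
    exact: Ck_sh.
  by apply: CkB; [exact: Ck_ch|exact: Ck_cst].
apply: CkV; first by move=> t _; rewrite gt_eqF.
rewrite (_ : tm j = (fun t => ch (a j * (t0 * t)) * tim (row j X) +
  sh (a j * (t0 * t)) * dotv v (spc (row j X)))); last exact/funext/tmE.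
apply: CkD; apply: CkM; try exact: Ck_cst.
  exact: Ck_ch.
exact: Ck_sh.
Qed.

Lemma boost_curve_dist t : 0 <= t <= 1 ->
  `|g t - proj X| <= 2 * (\sum_j `|a j|) * `|t0|.
Proof.
move=> /andP[ts0 ts1].
have g0 : g 0 = proj X by rewrite /g mulr0 boosts0.
rewrite -g0; set S := \sum_j _.
have S0 : 0 <= S by exact: sumr_ge0.
apply: (@le_trans _ _ (2 * S * `|t0| * (t - 0))); last first.
  by rewrite subr0 ler_piMr// !mulr_ge0.
apply: (@mean_value_mx _ _ _ _ (fun s => hfield a (g s) (t0 *: v))) => // s _.
  exact: boost_curve_derive.
apply/mx_norm_leP; first by rewrite !mulr_ge0.
move=> j k; rewrite hfieldE boost_curve_spheres dotvZl mul1r.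
have -> : (t0 *: v) 0 k = t0 * v 0 k by rewrite mxE.
have aS : `|a j| <= S.
  by rewrite /S (bigD1 j)//= lerDl sumr_ge0.
have unit (x : R) : x ^+ 2 <= 1 -> `|x| <= 1.
  by move=> h; rewrite -(@ler_pXn2r _ 2)// ?nnegrE// real_normK ?num_real// expr1n.
have h1 : `|v 0 k| <= 1 by apply: unit; rewrite -v1 dotv_entry_sqr.
have h2 : `|dotv v (row j (g s))| <= 1.
  apply: unit; apply: le_trans (unit_dotv_le _ v1) _.
  by rewrite boost_curve_spheres.
have h3 : `|g s j k| <= 1.
  apply: le_trans (mx_entry_le _ _ _) _.
  by apply: spheres_norm; exact: boost_curve_spheres.
have -> : a j * (t0 * v 0 k - t0 * dotv v (row j (g s)) * g s j k) =
    a j * (v 0 k - dotv v (row j (g s)) * g s j k) * t0 by ring.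
rewrite !normrM ler_wpM2r// mulrC ler_pM//.
apply: le_trans (ler_normB _ _) _; rewrite (_ : 2 = 1 + 1)// lerD//.
by rewrite normrM mulr_ile1.
Qed.

End BoostPieces.

(** * Strict differentiability and local surjectivity *)

Section Strict.
Context {R : realType} {V : normedModType R}.
Implicit Types (f g : V -> R) (e : R).

Lemma common_lower_bound (I : finType) (del : I -> R) : (forall i, 0 < del i) ->
  exists2 e : R, 0 < e & forall i, e <= del i.
Proof.
move=> d0; have S0 : 0 <= \sum_i (del i)^-1 by apply: sumr_ge0 => i _; rewrite invr_ge0 ltW.
have S1 : 0 < 1 + \sum_i (del i)^-1 by rewrite ltr_pwDl.
exists (1 + \sum_i (del i)^-1)^-1; first by rewrite invr_gt0.
move=> i; rewrite -[leRHS]invrK lef_pV2 ?posrE ?invr_gt0//.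
rewrite (bigD1 i)//= addrCA lerDl addr_ge0//.
by apply: sumr_ge0 => k _; rewrite invr_ge0 ltW.
Qed.

(** Strict differentiability at 0 with derivative 0.  Derivatives enter only
through explicit first-order parts, so no differential has to be computed. *)
Definition strict0 {W : normedModType R} (f : V -> W) : Prop :=
  forall e, 0 < e -> exists2 del : R, 0 < del &
    forall x y, `|x| < del -> `|y| < del -> `|f x - f y| <= e * `|x - y|.

Definition loclip f : Prop := exists C del : R, [/\ 0 <= C, 0 < del &
  forall x y, `|x| < del -> `|y| < del -> `|f x - f y| <= C * `|x - y|].

Lemma strict0_loclip f : strict0 f -> loclip f.
Proof. by move=> /(_ 1 ltr01)[del d0 h]; exists 1, del. Qed.

Lemma strict0D f g : strict0 f -> strict0 g -> strict0 (fun x => f x + g x).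
Proof.
move=> hf hg e e0; have e2 : 0 < e / 2 by rewrite divr_gt0.
have [del d0 h] := hf _ e2; have [del' d0' h'] := hg _ e2.
exists (Num.min del del'); first by rewrite lt_min d0.
move=> x y; rewrite !lt_min => /andP[x1 x2] /andP[y1 y2].
rewrite opprD addrACA; apply: le_trans (ler_normD _ _) _.
by rewrite [e in leRHS]splitr mulrDl lerD// ?h ?h'.
Qed.

Lemma strict0_cst (c : R) : strict0 (fun=> c).
Proof.
by move=> e e0; exists 1 => // x y _ _; rewrite subrr normr0 mulr_ge0// ltW.
Qed.

Lemma loclip_cst (c : R) : loclip (fun=> c).
Proof. by exists 0, 1; split => // x y _ _; rewrite subrr normr0 mul0r. Qed.

Lemma loclipD f g : loclip f -> loclip g -> loclip (fun x => f x + g x).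
Proof.
move=> [C [del [C0 d0 h]]] [C' [del' [C0' d0' h']]].
exists (C + C'), (Num.min del del'); split; [exact: addr_ge0|by rewrite lt_min d0|].
move=> x y; rewrite !lt_min => /andP[x1 x2] /andP[y1 y2].
rewrite opprD addrACA; apply: le_trans (ler_normD _ _) _.
by rewrite mulrDl lerD// ?h ?h'.
Qed.

Lemma loclipZ (c : R) f : loclip f -> loclip (fun x => c * f x).
Proof.
move=> [C [del [C0 d0 h]]]; exists (`|c| * C), del; split => //.
  exact: mulr_ge0.
by move=> x y xd yd; rewrite -mulrBr normrM -mulrA ler_wpM2l// h.
Qed.

Lemma loclip_sum (I : Type) (r : seq I) (F : I -> V -> R) :
  (forall i, loclip (F i)) -> loclip (fun x => \sum_(i <- r) F i x).
Proof.
move=> h; elim: r => [|i r IH].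
  by under eq_fun do rewrite big_nil; exact: loclip_cst.
by under eq_fun do rewrite big_cons; exact: loclipD.
Qed.

Lemma strict0M f g : strict0 f -> f 0 = 0 -> loclip g ->
  strict0 (fun x => f x * g x).
Proof.
move=> hf f0 [C [del [C0 d0 hg]]] e e0.
pose B := `|g 0| + C * del + C + 1.
have B0 : 0 < B by rewrite /B ltr_wpDl// !addr_ge0// mulr_ge0// ltW.
have eB : 0 < e / B by rewrite divr_gt0.
have [del' d0' h] := hf _ eB.
exists (Num.min 1 (Num.min del del')); first by rewrite !lt_min ltr01 d0.
move=> x y; rewrite !lt_min => /andP[x1 /andP[x2 x3]] /andP[y1 /andP[y2 y3]].
have n0 : `|(0 : V)| < del by rewrite normr0.
have n0' : `|(0 : V)| < del' by rewrite normr0.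
have gx : `|g x| <= `|g 0| + C * del.
  have := hg x 0 x2 n0; rewrite subr0 => h1.
  have := ler_normD (g x - g 0) (g 0); rewrite subrK => h2.
  have : C * `|x| <= C * del by rewrite ler_wpM2l// ltW.
  by lra.
have fy : `|f y| <= e / B.
  have := h y 0 y3 n0'; rewrite f0 !subr0 => h1; apply: le_trans h1 _.
  by rewrite ler_piMr// ltW.
have -> : f x * g x - f y * g y = (f x - f y) * g x + f y * (g x - g y) by ring.
apply: le_trans (ler_normD _ _) _; rewrite !normrM.
have h1 : `|f x - f y| * `|g x| <= e / B * `|x - y| * (`|g 0| + C * del).
  by rewrite ler_pM// h.
have h2 : `|f y| * `|g x - g y| <= e / B * (C * `|x - y|) by rewrite ler_pM// hg.
have h3 : e * `|x - y| = e / B * B * `|x - y| by rewrite divfK ?gt_eqF.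
have h4 : 0 <= e / B * `|x - y| by rewrite mulr_ge0// ltW.
rewrite h3 [in leRHS]/B.
apply: le_trans (lerD h1 h2) _; move: h4; set z := e / B; set n := `|x - y|.
set G := `|g 0| + C * del => zn.
have -> : z * (G + C + 1) * n = z * n * G + z * (C * n) + z * n by ring.
by lra.
Qed.

Lemma loclipM0 f g : loclip f -> loclip g -> f 0 = 0 -> g 0 = 0 ->
  strict0 (fun x => f x * g x).
Proof.
move=> [C [del [C0 d0 hf]]] [C' [del' [C0' d0' hg]]] f0 g0 e e0.
have B0 : 0 < 2 * C * C' + 1 by rewrite ltr_wpDl// !mulr_ge0.
pose r := e / (2 * C * C' + 1); have r0 : 0 < r by rewrite divr_gt0.
exists (Num.min r (Num.min del del')); first by rewrite !lt_min r0 d0.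
move=> x y; rewrite !lt_min => /andP[x1 /andP[x2 x3]] /andP[y1 /andP[y2 y3]].
have n0 : `|(0 : V)| < del by rewrite normr0.
have n0' : `|(0 : V)| < del' by rewrite normr0.
have gx : `|g x| <= C' * r.
  have := hg x 0 x3 n0'; rewrite g0 !subr0 => h1; apply: le_trans h1 _.
  by rewrite ler_wpM2l// ltW.
have fy : `|f y| <= C * r.
  have := hf y 0 y2 n0; rewrite f0 !subr0 => h1; apply: le_trans h1 _.
  by rewrite ler_wpM2l// ltW.
have -> : f x * g x - f y * g y = (f x - f y) * g x + f y * (g x - g y) by ring.
apply: le_trans (ler_normD _ _) _; rewrite !normrM.
have h1 : `|f x - f y| * `|g x| <= C * `|x - y| * (C' * r) by rewrite ler_pM// hf.
have h2 : `|f y| * `|g x - g y| <= C * r * (C' * `|x - y|) by rewrite ler_pM// hg.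
have h3 : e = r * (2 * C * C' + 1) by rewrite divfK ?gt_eqF.
apply: le_trans (lerD h1 h2) _; rewrite h3.
have h4 : 0 <= r * `|x - y| by rewrite mulr_ge0// ltW.
move: h4; set n := `|x - y|.
have -> : r * (2 * C * C' + 1) * n =
  C * n * (C' * r) + C * r * (C' * n) + r * n by ring.
by lra.
Qed.

(** By the mean value theorem, [g] is Lipschitz near 0 with a small constant. *)
Lemma strict0_comp (g g' : R -> R) f : (forall t : R, is_derive t 1 g (g' t)) ->
  continuous_at 0 g' -> g' 0 = 0 -> loclip f -> f 0 = 0 ->
  strict0 (fun x => g (f x)).
Proof.
move=> dg cg g0 [C [del [C0 d0 hf]]] f0 e e0.
have C1 : 0 < C + 1 by rewrite ltr_wpDl.
have eC : 0 < e / (C + 1) by rewrite divr_gt0.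
have /cvgrPdist_le/(_ _ eC) := cg; rewrite -nbhs_nearE => /nbhs_ballP[r /= r0 hr].
have small s t : `|s| < r -> `|t| < r -> `|g s - g t| <= e / (C + 1) * `|s - t|.
  move=> sr tr; wlog ts : s t sr tr / t <= s.
    move=> H; have /orP[ts|ts] := le_total t s; first exact: H.
    by rewrite (distrC (g s)) (distrC s); exact: H.
  rewrite [X in _ * X]ger0_norm ?subr_ge0//.
  apply: (@mean_value_le _ _ g') => // x /andP[x1 x2].
  have : ball (0 : R) r x.
    move: sr tr; rewrite /ball /= sub0r normrN !ltr_norml => /andP[h1 h2] /andP[h3 h4].
    by apply/andP; split; lra.
  by move=> /hr; rewrite /= g0 sub0r normrN.
exists (Num.min del (r / (C + 1))); first by rewrite lt_min d0 divr_gt0.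
have n0 : `|(0 : V)| < del by rewrite normr0.
have fr x : `|x| < Num.min del (r / (C + 1)) -> `|f x| < r.
  rewrite lt_min => /andP[x1 x2].
  have := hf x 0 x1 n0; rewrite f0 !subr0 => h1; apply: le_lt_trans h1 _.
  apply: (@le_lt_trans _ _ ((C + 1) * `|x|)); first by rewrite ler_wpM2r// lerDl.
  by rewrite mulrC -ltr_pdivlMr.
move=> x y xd yd; apply: le_trans (small _ _ (fr x xd) (fr y yd)) _.
move: xd yd; rewrite !lt_min => /andP[x1 _] /andP[y1 _].
apply: (@le_trans _ _ (e / (C + 1) * (C * `|x - y|))).
  by rewrite ler_wpM2l ?hf// ltW.
rewrite mulrA ler_wpM2r// mulrAC ler_pdivrMr// ler_wpM2l//; first exact: ltW.
by rewrite lerDl.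
Qed.

Lemma strict0_ch1 f : loclip f -> f 0 = 0 -> strict0 (fun x => ch (f x) - 1).
Proof.
move=> hf f0; apply: (strict0_comp (g := fun t => ch t - 1) (g' := sh)) => //.
- move=> t; have := is_deriveB (is_derive_ch t) (is_derive_cst (1 : R) t 1).
  by rewrite subr0.
- apply/differentiable_continuous/derivable1_diffP.
  by have [] := is_derive_sh (0 : R).
- exact: sh0.
Qed.

Lemma strict0_sh f : loclip f -> f 0 = 0 -> strict0 (fun x => sh (f x) - f x).
Proof.
move=> hf f0.
apply: (strict0_comp (g := fun t => sh t - t) (g' := fun t => ch t - 1)) => //.
- by move=> t; exact: (is_deriveB (is_derive_sh t) (is_derive_id t 1)).
- apply: continuousB; last exact: cst_continuous.
  apply/differentiable_continuous/derivable1_diffP.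
  by have [] := is_derive_ch (0 : R).
- by rewrite ch0 subrr.
Qed.

Lemma strict0_mx p q (f : V -> 'M[R]_(p, q)) :
  (forall i j, strict0 (fun x => f x i j)) -> strict0 f.
Proof.
move=> h e e0.
have /choice[del hdel] : forall ij : 'I_p * 'I_q, exists del : R, 0 < del /\
    forall x y, `|x| < del -> `|y| < del ->
      `|f x ij.1 ij.2 - f y ij.1 ij.2| <= e * `|x - y|.
  by move=> [i j]; have [del d0 hd] := h i j e e0; exists del.
have [r r0 hr] := common_lower_bound (fun ij => (hdel ij).1).
exists r => // x y xr yr; apply/mx_norm_leP; first by rewrite mulr_ge0// ltW.
move=> i j; rewrite !mxE; apply: (hdel (i, j)).2.
  exact: lt_le_trans (hr _).
exact: lt_le_trans (hr _).
Qed.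

End Strict.

(** Joins the norm of matrices to their completeness: the contraction principle
requires a structure with both. *)
HB.instance Definition _ (R : realType) (p q : nat) :=
  NormedModule.on 'M[R]_(p, q).

(** A map whose strict derivative at 0 is the identity hits every point near
its value at 0: Newton's iteration with frozen derivative is a contraction. *)
Lemma locally_surjective {R : realType} {p q : nat}
    (F : 'M[R]_(p, q) -> 'M[R]_(p, q)) (r : R) :
  0 < r -> strict0 (fun u => F u - u) ->
  exists2 rho : R, 0 < rho & forall z, `|z - F 0| < rho ->
    exists2 u, `|u| < r & F u = z.
Proof.
move=> r0 hF.
have h2 : 0 < (2^-1 : R) by rewrite invr_gt0.
have [del d0 hd] := hF _ h2.
pose s := Num.min r del / 2.
have m0 : 0 < Num.min r del by rewrite lt_min r0.
have s0 : 0 < s by rewrite divr_gt0.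
have sm : s < Num.min r del by rewrite /s; lra.
exists (s / 2); first by rewrite divr_gt0.
move=> z zr.
pose U : set 'M[R]_(p, q) := [set u | `|u| <= s].
pose f u := z - (F u - u).
have fd u : U u -> `|u| < del.
  by move=> /le_lt_trans-/(_ _ sm); rewrite lt_min => /andP[].
have U0 : U 0 by rewrite /U/= normr0 ltW.
have fU : {homo f : u / U u}.
  move=> u Uu; rewrite /U /= /f.
  have -> : z - (F u - u) = (z - F 0) - ((F u - u) - (F 0 - 0)).
    by apply/matrixP => i j; rewrite !mxE; ring.
  apply: le_trans (ler_normB _ _) _.
  have := hd u 0 (fd u Uu) (fd 0 U0); rewrite [in X in _ * X]subr0 => h.
  have : `|u| <= s by exact: Uu.
  by lra.
have ctr : is_contraction (mkfun fU).
  exists (2^-1)%:nng; split; first by rewrite /=; lra.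
  move=> [x y] [/= Ux Uy]; rewrite /f.
  have -> : z - (F x - x) - (z - (F y - y)) = - ((F x - x) - (F y - y)).
    by apply/matrixP => i j; rewrite !mxE; ring.
  by rewrite normrN; apply: hd; exact: fd.
have Uc : closed U.
  rewrite (_ : U = (fun u => `|u|) @^-1` [set x | x <= s])//.
  by apply: closed_comp; [move=> x _; exact: norm_continuous|exact: closed_le].
have [u Uu uE] := banach_fixed_point ctr Uc (ex_intro _ 0 U0).
exists u; first by move: (le_lt_trans Uu sm); rewrite lt_min => /andP[].
have /= : u = z - (F u - u) by [].
by move=> /eqP; rewrite eq_sym subr_eq addrC subrK => /eqP ->.
Qed.

(** * Local accessibility *)

Section Conjugates.
Context {R : realType} {m d : nat}.
Notation E := 'M[R]_(m, d).
Notation H := 'M[R]_(m, 1 + d).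
Variable a : 'I_m -> R.
Implicit Types (X : H) (v w : 'rV[R]_d) (t s : R).

Definition conj_boosts v w t s X : H :=
  boosts a w (- t) (boosts a v s (boosts a w t X)).

(** The generator of the conjugate of the boosts along [v] by the boost of
rapidity [t] along [w]. *)
Definition conj_gen v w t : 'M[R]_(1 + d) :=
  boost w t *m gen v *m boost w (- t).

Lemma conj_boosts_light v w t s X : dotv v v = 1 -> dotv w w = 1 ->
  light_rows X -> light_rows (conj_boosts v w t s X).
Proof. by move=> v1 w1 LX; do 3 apply: boosts_light => //. Qed.

(** The powers of a conjugate are conjugates of the powers. *)
Lemma row_conj_boosts v w t s X j : dotv v v = 1 -> dotv w w = 1 ->
  row j (conj_boosts v w t s X) = row j X +
    sh (a j * s) *: (row j X *m conj_gen v w (a j * t)) +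
    (ch (a j * s) - 1) *:
      (row j X *m conj_gen v w (a j * t) *m conj_gen v w (a j * t)).
Proof.
move=> v1 w1; rewrite /conj_boosts !row_boosts mulrN (mul_boost v).
rewrite !mulmxDl -!scalemxAl (boostD w1 (a j * t) (- (a j * t))) subrr boost0//.
congr (_ + _ *: _ + _ *: _); rewrite /conj_gen !mulmxA//.
set y := row j X *m _ *m _.
by rewrite (boostD w1 (- (a j * t)) (a j * t) y) addNr (boost0 w y).
Qed.

(** The conjugate generator is [ch t] times the boost along [v] plus [sh t] times
a rotation in the plane of [v] and [w]; adding both signs of [t] cancels the
rotation. *)
Lemma spc_conj_gen_even v w t (x : 'rV[R]_(1 + d)) : dotv v v = 1 ->
  dotv w w = 1 -> dotv v w = 0 -> tim x = 1 ->
  spc (x *m conj_gen v w t) + spc (x *m conj_gen v w (- t)) = (2 * ch t) *: v.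
Proof.
move=> v1 w1 vw x1.
have h r : spc (x *m conj_gen v w r) =
    (ch r + sh r * dotv w (spc x)) *: v - (sh r * dotv v (spc x)) *: w.
  rewrite /conj_gen !mulmxA spc_boost// tim_gen spc_gen tim_boost// spc_boost//.
  rewrite dotvZr (dotvC w v) vw mulr0 mulr0 addr0 dotvDr dotvZr vw mulr0 addr0.
  by rewrite x1 mulr1 shN mulNr scaleNr.
by rewrite !h chN shN; apply/rowP => k; rewrite !mxE; ring.
Qed.

End Conjugates.

Section Endpoint.
Context {R : realType} {m d : nat}.
Notation E := 'M[R]_(m, d).
Notation H := 'M[R]_(m, 1 + d).
Variables (a : 'I_m -> R) (I : eqType) (v w : I -> 'rV[R]_d) (t : I -> R)
  (s : I -> E -> R).
Hypotheses (v1 : forall i, dotv (v i) (v i) = 1)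
  (w1 : forall i, dotv (w i) (w i) = 1).
Implicit Types (X : H) (r : seq I) (u : E).

Definition endpoint r X u : H :=
  foldl (fun X i => conj_boosts a (v i) (w i) (t i) (s i u) X) X r.

Lemma endpoint_rcons r i X u : endpoint (rcons r i) X u =
  conj_boosts a (v i) (w i) (t i) (s i u) (endpoint r X u).
Proof. by rewrite /endpoint -cats1 foldl_cat. Qed.

Lemma endpoint_light r X u : light_rows X -> light_rows (endpoint r X u).
Proof.
by move=> LX; elim/last_ind: r => // r i IH; rewrite endpoint_rcons;
  exact: conj_boosts_light.
Qed.

Section FirstOrder.
Hypotheses (s0 : forall i, s i 0 = 0) (sl : forall i, loclip (s i)).
Variable X : H.

Definition endpoint_linear r u j k : R :=
  \sum_(i <- r) s i u *
    (a j * (row j X *m conj_gen (v i) (w i) (a j * t i)) 0 k).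

Lemma endpoint0 r : endpoint r X 0 = X.
Proof.
elim/last_ind: r => // r i IH; rewrite endpoint_rcons IH.
apply/row_matrixP => j; rewrite row_conj_boosts// s0 mulr0 sh0 ch0 subrr.
by rewrite !scale0r !addr0.
Qed.

(** To first order the conjugate boosts add up, each being evaluated at the
initial point. *)
Lemma endpoint_first_order r j k :
  strict0 (fun u => endpoint r X u j k - X j k - endpoint_linear r u j k).
Proof.
elim/last_ind: r j k => [|r i IH] j k.
  move=> e e0; exists 1 => // x y _ _.
  by rewrite /endpoint_linear !big_nil /= !subrr normr0 mulr_ge0// ltW.
have llin l : loclip (fun u => endpoint_linear r u j l).
  apply: loclip_sum => i'.
  by under eq_fun do rewrite mulrC; exact: loclipZ.
have lent l : loclip (fun u => endpoint r X u j l).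
  have -> : (fun u => endpoint r X u j l) = (fun u =>
      (endpoint r X u j l - X j l - endpoint_linear r u j l) +
      (X j l + endpoint_linear r u j l)).
    by apply/funext => u; ring.
  apply: loclipD; first exact/strict0_loclip/IH.
  by apply: loclipD => //; exact: loclip_cst.
pose Q := conj_gen (v i) (w i) (a j * t i).
have lmul (M : 'M[R]_(1 + d)) l : loclip (fun u => (row j (endpoint r X u) *m M) 0 l).
  under eq_fun do rewrite mxE.
  apply: loclip_sum => l'; under eq_fun do rewrite mulrC mxE.
  exact: loclipZ.
pose q0 := (row j X *m Q) 0 k.
pose q1 u := (row j (endpoint r X u) *m Q) 0 k.
pose q2 u := (row j (endpoint r X u) *m Q *m Q) 0 k.
have lq1 : loclip q1 by exact: lmul.
have lq2 : loclip q2.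
  by rewrite /q2; under eq_fun do rewrite -mulmxA; exact: lmul.
have las : loclip (fun u => a j * s i u) by exact: loclipZ.
have as0 : a j * s i 0 = 0 by rewrite s0 mulr0.
have -> : (fun u => endpoint (rcons r i) X u j k - X j k -
      endpoint_linear (rcons r i) u j k) =
    (fun u => ((endpoint r X u j k - X j k - endpoint_linear r u j k) +
      (sh (a j * s i u) - a j * s i u) * q1 u) +
      ((a j * s i u) * (q1 u + - q0) + (ch (a j * s i u) - 1) * q2 u)).
  (* q0 is the value of q1 at the initial point *)
  apply/funext => u; rewrite /endpoint_linear -cats1 big_cat big_seq1/=.
  rewrite cats1 endpoint_rcons.
  have rE : forall Y : H, Y j k = row j Y 0 k by move=> Y; rewrite mxE.
  rewrite rE row_conj_boosts// -/Q -/q0.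
  have lin (x y z : 'rV[R]_(1 + d)) (k1 k2 : R) :
      (x + k1 *: y + k2 *: z) 0 k = x 0 k + k1 * y 0 k + k2 * z 0 k.
    by rewrite !mxE.
  rewrite lin -rE -/(q1 u) -/(q2 u); ring.
apply: strict0D.
  apply: strict0D; first exact: IH.
  apply: strict0M => //; first exact: strict0_sh.
  by rewrite as0 sh0 subrr.
apply: strict0D.
  apply: loclipM0 => //.
    by apply: loclipD => //; exact: loclip_cst.
  by rewrite /q1 endpoint0 subrr.
apply: strict0M => //; first exact: strict0_ch1.
by rewrite as0 ch0 subrr.
Qed.

End FirstOrder.

Section Reach.
Variables (U : set 'rV[R]_d) (q : E) (e : R).
Hypotheses (Ureg : U `<=` regular_value a)
  (Uq : forall z : E, `|z - q| < e -> U (wsum a z)).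

Let A : R := \sum_j `|a j|.

Lemma boosts_reach X x (r K rho : R) : dotv x x = 1 -> light_rows X ->
  2 * A * `|r| <= K -> `|proj X - q| <= rho -> rho + K < e ->
  reach a U (proj X) (proj (boosts a x r X)) /\
  `|proj (boosts a x r X) - q| <= rho + K.
Proof.
move=> x1 LX rK Xrho near.
pose g (y : R) := proj (boosts a x (r * y) X).
have g0 : g 0 = proj X by rewrite /g mulr0 boosts0.
have g1 : g 1 = proj (boosts a x r X) by rewrite /g mulr1.
have dist (y : R) : 0 <= y <= 1 -> `|g y - q| <= rho + K.
  move=> y01; have h := le_trans (boost_curve_dist a r x1 LX y01) rK.
  rewrite -(subrKA (proj X)) addrC; apply: le_trans (ler_normD _ _) _.
  by rewrite lerD.
split; last by rewrite -g1; apply: dist; rewrite ler01 lexx.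
rewrite -g0 -g1; apply: (reach_control_piece Ureg); split.
- by move=> n; exact: boost_curve_Ck.
- move=> y; have Sg := boost_curve_spheres a r x1 LX y; split; first exact: Sg.
  rewrite (derive1_val (boost_curve_derive a r x1 LX y)).
  exact: hfield_horizontal.
- by move=> y y01; apply: Uq; apply: le_lt_trans near; exact: dist.
Qed.

(** Every boost moves the points by at most [K]; the budget [e] guarantees that
f stays in [U] throughout. *)
Lemma endpoint_reach r X u (K rho : R) : light_rows X -> 0 <= K ->
  (forall i, 2 * A * `|t i| <= K) -> (forall i, 2 * A * `|s i u| <= K) ->
  `|proj X - q| <= rho -> rho + (size r)%:R * (3 * K) < e ->
  reach a U (proj X) (proj (endpoint r X u)).
Proof.
move=> LX0 K0 tK sK; elim: r X LX0 rho => [|i r IH] X LX rho Xrho.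
  by move=> _; exact: reach_refl.
rewrite [size _]/= -natr1 mulrDl mul1r => near.
have tNK : 2 * A * `|- t i| <= K by rewrite normrN.
have rest : 0 <= (size r)%:R * (3 * K) by rewrite !mulr_ge0.
have near3 : rho + K + K + K + (size r)%:R * (3 * K) < e.
  by apply: le_lt_trans near; rewrite le_eqVlt; apply/orP; left; apply/eqP; ring.
have near2 : rho + K + K + K < e by apply: le_lt_trans near3; rewrite lerDl.
have near1 : rho + K + K < e by apply: le_lt_trans near2; rewrite lerDl.
have near0 : rho + K < e by apply: le_lt_trans near1; rewrite lerDl.
have [r1 n1] := boosts_reach (w1 i) LX (tK i) Xrho near0.
have LX1 := boosts_light a (t i) (w1 i) LX.
have [r2 n2] := boosts_reach (v1 i) LX1 (sK i) n1 near1.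
have LX2 := boosts_light a (s i u) (v1 i) LX1.
have [r3 n3] := boosts_reach (w1 i) LX2 tNK n2 near2.
have LX3 := boosts_light a (- t i) (w1 i) LX2.
have r4 := IH _ LX3 _ n3 near3.
exact: reach_trans r1 (reach_trans r2 (reach_trans r3 r4)).
Qed.

End Reach.
End Endpoint.

(** By the Chebyshev recursion ch((l+1)x) + ch((l-1)x) = 2 ch(x) ch(l x), a linear
relation between the columns is also one between the vectors of powers of the
numbers [ch (a j * tau)]; these are distinct, so the Vandermonde determinant
excludes it. *)
Lemma ch_matrix_unit {R : realType} {m : nat} (a : 'I_m -> R) (tau : R) :
  (forall j, 0 < a j) -> injective a -> 0 < tau ->
  (\matrix_(l < m, j < m) (2 * a j * ch (a j * (l%:R * tau)))) \in unitmx.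
Proof.
move=> a0 ainj tau0; set M := \matrix_(l, j) _.
rewrite unitmxE unitfE -det_tr; apply/negP => /det0P[mu mu0 muM].
pose x j := ch (a j * tau).
have S l : (l < m)%N -> \sum_j mu 0 j * a j * ch (a j * (l%:R * tau)) = 0.
  move=> lm; have /rowP/(_ (Ordinal lm)) := muM; rewrite !mxE.
  move=> h; apply: (@mulfI _ 2); first by rewrite pnatr_eq0.
  rewrite mulr0 -[RHS]h mulr_sumr; apply: eq_bigr => j _; rewrite !mxE /=; ring.
have Sk k : forall l, (k + l < m)%N ->
    \sum_j mu 0 j * a j * x j ^+ k * ch (a j * (l%:R * tau)) = 0.
  elim: k => [|k IH] l klm.
    by rewrite -[RHS](S l)//; apply: eq_bigr => j _; rewrite expr0 mulr1.
  have [l0|l0] := posnP l.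
    have := IH 1%N; rewrite addn1 => /(_ _) h; rewrite l0.
    rewrite -[RHS]h; last by move: klm; rewrite l0 addn0.
    apply: eq_bigr => j _; rewrite mul0r mulr0 ch0 mul1r exprSr /x; ring.
  have kl1 : (k + l.+1 < m)%N by rewrite addnS -addSn.
  have kl2 : (k + l.-1 < m)%N.
    apply: leq_ltn_trans klm; rewrite addSn.
    by apply: leq_trans (leqnSn _); rewrite leq_add2l leq_pred.
  have := congr2 (fun x y => x + y) (IH _ kl1) (IH _ kl2); rewrite addr0 => h.
  apply: (@mulfI _ 2); first by rewrite pnatr_eq0.
  rewrite mulr0 -[RHS]h.
  rewrite mulr_sumr -big_split/=; apply: eq_bigr => j _.
  rewrite -mulrDr.
  have -> : ch (a j * (l.+1%:R * tau)) + ch (a j * (l.-1%:R * tau)) =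
      2 * x j * ch (a j * (l%:R * tau)).
    have -> : a j * (l.+1%:R * tau) = a j * (l%:R * tau) + a j * tau.
      by rewrite -natr1; ring.
    have -> : a j * (l.-1%:R * tau) = a j * (l%:R * tau) + - (a j * tau).
      by rewrite -{2}(prednK l0) -natr1; ring.
    by rewrite !chD chN shN /x; ring.
  by rewrite exprSr; ring.
pose V := Vandermonde m (\row_j x j).
have : (\row_j (mu 0 j * a j)) *m V^T = 0.
  apply/rowP => k; rewrite !mxE -[RHS](Sk k 0%N); last by rewrite addn0.
  apply: eq_bigr => j _; rewrite !mxE mul0r mulr0 ch0 mulr1; reflexivity.
have Vu : V^T \in unitmx.
  rewrite unitmxE unitfE det_tr det_Vandermonde.
  apply/prodf_neq0 => i _; apply/prodf_neq0 => j ij; rewrite !mxE subr_eq0.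
  apply/eqP => /ch_inj h.
  have aij : a j * tau = a i * tau by apply: h; rewrite mulr_ge0// ltW.
  have /ainj E : a j = a i by apply: (mulIf (lt0r_neq0 tau0)).
  by move: ij; rewrite E ltnn.
move=> /(congr1 (mulmx^~ (invmx V^T))); rewrite mulmxK// mul0mx => mua.
case/negP: mu0; apply/eqP/rowP => j.
have /rowP/(_ j) := mua; rewrite !mxE => /eqP.
by rewrite mulf_eq0 (gt_eqF (a0 j)) orbF => /eqP.
Qed.

Section Accessibility.
Context {R : realType} {m d : nat}.
Notation E := 'M[R]_(m, d).
Variables (a : 'I_m -> R) (U : set 'rV[R]_d).
Hypotheses (hd : (2 <= d)%N) (a0 : forall j, 0 < a j) (ainj : injective a)
  (Uo : open U) (Ureg : U `<=` regular_value a).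

Lemma other_index (i : 'I_d) : exists i' : 'I_d, i != i'.
Proof.
have d0 : (0 < d)%N by exact: ltnW.
have [i0|i0] := eqVneq i (Ordinal d0).
  by exists (Ordinal hd); rewrite i0.
by exists (Ordinal d0).
Qed.

(** Performing, for all coordinate directions, conjugate boosts with [m]
different conjugating rapidities and both signs gives a chart: the durations
can be chosen as linear functions of a prescribed first-order displacement of
the space components, because the matrix of [ch_matrix_unit] is invertible. *)
Lemma local_reach q : spheres q -> U (wsum a q) ->
  exists2 rho : R, 0 < rho & forall z, spheres z -> `|z - q| < rho ->
    reach a U q z.
Proof.
move=> Sq Uq.
have [e e0 he] : exists2 e : R, 0 < e &
    forall z : E, `|z - q| < e -> U (wsum a z).
  have : nbhs (wsum a q) U by exact: open_nbhs_nbhs.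
  move=> /wsum_continuous; rewrite /= => /nbhs_ballP[e /= e0 h].
  exists e => // z zq; apply: h.
  by rewrite -ball_normE /ball_/= distrC.
pose A : R := \sum_j `|a j|.
have A0 : 0 <= A by exact: sumr_ge0.
pose I : finType := ('I_d * 'I_m * bool)%type.
(* K bounds the displacement under a single boost, eta the durations *)
pose N : R := (size (enum I))%:R * 3 + 1.
have N0 : 0 < N by rewrite ltr_wpDl// mulr_ge0.
pose K := e / (2 * N); have K0 : 0 < K by rewrite divr_gt0// mulr_gt0.
have NK : (size (enum I))%:R * (3 * K) < e.
  have : N * K = e / 2 by rewrite /K; field; rewrite gt_eqF.
  rewrite /N; lra.
pose eta := K / (2 * A + 1).
have A1 : 0 < 2 * A + 1 by rewrite ltr_wpDl// mulr_ge0.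
have eta0 : 0 < eta by rewrite divr_gt0.
have etaK (x : R) : `|x| <= eta -> 2 * A * `|x| <= K.
  move=> xe; apply: (@le_trans _ _ ((2 * A + 1) * eta)).
    by rewrite ler_pM ?mulr_ge0// lerDl.
  by rewrite /eta mulrC divfK// gt_eqF.
pose tau := eta / (m%:R + 1).
have m1 : 0 < m%:R + 1 :> R by rewrite ltr_wpDl.
have tau0 : 0 < tau by rewrite divr_gt0.
have /choice[other hother] := other_index.
pose M : 'M[R]_m := \matrix_(l, j) (2 * a j * ch (a j * (l%:R * tau))).
have Mu : M \in unitmx by exact: ch_matrix_unit.
pose D := invmx M.
have MD (i j : 'I_m) : \sum_l D i l * M l j = (i == j)%:R.
  by have /matrixP/(_ i j) := mulVmx Mu; rewrite !mxE.
pose v (k : I) : 'rV[R]_d := delta_mx 0 k.1.1.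
pose w (k : I) : 'rV[R]_d := delta_mx 0 (other k.1.1).
pose t (k : I) : R := if k.2 then k.1.2%:R * tau else - (k.1.2%:R * tau).
pose s (k : I) (u : E) : R := \sum_j u j k.1.1 * D j k.1.2.
have v1 k : dotv (v k) (v k) = 1 by rewrite dotv_delta mxE !eqxx.
have w1 k : dotv (w k) (w k) = 1 by rewrite dotv_delta mxE !eqxx.
have s0 k : s k 0 = 0 by rewrite /s big1// => j _; rewrite mxE mul0r.
have sl k : loclip (s k).
  apply: loclip_sum => j; under eq_fun do rewrite mulrC; apply: loclipZ.
  exists 1, 1; split => // x y _ _; rewrite mul1r.
  by apply: le_trans (mx_entry_le _ j k.1.1); rewrite !mxE.
have teta k : `|t k| <= eta.
  have -> : `|t k| = k.1.2%:R * tau.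
    have h : 0 <= k.1.2%:R * tau by rewrite mulr_ge0// ltW.
    by rewrite /t; case: k.2; rewrite ?normrN ger0_norm.
  apply: (@le_trans _ _ ((m%:R + 1) * tau)).
    rewrite ler_wpM2r ?(ltW tau0)// (le_trans (_ : _ <= m%:R))// ?lerDl//.
    by rewrite ler_nat ltnW// ltn_ord.
  by rewrite /tau mulrC divfK// gt_eqF.
pose X := homog q.
have LX : light_rows X by exact: light_homog.
pose F u : E := \matrix_(j, k) spc (row j (endpoint a v w t s (enum I) X u)) 0 k.
have F0 : F 0 = q.
  by apply/matrixP => j k; rewrite mxE endpoint0// spc_homog mxE.
have pair_sum (c : 'I_d * 'I_m) (j : 'I_m) (k : 'I_d) :
    spc (row j X *m conj_gen (v (c, true)) (w (c, true)) (a j * t (c, true))) 0 k +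
    spc (row j X *m conj_gen (v (c, false)) (w (c, false)) (a j * t (c, false))) 0 k
    = 2 * ch (a j * (c.2%:R * tau)) * (c.1 == k)%:R.
  have vw : dotv (v (c, true)) (w (c, true)) = 0.
    by rewrite dotv_delta mxE eqxx eq_sym (negPf (hother c.1)).
  rewrite /t /= mulrN.
  have := spc_conj_gen_even (a j * (c.2%:R * tau)) (v1 (c, true)) (w1 (c, true))
    vw (tim_homog q j).
  by move=> /rowP/(_ k); rewrite [LHS]mxE => ->; rewrite !mxE eqxx eq_sym.
(* the first-order displacement of the space part is the parameter itself *)
have lin u (j : 'I_m) (k : 'I_d) :
    endpoint_linear a v w t s X (enum I) u j (rshift 1 k) = u j k.
  rewrite /endpoint_linear big_enum/=.
  rewrite (eq_bigr (fun c : I => s c u * (a j * spc (row j X *m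
    conj_gen (v c) (w c) (a j * t c)) 0 k))); last by move=> c _; rewrite [spc _ _ _]mxE.
  rewrite -(pair_bigA _ (fun (c : 'I_d * 'I_m) (b : bool) => s (c, b) u * (a j *
    spc (row j X *m conj_gen (v (c, b)) (w (c, b)) (a j * t (c, b))) 0 k)))/=.
  rewrite (eq_bigr (fun c : 'I_d * 'I_m =>
      (\sum_j' u j' c.1 * D j' c.2) * (M c.2 j * (c.1 == k)%:R))); last first.
    move=> c _; rewrite big_bool /= -[s (c, true) u]/(s (c, false) u) -mulrDr.
    by rewrite -mulrDr pair_sum [M _ _]mxE; congr (_ * _); ring.
  rewrite -(pair_bigA _ (fun (i : 'I_d) (l : 'I_m) =>
    (\sum_j' u j' i * D j' l) * (M l j * (i == k)%:R)))/=.
  rewrite (bigD1 k)//= [X in _ + X]big1 ?addr0; last first.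
    by move=> i /negPf ik; rewrite big1// => l _; rewrite ik !mulr0.
  rewrite (eq_bigr (fun l => \sum_j' u j' k * (D j' l * M l j))); last first.
    move=> l _; rewrite eqxx mulr1 mulr_suml; apply: eq_bigr => j' _.
    by rewrite mulrA.
  rewrite exchange_big /= (bigD1 j)//= [X in _ + X]big1 ?addr0; last first.
    by move=> j' /negPf jj; rewrite -mulr_sumr MD jj mulr0.
  by rewrite -mulr_sumr MD eqxx mulr1.
have Fstrict : strict0 (fun u => F u - u).
  apply: strict0_mx => j k.
  have := endpoint_first_order a t v1 w1 s0 sl X (enum I) j (rshift 1 k).
  move=> h; have hq := strict0D h (@strict0_cst _ _ (q j k)).
  rewrite (_ : (fun u => (F u - u) j k) = (fun u => endpoint a v w t s (enum I) X u
    j (rshift 1 k) - X j (rshift 1 k) -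
    endpoint_linear a v w t s X (enum I) u j (rshift 1 k) + q j k))//.
  apply/funext => u; rewrite lin [LHS]mxE [F u j k]mxE [(- u) j k]mxE.
  have -> : q j k = X j (rshift 1 k).
    have := congr1 (fun x : 'rV[R]_d => x 0 k) (spc_homog q j).
    by rewrite /spc !mxE.
  by rewrite /spc !mxE; ring.
have [del del0 hs] : exists2 del : R, 0 < del &
    forall k u, `|u| < del -> `|s k u| <= eta.
  have /choice[dl hdl] : forall k, exists dl : R, 0 < dl /\
      forall u : E, `|u| < dl -> `|s k u| <= eta.
    move=> k; have [C [dl [C0 dl0 hC]]] := sl k.
    have C1 : 0 < C + 1 by rewrite ltr_wpDl.
    exists (Num.min dl (eta / (C + 1))); rewrite lt_min dl0 divr_gt0//.
    split => // u; rewrite lt_min => /andP[u1 u2].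
    have := hC u 0 u1; rewrite normr0 s0 !subr0 => /(_ dl0) h; apply: le_trans h _.
    apply: (@le_trans _ _ ((C + 1) * `|u|)); first by rewrite ler_wpM2r// lerDl.
    by rewrite mulrC -ler_pdivlMr// ltW.
  have [r r0 hr] := common_lower_bound (fun k => (hdl k).1).
  by exists r => // k u ur; apply: (hdl k).2; exact: lt_le_trans (hr k).
have [rho rho0 hrho] := locally_surjective del0 Fstrict.
rewrite F0 in hrho.
exists rho => // z Sz zq; have [u ud Fu] := hrho z zq.
have -> : z = proj (endpoint a v w t s (enum I) X u).
  have LE := endpoint_light a t s v1 w1 (enum I) u LX.
  apply/matrixP => j k; rewrite mxE.
  have spz : spc (row j (endpoint a v w t s (enum I) X u)) = row j z.
    by rewrite -Fu rowK.
  have [tp tt] := LE j; rewrite spz Sz in tt.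
  have -> : tim (row j (endpoint a v w t s (enum I) X u)) = 1.
    by apply/eqP; rewrite -(eqrXn2 (n := 2))// ?tt ?expr1n ?ltW.
  by rewrite spz divr1 mxE.
rewrite -{1}(proj_homog q) -/X.
apply: (endpoint_reach v1 w1 Ureg he LX (ltW K0) (rho := 0)).
- by move=> k; apply: etaK.
- by move=> k; apply: etaK; exact: hs.
- by rewrite /X proj_homog subrr normr0.
- by rewrite add0r.
Qed.

End Accessibility.

(** A sequence of [m] elements with [m] distinct non-zero values has neither
repetitions nor zeros. *)
Lemma sharp_injective {R : realType} {m : nat} (a : 'I_m -> R) :
  sharp a = m -> injective a /\ forall j, a j != 0.
Proof.
rewrite /sharp; set nz := [seq x <- codom a | x != 0] => h.
have sz : size (codom a) = m by rewrite size_codom card_ord.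
have nzm : size nz = m.
  apply/eqP; rewrite eqn_leq -{2}h size_undup andbT.
  by rewrite size_filter -[X in (_ <= X)%N]sz count_size.
have al : all (fun x => x != 0) (codom a).
  by rewrite all_count -size_filter -/nz nzm sz.
split; last by move=> j; have /allP := al; apply; exact: codom_f.
apply/injectiveP; rewrite /injectiveb /dinjectiveb -/(codom a).
have := ltn_size_undup nz; rewrite h nzm ltnn => /esym/negbFE.
by rewrite /nz (all_filterP al).
Qed.

(** * The holonomy group acts transitively on components *)

Theorem proposition6p2 (R : realType) (d m : nat) (hd : (2 <= d)%N)
    (hm : (1 <= m)%N) (a : 'I_m -> R) (ha : forall j, 0 <= a j)
    (b : 'rV[R]_d) (hb : regular_value a b)
    (U : set 'rV[R]_d) (hUo : open U) (hUreg : U `<=` regular_value a)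
    (hUb : U b) (hsharp : sharp a = m) :
  forall q : fiber a b,
    acts_transitively_on (holonomy_group a b U)
      (connected_component [set: fiber a b] q).
Proof.
move=> q; have [ainj an0] := sharp_injective hsharp.
have a0 j : 0 < a j by rewrite lt_def an0 ha.
split.
  move=> h x Hh qx; apply: connected_component_trans qx _.
  exact: (holonomy_component hUreg).
move=> x y qx qy.
suff rxy : reach a U (\val x) (\val y) by exact: (reach_holonomy hUb rxy).
have xy : connected_component [set: fiber a b] x y.
  by apply: connected_component_trans qy; exact: connected_component_sym.
have [A [Ax _ Ac] Ay] := xy.
apply: (locally_constant_connected Ac
  (P := fun p : fiber a b => reach a U (\val x) (\val p)) _ Ax Ay); last first.
  exact: reach_refl.
move=> p _; have [Sp fp] := set_valP p.
have Up : U (wsum a (\val p)) by rewrite fp.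
have [rho rho0 hrho] := local_reach hd a0 ainj hUo hUreg Sp Up.
exists ((set_val : fiber a b -> 'M[R]_(m, d)) @^-1` ball (\val p) rho); split.
- by apply: open_comp; [move=> z _; exact: initial_continuous|exact: ball_open].
- exact: ballxx.
move=> p' _ /= pp'.
have [Sp' fp'] := set_valP p'.
have r1 : reach a U (\val p) (\val p').
  apply: hrho => //; rewrite distrC.
  by move: pp'; rewrite -ball_normE.
split=> h; first exact: reach_trans h r1.
exact: reach_trans h (reach_sym hUreg r1).
Qed.
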